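(* Let $T:[0,1]\to[0,1]$ be the map $$T(x)=\begin{cases}\big(a+(x-\tfrac18)^{1/3}\big)e^{-x}+b,&0\le x\le0.3,\\ c\,\big(10x\,e^{-10x/3}\big)^{19}+b,&0.3\le x\le1,\end{cases}$$ with $a=\frac{19}{42}\left(\frac75\right)^{1/3}$, $c=\frac{20}{3^{20}\cdot7}\left(\frac75\right)^{1/3}e^{187/10}$ and $$b=0.02328852830307032054478158044023918735669943648088852646123182739831022528,$$ and let $m_T=T(0.3)$ be the global maximum value of $T$. Let $\xi\in\{0.860\times10^{-2},\ 0.129\times10^{-3}\}$ and $\rho_\xi=\xi^{-1}1_{[-\xi/2,\xi/2]}$. For $\delta\in[0,\overline\delta)$ let $D_\delta=\mathrm{Id}+\delta S:[0,1]\to[0,1]$ be a bilipschitz homeomorphism, where $S$ is $1$-Lipschitz with $S(0)=S(1)=0$ and the support $\chi_S$ of $S$ is a finite union of intervals disjoint from some neighborhood of $m_T$. Let $T_\delta=D_\delta\circ T$ and $L_{\xi,T_\delta}=\rho_\xi\,\hat\ast\,L_{D_\delta\circ T}$. Let $f_0$ be the stationary probability measure of $L_{\xi,T_0}$ (with $T_0=T$) and let $f_\delta$ be some stationary probability measure of $L_{\xi,T_\delta}$. Then $$\lim_{\delta\to0}\left\|\frac{f_\delta-f_0}{\delta}-R(1,L_{\xi,T_0})\big[\rho_\xi\,\hat\ast\,(-L_T(f_0)S)'\big]\right\|_1=0 .$$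
   Context: The cube root is the real cube root. $L_T$ is the transfer operator (pushforward $L_T\mu(A)=\mu(T^{-1}A)$); absolutely continuous measures are identified with densities in $L^1[0,1]$. Let $\pi:\mathbb R\to[0,1]$, $\pi(x)=\min_{i\in\mathbb Z}|x-2i|$. For a finite signed measure $\rho$ on $\mathbb R$ and a finite signed measure $\mu$ on $[0,1]$, $\rho\,\hat\ast\,\mu=\pi_*(\rho\ast\hat\mu)$, where $\hat\mu$ is the extension of $\mu$ by zero to $\mathbb R$, $\ast$ is the usual convolution on $\mathbb R$, and $\pi_*$ is the pushforward by $\pi$. $(L_T(f_0)S)'$ is the distributional derivative (a finite signed measure) of the bounded variation function $L_T(f_0)S$. $R(1,L)=\sum_{n\ge0}L^n=(\mathrm{Id}-L)^{-1}$, acting on zero-average $L^1$ densities. *)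

(* Defs.v *)
From HB Require Import structures.
From mathcomp Require Import all_boot all_order all_algebra.
From mathcomp Require Import all_classical all_reals all_analysis.

Set Implicit Arguments.
Unset Strict Implicit.
Unset Printing Implicit Defensive.

Import Order.TTheory GRing.Theory Num.Theory.
Import numFieldNormedType.Exports.

Local Open Scope classical_set_scope.
Local Open Scope ring_scope.

Section unimodal_map.
Context {R : realType}.

Definition cbrt (x : R) : R := Num.sg x * `|x| `^ (3^-1).

(* Numerals are unary in [ring_scope], so the 74-digit decimal constant is
   given by the list of its digits after the decimal point. *)
Definition b_digits : seq nat :=
  [:: 0; 2; 3; 2; 8; 8; 5; 2; 8; 3; 0; 3; 0; 7; 0; 3; 2; 0; 5; 4; 4; 7; 8; 1;
      5; 8; 0; 4; 4; 0; 2; 3; 9; 1; 8; 7; 3; 5; 6; 6; 9; 9; 4; 3; 6; 4; 8; 0;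
      8; 8; 8; 5; 2; 6; 4; 6; 1; 2; 3; 1; 8; 2; 7; 3; 9; 8; 3; 1; 0; 2; 2; 5;
      2; 8]%N.

Definition Ta : R := 19 / 42 * cbrt (7 / 5).
Definition Tb : R :=
  \sum_(i < size b_digits) (nth 0%N b_digits i)%:R / 10 ^+ i.+1.
Definition Tc : R := 20 / (3 ^+ 20 * 7) * cbrt (7 / 5) * expR (187 / 10).

(* The two branches agree at 3/10: both equal
   20/21 * cbrt (7/5) * expR (- 3/10) + Tb. *)
Definition Tmap (x : R) : R :=
  if x <= 3 / 10 then (Ta + cbrt (x - 8^-1)) * expR (- x) + Tb
  else Tc * (10 * x * expR (- (10 * x / 3))) ^+ 19 + Tb.

Definition Tmax : R := Tmap (3 / 10).

End unimodal_map.

Section perturbation.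
Context {R : realType}.

Definition I01 : set R := `[0, 1].

Definition Dpert (S : R -> R) (delta x : R) : R := x + delta * S x.

Definition Tpert (S : R -> R) (delta : R) : R -> R := Dpert S delta \o Tmap.

(* A bi-Lipschitz bijection is automatically a homeomorphism. *)
Definition bilipschitz_homeo01 (D : R -> R) : Prop :=
  set_bij I01 I01 D /\
  exists k K : R, [/\ 0 < k, 0 < K &
    forall x y, I01 x -> I01 y ->
      k * `|x - y| <= `|D x - D y| <= K * `|x - y| ].

Definition supp01 (S : R -> R) : set R :=
  closure [set x | I01 x /\ S x != 0].

Definition finite_union_of_intervals (A : set R) : Prop :=
  exists (n : nat) (J : 'I_n -> interval R),
    A = \bigcup_(i in [set: 'I_n]) [set` J i].

Definition admissible_direction (S : R -> R) : Prop :=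
  [/\ 1.-lipschitz_I01 S, S 0 = 0, S 1 = 0,
      finite_union_of_intervals (supp01 S) &
      exists2 V : set R, nbhs (Tmax : R) V & V `&` supp01 S = set0 ].

End perturbation.

(* Signed measures on [0, 1] are set functions on R carried by [0, 1]; the
   operators below are defined on arbitrary set functions, so that they can be
   applied to bundled charges and probabilities without side conditions. *)
Section operators.
Context {R : realType}.
Notation leb := (@lebesgue_measure R).
Notation T_R := (measurableTypeR R).

(* L_T mu : only the values of T on [0, 1] matter. *)
Definition transfer (T : R -> R) (mu : set R -> \bar R) : set R -> \bar R :=
  fun A => mu (I01 `&` T @^-1` A).

Definition ext0 (mu : set R -> \bar R) : set R -> \bar R :=
  fun A => mu (A `&` I01).

(* (rho * mu) A = \int mu (A - t) d rho(t), rho being given by its density. *)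
Definition convolution (rho : R -> R) (mu : set R -> \bar R) : set R -> \bar R :=
  fun A => (\int[leb]_t ((rho t)%:E * mu ((fun x => (x + t)%R) @^-1` A)))%E.

(* The distance from x to the even integers; the infimum is attained. *)
Definition fold01 (x : R) : R := inf (range (fun i : int => `|x - 2 * i%:~R|)).

Definition reflconv (rho : R -> R) (mu : set R -> \bar R) : set R -> \bar R :=
  fun A => convolution rho (ext0 mu) (fold01 @^-1` A).

Definition rho_unif (xi : R) (x : R) : R :=
  xi^-1 * \1_(`[- (xi / 2), xi / 2]) x.

Definition Lnoise (xi : R) (T : R -> R) (mu : set R -> \bar R) :
    set R -> \bar R :=
  reflconv (rho_unif xi) (transfer T mu).

Definition stationary01 (xi : R) (T : R -> R) (mu : probability T_R R) : Prop :=
  mu I01 = 1%E /\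
  forall A : set T_R, measurable A -> Lnoise xi T mu A = mu A.

Definition L1 (f : R -> R) : Prop := leb.-integrable I01 (EFin \o f).

Definition L1norm (f : R -> R) : \bar R := (\int[leb]_(x in I01) `|f x|%:E)%E.

Definition zero_average (f : R -> R) : Prop :=
  L1 f /\ (\int[leb]_(x in I01) (f x)%:E = 0)%E.

(* Identification of densities in L^1[0, 1] with measures. *)
Definition meas (f : R -> R) : set R -> \bar R :=
  fun A => (\int[leb]_(x in A `&` I01) (f x)%:E)%E.

Definition is_density (mu : set R -> \bar R) (f : R -> R) : Prop :=
  L1 f /\ forall A : set T_R, measurable A -> mu A = meas f A.

Definition has_density (mu : set R -> \bar R) : Prop :=
  exists f, is_density mu f.

(* A representative of the a.e. class of the density of mu, meaningful when
   [has_density mu] holds. *)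
Definition dens (mu : set R -> \bar R) : R -> R :=
  xget (fun=> 0) [set f | is_density mu f].

Definition LnoiseL1 (xi : R) (T : R -> R) (f : R -> R) : R -> R :=
  dens (Lnoise xi T (meas f)).

(* r is the sum in L^1[0, 1] of the series \sum_n L^n h, within zero-average
   densities. *)
Definition is_neumann_sum (L : (R -> R) -> (R -> R)) (h r : R -> R) : Prop :=
  zero_average r /\
  (L1norm (fun x => r x - \sum_(k < n) iter k L h x) @[n --> \oo] --> 0%E).

Definition resolvent1 (L : (R -> R) -> (R -> R)) (h : R -> R) : R -> R :=
  xget (fun=> 0) [set r | is_neumann_sum L h r].

Definition test_function01 (phi : R -> R) : Prop :=
  (forall n x, derivable (derive1n n phi) x 1) /\
  exists u v : R, [/\ 0 < u, v < 1 & forall x, ~~ (u <= x <= v) -> phi x = 0].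

(* nu is the distributional derivative on ]0, 1[ of g, extended by zero; the
   integral against nu is taken through its Jordan decomposition, which does
   not depend on the choice of P and N. *)
Definition distributional_derivative
    (g : R -> R) (nu : {charge set T_R -> \bar R}) : Prop :=
  [/\ L1 g,
      (forall A : set T_R, measurable A -> nu (A `&` `]0, 1[) = nu A) &
      forall (P N : set T_R) (nuPN : hahn_decomposition nu P N) (phi : R -> R),
        test_function01 phi ->
        (\int[jordan_pos nuPN]_x (phi x)%:E - \int[jordan_neg nuPN]_x (phi x)%:E
         = - \int[leb]_(x in I01) (derive1 phi x * g x)%:E)%E ].

End operators.

(* Main.v *)
(* Only the derivative of the operators at f_0 is delicate: T has an infinite
   slope at 1/8 and a turning point at 3/10, so that L_T f_0 is unbounded near
   its maximum m_T, where S vanishes.  Since the noise makes f_0 continuous, the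
   distribution function G of T_* f_0 is C^1 on [0, m_T[, with density g there;
   f_0 (y) = (G (y + xi/2) - G (y - xi/2)) / xi, and the same formula for
   T_delta, with G o D_delta^-1 in place of G, gives
   (L_delta f_0 - L_0 f_0) / delta -> (F (. + xi/2) - F (. - xi/2)) / xi
   uniformly, F = - g S, by the mean value theorem.  F is a difference of
   monotone continuous functions, whose Stieltjes measures yield (- L_T f_0 S)'.
   The powers of L_0 contract zero-average densities (Doeblin): the iterated
   random orbits from every point reach any neighbourhood of the fixed point
   p = 0.393 of T, hence by compactness do so with uniform probability.  The
   reachability only needs that T is expanding, in mean along one or two steps,
   off the part of [0, 1] that reaches p at once, which is checked by explicit
   numerical bounds on the branches of T. *)
From HB Require Import structures.
Require Import Defs.
From mathcomp Require Import all_boot all_order all_algebra.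
From mathcomp Require Import all_classical all_reals all_analysis.
From mathcomp Require Import measurable_realfun ring lra.
Import Order.TTheory GRing.Theory Num.Theory.
Import numFieldNormedType.Exports.
Local Open Scope classical_set_scope.
Local Open Scope ring_scope.

(** * Branches of the map and reachability *)

(** The tight point is reachability at the smaller noise. The image of an interval without good
    points is again one, so it is enough that one of its first four images is longer by a factor
    1.01: no such interval of positive length can then exist. Expansion is in doubt only on the tail
    of the right branch, whose slope at x is comparable to T x - b and so degenerates near b. Two
    facts repair this. Values within about the noise of b are good, because the noise leads the
    orbit of b to p. For the others, the second image of b lies only about 6e-4 below 1/8, so the
    orbit soon passes by the vertical tangent; convexity of the left branch relates T x - b to T^3 x
    - T^2 b, and the infinite slope wins by a narrow margin. In the response only the resolvent of
    L_0 occurs: (1 - L_0)(f_delta - f_0) = (L_delta - L_0) f_delta first gives f_delta - f_0 =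
    O(delta); putting f_0 on the right then costs only O(delta^2). Densities are representatives
    chosen by [dens], so equalities are carried as L^1 distances equal to 0. *)

Section elementary.
Context {R : realType}.
Implicit Types x y r : R.

Lemma eq_ler x y : x = y -> x <= y.
Proof. by move=> ->. Qed.

Lemma ltr_cube x y : (x ^+ 3 < y ^+ 3) = (x < y).
Proof.
have inc u v : u < v -> u ^+ 3 < v ^+ 3 :> R.
  move=> uv; have : 0 < (v - u) * ((u + v) ^+ 2 + u ^+ 2 + v ^+ 2) / 2.
    rewrite divr_gt0// mulr_gt0 ?subr_gt0//.
    have [u0|u0] := eqVneq u 0; last first.
      by rewrite ltr_wpDr ?sqr_ge0// ltr_wpDl ?sqr_ge0// exprn_even_gt0.
    have [v0|v0] := eqVneq v 0; last by rewrite ltr_wpDl ?addr_ge0 ?sqr_ge0 ?exprn_even_gt0.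
    by move: uv; rewrite u0 v0 ltxx.
  by rewrite -(subr_gt0 (u ^+ 3)) => h; apply: (lt_le_trans h); apply/eq_ler; field.
apply/idP/idP; last exact: inc.
by rewrite ltNge => /negP xy; rewrite ltNge; apply/negP; rewrite le_eqVlt => /orP[/eqP yx|/inc/ltW//]; apply: xy; rewrite yx.
Qed.

Lemma ler_cube x y : (x ^+ 3 <= y ^+ 3) = (x <= y).
Proof. by rewrite !leNgt ltr_cube. Qed.

Lemma cbrtK x : cbrt x ^+ 3 = x.
Proof.
have pK y : 0 <= y -> (y `^ 3^-1) ^+ 3 = y.
  move=> y0; rewrite -powR_mulrn ?powR_ge0// -powRrM mulVf ?powRr1//.
rewrite /cbrt exprMn pK//; have [x0|x0|->] := ltgtP x 0.
- by rewrite ltr0_sg// ltr0_norm// -signr_odd/=; ring.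
- by rewrite gtr0_sg// gtr0_norm//; ring.
- by rewrite normr0 mulr0.
Qed.

(** Comparison with a cube root becomes a polynomial inequality, which [lra] decides for numerals;
    all enclosures of the map rest on this. *)
Lemma ler_cbrtl x r : (cbrt x <= r) = (x <= r ^+ 3).
Proof. by rewrite -ler_cube cbrtK. Qed.
Lemma ltr_cbrtl x r : (cbrt x < r) = (x < r ^+ 3).
Proof. by rewrite -ltr_cube cbrtK. Qed.
Lemma ler_cbrtr x r : (r <= cbrt x) = (r ^+ 3 <= x).
Proof. by rewrite -ler_cube cbrtK. Qed.
Lemma ltr_cbrtr x r : (r < cbrt x) = (r ^+ 3 < x).
Proof. by rewrite -ltr_cube cbrtK. Qed.
Lemma ler_cbrt x y : (cbrt x <= cbrt y) = (x <= y).
Proof. by rewrite ler_cbrtl cbrtK. Qed.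
Lemma ltr_cbrt x y : (cbrt x < cbrt y) = (x < y).
Proof. by rewrite ltr_cbrtl cbrtK. Qed.
Lemma cubeK x : cbrt (x ^+ 3) = x.
Proof. by apply/le_anti; rewrite ler_cbrtl ler_cbrtr lexx. Qed.

Lemma continuous_cbrt : continuous (@cbrt R).
Proof.
move=> x; apply/cvgrPdist_lt => e e0; near=> y.
rewrite distrC ltr_distl ltr_cbrtr ltr_cbrtl; apply/andP; split; near: y.
- by apply: lt_nbhsr; rewrite -ltr_cbrtr ltrBlDr ltrDl.
- by apply: lt_nbhsl; rewrite -ltr_cbrtl ltrDl.
Unshelve. all: by end_near. Qed.

Lemma cbrt_eq0 x : (cbrt x == 0) = (x == 0).
Proof. by rewrite !eq_le ler_cbrtl ler_cbrtr !expr0n. Qed.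

Lemma is_derive_cbrt x : x != 0 -> is_derive x 1 (@cbrt R) ((3 * cbrt x ^+ 2)^-1).
Proof.
move=> x0; rewrite -[X in is_derive X _ _](cbrtK x).
apply: (@is_derive_inverse R (fun y => y ^+ 3)).
- by near=> y; rewrite cubeK.
- by near=> y; exact: exprn_continuous.
- by apply: is_derive_eq; rewrite /GRing.scale/=; ring.
- by rewrite mulf_neq0// expf_neq0// cbrt_eq0.
Unshelve. all: by end_near. Qed.

(** For the Taylor polynomial p of degree n of exp (-x), p + p' is x^n / n! up to sign, so p times
    exp is monotone on the half line and is compared with its value 1 at 0. *)
Lemma expRN_bounds5 x : 0 <= x ->
  1 - x + x ^+ 2 / 2 - x ^+ 3 / 6 + x ^+ 4 / 24 - x ^+ 5 / 120 <= expR (- x)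
   <= 1 - x + x ^+ 2 / 2 - x ^+ 3 / 6 + x ^+ 4 / 24.
Proof.
move=> x0.
pose p4 := 1 - 'X + 2^-1 *: 'X^2 - 6^-1 *: 'X^3 + 24^-1 *: 'X^4 : {poly R}.
pose p5 := p4 - 120^-1 *: 'X^5.
have dE (p : {poly R}) (y : R) : is_derive y 1 (fun z => p.[z] * expR z) ((p.[y] + p^`().[y]) * expR y).
  have H1 : is_derive y 1 (horner p) p^`().[y].
    by apply: DeriveDef; [exact: derivable_horner|rewrite -derive1E -derivE].
  by apply: is_derive_eq; rewrite /GRing.scale/=; ring.
have cE (p : {poly R}) : continuous (fun z => p.[z] * expR z).
  by move=> y; apply/differentiable_continuous/derivable1_diffP; have [] := dE p y.
have p40 : p4.[0] = 1 by rewrite /p4 !hornerE /=; field.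
have p50 : p5.[0] = 1 by rewrite /p5 /p4 !hornerE /=; field.
have d4 y : p4.[y] + p4^`().[y] = y ^+ 4 / 24.
  by rewrite /p4 !poly.derivE !hornerE /=; field.
have d5 y : p5.[y] + p5^`().[y] = - (y ^+ 5 / 120).
  by rewrite /p5 /p4 !poly.derivE !hornerE /=; field.
have [->|xn0] := eqVneq x 0; first by rewrite oppr0 expR0; lra.
have {x0 xn0}x0 : 0 < x by rewrite lt_neqAle eq_sym xn0.
have [c4 c4x] := @MVT R _ _ 0 x x0 (fun y _ => dE p4 y) (continuous_subspaceT (cE p4)).
have [c5 c5x] := @MVT R _ _ 0 x x0 (fun y _ => dE p5 y) (continuous_subspaceT (cE p5)).
have e0 := expR_gt0 x.
rewrite !subr0 expR0 !mulr1 p40 p50 d4 d5 => h5 h4.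
have m5 : (p5).[x] * expR x <= 1.
  rewrite -subr_le0 h5 mulr_le0_ge0 ?(ltW x0)// mulr_le0_ge0 ?expR_ge0// oppr_le0.
  by rewrite divr_ge0// exprn_ge0//; move: c5x; rewrite in_itv/= => /andP[/ltW].
have m4 : 1 <= (p4).[x] * expR x.
  rewrite -subr_ge0 h4 mulr_ge0 ?(ltW x0)// mulr_ge0 ?expR_ge0// divr_ge0//.
  by rewrite exprn_ge0//; move: c4x; rewrite in_itv/= => /andP[/ltW].
rewrite expRN -[(expR x)^-1]mul1r ler_pdivlMr// ler_pdivrMr//; apply/andP; split.
  apply: le_trans m5; apply/eq_ler; congr (_ * _).
  by rewrite /p5 /p4 !hornerE /=; field.
apply: le_trans m4 _; apply/eq_ler; congr (_ * _).
by rewrite /p4 !hornerE /=; field.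
Qed.

End elementary.

(** * The two branches of the map and enclosures of its constants *)

Section branches.
Context {R : realType}.
Implicit Types x y : R.

Definition Tleft x : R := (Ta + cbrt (x - 8^-1)) * expR (- x) + Tb.
Definition Theight : R := 20 / 21 * cbrt (7 / 5) * expR (- (3 / 10)).
(** Normalised to have maximum 1, attained at 3/10. The extreme constants of [Tc] are thereby
    absorbed into [Theight], the height of the peak of the map above [Tb]. *)
Definition hump x : R := 10 * x / 3 * expR (1 - 10 * x / 3).
Definition Tright x : R := Theight * hump x ^+ 19 + Tb.
Definition dTleft x : R :=
  expR (- x) * ((3 * cbrt (x - 8^-1) ^+ 2)^-1 - Ta - cbrt (x - 8^-1)).
(** Logarithmic derivative form: the slope is the height above [Tb] times a rate, so that lower
    bounds on [Tright x] give lower bounds on the slope. *)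
Definition dTright x : R := (Tright x - Tb) * (19 * (x^-1 - 10 / 3)).

Lemma TmapE_left x : x <= 3 / 10 -> Tmap x = Tleft x.
Proof. by rewrite /Tmap => ->. Qed.

(** The exponentials match because 187/10 = 19 - 3/10. *)
Lemma TrightE x : Tright x = Tc * (10 * x * expR (- (10 * x / 3))) ^+ 19 + Tb.
Proof.
rewrite /Tright /Theight /Tc /hump; congr (_ + _).
have -> : (187 / 10 : R) = 1 *+ 19 + - (3 / 10) by field.
have e19 : expR (1 *+ 19) = expR 1 ^+ 19 :> R by rewrite -mulr_natl expRM_natl.
by rewrite (expRD (1 *+ 19)) (expRD 1) e19; field.
Qed.

Lemma hump1 : hump (3 / 10) = 1.
Proof.
by rewrite /hump (_ : 1 - _ = 0) ?expR0; field.
Qed.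

Lemma cbrt740 : 2 * cbrt (3 / 10 - 8^-1) = cbrt (7 / 5) :> R.
Proof.
have h : (2 * cbrt (3 / 10 - 8^-1)) ^+ 3 = 7 / 5 :> R.
  by rewrite exprMn cbrtK; field.
by rewrite -h cubeK.
Qed.

Lemma TmapE_right x : 3 / 10 <= x -> Tmap x = Tright x.
Proof.
rewrite /Tmap => x3; case: ifPn => [x3'|_]; last by rewrite TrightE.
have -> : x = 3 / 10 by apply/le_anti/andP.
rewrite /Tright hump1 /Theight /Ta -cbrt740; congr (_ + _).
by field.
Qed.

Lemma is_derive_Tleft x : x != 8^-1 -> is_derive x 1 Tleft (dTleft x).
Proof.
move=> x8; rewrite /Tleft /dTleft.
have h1 : is_derive (x - 8^-1) 1 (@cbrt R) ((3 * cbrt (x - 8^-1) ^+ 2)^-1).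
  by apply: is_derive_cbrt; rewrite subr_eq0.
have h2 : is_derive x 1 (fun y : R => cbrt (y - 8^-1)) ((3 * cbrt (x - 8^-1) ^+ 2)^-1).
  have h3 : is_derive x 1 (fun y : R => y - 8^-1) 1.
    exact: is_derive_shift.
  have := @is_derive1_comp R (@cbrt R) (fun y : R => y - 8^-1) x _ _ h1 h3.
  by rewrite mulr1.
have h4 : is_derive x 1 (fun y : R => expR (- y)) (- expR (- x)).
  by apply: is_derive_eq; rewrite /GRing.scale/=; ring.
by apply: is_derive_eq; rewrite /GRing.scale/=; ring.
Qed.

Lemma is_derive_hump x : is_derive x 1 hump (10 / 3 * (1 - 10 * x / 3) * expR (1 - 10 * x / 3)).
Proof.
have h : is_derive x 1 (fun y : R => expR (1 - 10 * y / 3)) (- (10 / 3) * expR (1 - 10 * x / 3)).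
  by apply: is_derive_eq; rewrite /GRing.scale/=; field.
by apply: is_derive_eq; rewrite /GRing.scale/=; field.
Qed.

Lemma is_derive_Tright x : x != 0 -> is_derive x 1 Tright (dTright x).
Proof.
move=> x0; have h := is_derive_hump x.
by apply: is_derive_eq; rewrite /dTright /Tright /GRing.scale/= /hump; field.
Qed.

Lemma continuous_Tleft : continuous Tleft.
Proof.
move=> x; apply: cvgD; last exact: cvg_cst.
apply: cvgM; last first.
  by apply: (@continuous_comp _ _ _ -%R expR); [exact: opp_continuous|exact: continuous_expR].
apply: cvgD; first exact: cvg_cst.
apply: (@continuous_comp _ _ _ (fun y => y - 8^-1) (@cbrt R)); last exact: continuous_cbrt.
by apply: cvgB; [exact: cvg_id|exact: cvg_cst].
Qed.

Lemma continuous_hump : continuous hump.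
Proof.
by move=> x; apply/differentiable_continuous/derivable1_diffP; have [] := is_derive_hump x.
Qed.

Lemma continuous_Tright : continuous Tright.
Proof.
move=> x; apply: cvgD; last exact: cvg_cst.
apply: cvgM; first exact: cvg_cst.
apply: (@continuous_comp _ _ _ hump (fun y => y ^+ 19)); first exact: continuous_hump.
exact: exprn_continuous.
Qed.

(** Truncating the argument of each branch at 3/10 gives a formula without case distinction, from
    which continuity of the map is immediate. *)
Lemma TmapE x : Tmap x = Tleft (Num.min x (3 / 10)) + Tright (Num.max x (3 / 10)) - Tmax.
Proof.
have e : Tright (3 / 10) = Tmax by rewrite /Tmax TmapE_right.
have e' : Tleft (3 / 10) = Tmax by rewrite /Tmax TmapE_left.
have [x3|x3] := leP x (3 / 10).
  by rewrite TmapE_left// e addrK.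
by rewrite TmapE_right ?(ltW x3)// e' addrAC subrr add0r.
Qed.

Lemma continuous_Tmap : continuous (@Tmap R).
Proof.
have -> : @Tmap R = fun x => Tleft (Num.min x (3 / 10)) + Tright (Num.max x (3 / 10)) - Tmax.
  by apply/funext => x; exact: TmapE.
move=> x; apply: cvgB; last exact: cvg_cst.
apply: cvgD.
- apply: (@continuous_comp _ _ _ (fun y => Num.min y (3 / 10)) Tleft); last exact: continuous_Tleft.
  by apply: continuous_min => y; [exact: cvg_id|exact: cvg_cst].
- apply: (@continuous_comp _ _ _ (fun y => Num.max y (3 / 10)) Tright); last exact: continuous_Tright.
  by apply: continuous_max => y; [exact: cvg_id|exact: cvg_cst].
Qed.

Lemma decimal_cons d (s : seq nat) :
  \sum_(i < size (d :: s)) (nth 0%N (d :: s) i)%:R / 10 ^+ i.+1 =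
  (d%:R + \sum_(i < size s) (nth 0%N s i)%:R / 10 ^+ i.+1) / 10 :> R.
Proof.
rewrite [LHS]big_ord_recl mulrDl mulr_suml; congr (_ + _).
by apply: eq_bigr => i _; rewrite lift0 exprSr invfM mulrA.
Qed.

Lemma decimal_bounds (s : seq nat) : all (fun d => d <= 9)%N s ->
  0 <= (\sum_(i < size s) (nth 0%N s i)%:R / 10 ^+ i.+1 : R) <= 1.
Proof.
elim: s => [_|d s IH /andP[d9 /IH]]; first by rewrite big_ord0; lra.
rewrite decimal_cons; have : 0 <= (d%:R : R) <= 9 by rewrite ler0n ler_nat.
lra.
Qed.

(** Nine digits are peeled off by [decimal_cons]; what remains is a decimal in [0, 1]. *)
Lemma Tb_bounds : 23 / 10 ^+ 3 + 288 / 10 ^+ 6 + 528 / 10 ^+ 9 <= (Tb : R) <= 23 / 10 ^+ 3 + 288 / 10 ^+ 6 + 529 / 10 ^+ 9.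
Proof.
rewrite /Tb /b_digits 9!decimal_cons.
set t := \sum_(i < _) _.
have := @decimal_bounds (drop 9 b_digits) isT; rewrite /= -/t; lra.
Qed.

Lemma cbrt75_bounds : 1 + 118 / 10 ^+ 3 + 688 / 10 ^+ 6 <= cbrt (7 / 5 : R) <= 1 + 118 / 10 ^+ 3 + 690 / 10 ^+ 6.
Proof. rewrite ler_cbrtl ler_cbrtr; apply/andP; split; lra. Qed.

Lemma Ta_bounds : 506 / 10 ^+ 3 + 73 / 10 ^+ 6 <= (Ta : R) <= 506 / 10 ^+ 3 + 75 / 10 ^+ 6.
Proof. by have := cbrt75_bounds; rewrite /Ta; lra. Qed.

Lemma Theight_bounds : (789 / 10 ^+ 3 + 2 / 10 ^+ 4) <= Theight <= (789 / 10 ^+ 3 + 4 / 10 ^+ 4).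
Proof.
have h1 := cbrt75_bounds; rewrite /Theight.
have h2 := @expRN_bounds5 R (3 / 10) ltac:(lra).
have h3 : (740 / 10 ^+ 3 + 8 / 10 ^+ 4) <= expR (- (3 / 10 : R)) <= (740 / 10 ^+ 3 + 9 / 10 ^+ 4) by lra.
by nra.
Qed.

Lemma TmaxE : Tmax = Theight + Tb :> R.
Proof. by rewrite /Tmax TmapE_right// /Tright hump1 expr1n mulr1. Qed.

End branches.

(** * Monotonicity of the branches *)

Section monotone_branches.
Context {R : realType}.
Implicit Types (x y u v : R) (f df : R -> R).

(** Mean value inequality applied on both sides of c, where the derivative may fail to exist. It
    lets intervals cross the vertical tangent at 1/8. *)
Lemma growth_avoiding f df u v c l : u <= v -> continuous f ->
  (forall x, u < x < v -> x != c -> is_derive x 1 f (df x) /\ l <= df x) ->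
  l * (v - u) <= f v - f u.
Proof.
move=> uv cf H.
have step s t : u <= s -> s <= t -> t <= v -> ~~ (s < c < t) ->
    l * (t - s) <= f t - f s.
  move=> us; rewrite le_eqVlt => /predU1P[->|st] tv nc; first by rewrite !subrr mulr0.
  have inc x : x \in `]s, t[ -> u < x < v /\ x != c.
    rewrite in_itv/= => /andP[sx xt]; split.
      by rewrite (le_lt_trans us sx) (lt_le_trans xt tv).
    by apply: contra nc => /eqP <-; rewrite sx.
  have D x : x \in `]s, t[ -> is_derive x 1 f (df x).
    by move=> /inc[? ?]; have [] := H x.
  have [e est ->] := MVT st D (continuous_subspaceT cf).
  have [? ?] := inc _ est.
  by rewrite ler_wpM2r ?subr_ge0 ?(ltW st)//; have [] := H e.
have [/andP[uc cv]|nc] := boolP (u < c < v); last exact: step.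
have h1 := step u c (lexx _) (ltW uc) (ltW cv).
have h2 := step c v (ltW uc) (ltW cv) (lexx _).
rewrite ltxx andbF/= in h1; rewrite ltxx/= in h2.
by have := h1 isT; have := h2 isT; lra.
Qed.

(** The left branch in the coordinate v with x = 1/8 + v^3, in which the vertical tangent at 1/8
    disappears; monotonicity and inversion are carried out there. *)
Definition qleft v : R := (Ta + v) * expR (- (8^-1 + v ^+ 3)) + Tb.
Definition dqleft v : R := expR (- (8^-1 + v ^+ 3)) * (1 - 3 * v ^+ 2 * (Ta + v)).
Definition vmax : R := cbrt (3 / 10 - 8^-1).

Lemma TleftE x : Tleft x = qleft (cbrt (x - 8^-1)).
Proof. by rewrite /Tleft /qleft cbrtK subrKC. Qed.

Lemma is_derive_qleft v : is_derive v 1 qleft (dqleft v).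
Proof.
have h4 k : is_derive v 1 (fun y : R => expR (- (k + y ^+ 3)))
    (- (3 * v ^+ 2) * expR (- (k + v ^+ 3))).
  by apply: is_derive_eq; rewrite /GRing.scale/=; ring.
have h := h4 8^-1.
by rewrite /dqleft; apply: is_derive_eq; rewrite /GRing.scale/=; ring.
Qed.

Lemma vmaxE : 2 * vmax = cbrt (7 / 5) /\ (Ta : R) = 19 / 21 * vmax.
Proof.
split; first exact: cbrt740.
rewrite /Ta -cbrt740 -/vmax; move: (vmax) => w. by field.
Qed.

(** The value of a makes [vmax], that is x = 3/10, a critical point:
    [3 * vmax ^+ 2 * (Ta + vmax) = 1]. For nonnegative v below [vmax] this expression is strictly
    smaller; for negative v it is either nonpositive or small because |v| < a. *)
Lemma dqleft_gt0 v : -1 <= v -> v < vmax -> 0 < dqleft v.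
Proof.
move=> v1 vm; rewrite mulr_gt0 ?expR_gt0// subr_gt0.
have [_ Ha] := vmaxE; have vm3 : vmax ^+ 3 = 7 / 40 :> R by rewrite cbrtK; field.
have ab := @Ta_bounds R.
have [v0|v0] := leP 0 v.
  have h1 : 3 * vmax ^+ 2 * (Ta + vmax) = 1 :> R.
    have -> : 3 * vmax ^+ 2 * (Ta + vmax) = 40 / 7 * vmax ^+ 3 :> R by rewrite Ha; field.
    by rewrite vm3; field.
  rewrite -[ltRHS]h1.
  have h2 : v ^+ 2 < vmax ^+ 2 by rewrite ltr_pXn2r// nnegrE// (le_trans v0)// ltW.
  have h0 : 0 <= v ^+ 2 by exact: sqr_ge0.
  apply: (@le_lt_trans _ _ (3 * v ^+ 2 * (Ta + vmax))); first by nra.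
  by rewrite ltr_pM2r ?ltr_pM2l//; nra.
have [h|h] := leP (Ta + v) 0.
  have h0 := sqr_ge0 v.
  by apply: (@le_lt_trans _ _ 0) => //; nra.
have h2 : v ^+ 2 <= Ta ^+ 2 by nra.
have h3 : Ta ^+ 2 <= (26 / 10 ^+ 2 : R) by nra.
have h0 := sqr_ge0 v.
nra.
Qed.

Lemma continuous_qleft : continuous qleft.
Proof.
by move=> x; apply/differentiable_continuous/derivable1_diffP; have [] := is_derive_qleft x.
Qed.

Lemma qleft_lt u v : -1 <= u -> u < v -> v <= vmax -> qleft u < qleft v.
Proof.
move=> u1 uv vm.
have [c] := MVT uv (fun x _ => is_derive_qleft x) (continuous_subspaceT continuous_qleft).
rewrite in_itv/= => /andP[uc cv] h.
by rewrite -subr_gt0 h mulr_gt0 ?subr_gt0// dqleft_gt0; lra.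
Qed.

Lemma Tleft_lt x y : 0 <= x -> x < y -> y <= 3 / 10 -> Tleft x < Tleft y.
Proof.
move=> x0 xy y3; rewrite !TleftE; apply: qleft_lt; rewrite ?ltr_cbrt ?ler_cbrt ?ler_cbrtr; lra.
Qed.

Lemma Tleft_le x y : 0 <= x -> x <= y -> y <= 3 / 10 -> Tleft x <= Tleft y.
Proof. by move=> x0; rewrite le_eqVlt => /predU1P[->//|xy] y3; rewrite ltW// Tleft_lt. Qed.

Lemma Theight_gt0 : 0 < Theight :> R.
Proof. by have := @Theight_bounds R; lra. Qed.

Lemma hump_gt0 x : 0 < x -> 0 < hump x.
Proof. by move=> x0; rewrite mulr_gt0 ?expR_gt0//; lra. Qed.

Lemma Tright_gtb x : 0 < x -> Tb < Tright x.
Proof. by move=> x0; rewrite ltrDr mulr_gt0 ?Theight_gt0// exprn_gt0// hump_gt0. Qed.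

Lemma dTright_lt0 x : 3 / 10 < x -> dTright x < 0.
Proof.
move=> x3; have x0 : 0 < x by lra.
rewrite /dTright pmulr_rlt0 ?subr_gt0 ?Tright_gtb//.
have : x^-1 < 10 / 3; last by lra.
by rewrite invf_plt ?posrE//; lra.
Qed.

Lemma Tright_lt x y : 3 / 10 <= x -> x < y -> Tright y < Tright x.
Proof.
move=> x3 xy.
have D z : z \in `]x, y[ -> is_derive z 1 Tright (dTright z).
  by rewrite in_itv/= => /andP[xz _]; apply: is_derive_Tright; lra.
have [c] := MVT xy D (continuous_subspaceT continuous_Tright).
rewrite in_itv/= => /andP[xc cy] h.
by rewrite -subr_lt0 h nmulr_rlt0 ?subr_gt0// dTright_lt0//; lra.
Qed.

Lemma Tright_le x y : 3 / 10 <= x -> x <= y -> Tright y <= Tright x.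
Proof. by move=> x3; rewrite le_eqVlt => /predU1P[->//|xy]; rewrite ltW// Tright_lt. Qed.

(** Interval evaluation: rational enclosures of the cube root, checked by cubing, and of the
    exponential are combined into one of the value. *)
Lemma Tleft_bounds x r1 r2 e1 e2 : r1 ^+ 3 <= x - 8^-1 <= r2 ^+ 3 ->
  e1 <= expR (- x) <= e2 -> 0 <= 506 / 10 ^+ 3 + 73 / 10 ^+ 6 + r1 -> 0 <= e1 ->
  (506 / 10 ^+ 3 + 73 / 10 ^+ 6 + r1) * e1 + (23 / 10 ^+ 3 + 288 / 10 ^+ 6 + 528 / 10 ^+ 9) <= Tleft x <=
  (506 / 10 ^+ 3 + 75 / 10 ^+ 6 + r2) * e2 + (23 / 10 ^+ 3 + 288 / 10 ^+ 6 + 529 / 10 ^+ 9).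
Proof.
rewrite -ler_cbrtl -ler_cbrtr /Tleft => /andP[h1 h2] /andP[h3 h4] h5 h6.
have ab := @Ta_bounds R; have bb := @Tb_bounds R.
have : (506 / 10 ^+ 3 + 73 / 10 ^+ 6 + r1) * e1 <= (Ta + cbrt (x - 8^-1)) * expR (- x).
  by apply: ler_pM => //; lra.
have : (Ta + cbrt (x - 8^-1)) * expR (- x) <= (506 / 10 ^+ 3 + 75 / 10 ^+ 6 + r2) * e2.
  by apply: ler_pM; rewrite ?expR_ge0//; lra.
lra.
Qed.

Lemma Tb_le_T x : 0 <= x <= 1 -> Tb <= Tmap x.
Proof.
move=> /andP[x0 x1]; have [x3|x3] := leP x (3 / 10); last first.
  by rewrite TmapE_right ?(ltW x3)// ltW// Tright_gtb//; lra.
rewrite TmapE_left// /Tleft lerDr mulr_ge0 ?expR_ge0//.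
have ab := @Ta_bounds R.
have : - (1 / 2) <= cbrt (x - 8^-1) by rewrite ler_cbrtr; lra.
lra.
Qed.

Lemma T_le_Tmax x : 0 <= x -> Tmap x <= Tmax.
Proof.
move=> x0; have [x3|x3] := leP x (3 / 10).
  by rewrite TmapE_left// /Tmax TmapE_left// Tleft_le.
by rewrite TmapE_right ?(ltW x3)// /Tmax TmapE_right// Tright_le// ltW.
Qed.

Lemma Tmax_bounds : 812 / 10 ^+ 3 <= (Tmax : R) <= 813 / 10 ^+ 3.
Proof. by have := @Tb_bounds R; have := @Theight_bounds R; rewrite TmaxE; lra. Qed.

End monotone_branches.

(** * Numerical bounds on the slope and the values of the left branch *)

Section numerics.
Context {R : realType}.
Implicit Types (x y z u v w c : R).

Lemma expRN_ge x : 1 - x <= expR (- x).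
Proof. exact: expR_ge1Dx. Qed.

Lemma inv3sqr_ge c r : c != 0 -> 0 <= r -> 3 * c ^+ 2 * r <= 1 -> r <= (3 * c ^+ 2)^-1.
Proof.
move=> c0 r0 h; have c2 : 0 < 3 * c ^+ 2 by rewrite mulr_gt0// exprn_even_gt0.
by rewrite -[leRHS]mul1r ler_pdivlMr// mulrC.
Qed.

Lemma dTleft_ge1 x : 0 <= x <= 17 / 10 ^+ 2 -> x != 8^-1 -> 116 / 10 ^+ 2 <= dTleft x.
Proof.
move=> /andP[x0 x17] x8; rewrite /dTleft.
have c0 : cbrt (x - 8^-1) != 0 by rewrite cbrt_eq0 subr_eq0.
have e := expRN_ge x; have ab := @Ta_bounds R.
have cl : - (1 / 2) <= cbrt (x - 8^-1) by rewrite ler_cbrtr; lra.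
have cu : cbrt (x - 8^-1) <= 356 / 10 ^+ 3 by rewrite ler_cbrtl; lra.
have ck : x <= 8^-1 -> cbrt (x - 8^-1) <= 0 by move=> h; rewrite ler_cbrtl; lra.
have ck' : 8^-1 < x -> 0 <= cbrt (x - 8^-1) by move=> h; rewrite ler_cbrtr; lra.
move: (cbrt (x - 8^-1)) c0 cl cu ck ck' => c c0 cl cu ck ck'.
have [xl|xl] := leP x 8^-1.
  have {}ck := ck xl.
  (* The linear bound meets 1 / (3 c^2) at c = -1/2, that is at x = 0; its term c cancels the [- c]
     of the slope and leaves a constant. *)
  have h : 11 / 6 + c <= (3 * c ^+ 2)^-1.
    apply: inv3sqr_ge; [by []|by lra|].
    rewrite -subr_ge0 (_ : 1 - _ = (c + 1 / 2) * (- 6 * c ^+ 2 - 8 * c + 4) / 2); last by field.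
    have A1 : 0 <= c + 1 / 2 by lra.
    have A2 : 0 <= - 6 * c ^+ 2 - 8 * c + 4 by nra.
    by rewrite divr_ge0// mulr_ge0.
  apply: (@le_trans _ _ ((7 / 8) * (11 / 6 - (506 / 10 ^+ 3 + 75 / 10 ^+ 6)))); first by lra.
  by apply: ler_pM; lra.
have {}ck' := ck' xl.
have h : 263 / 10 ^+ 2 <= (3 * c ^+ 2)^-1.
  apply: inv3sqr_ge; [by []|by lra|].
  have : c ^+ 2 <= (356 / 10 ^+ 3) ^+ 2 by nra.
  by lra.
apply: (@le_trans _ _ ((83 / 10 ^+ 2) * (146 / 83))); first by lra.
by apply: ler_pM; lra.
Qed.

Lemma dTleft_ge2 x : 12 / 10 ^+ 2 <= x <= 17 / 10 ^+ 2 -> x != 8^-1 -> 146 / 10 ^+ 2 <= dTleft x.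
Proof.
move=> /andP[x0 x17] x8; rewrite /dTleft.
have c0 : cbrt (x - 8^-1) != 0 by rewrite cbrt_eq0 subr_eq0.
have e := expRN_ge x; have ab := @Ta_bounds R.
have cl : - (172 / 10 ^+ 3) <= cbrt (x - 8^-1) by rewrite ler_cbrtr; lra.
have cu : cbrt (x - 8^-1) <= 356 / 10 ^+ 3 by rewrite ler_cbrtl; lra.
move: (cbrt (x - 8^-1)) c0 cl cu => c c0 cl cu.
have h : 263 / 10 ^+ 2 <= (3 * c ^+ 2)^-1.
  apply: inv3sqr_ge; [by []|by lra|].
  have : c ^+ 2 <= (356 / 10 ^+ 3) ^+ 2 by nra.
  by lra.
apply: (@le_trans _ _ ((83 / 10 ^+ 2) * (146 / 83))); first by lra.
by apply: ler_pM; lra.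
Qed.

(* Convexity of the left branch before its vertical tangent: since
   [exp h <= 1 / (1 - h)], it is enough to compare [k] and [(1 - h) k]. *)
Lemma dTleft_homo x y : 0 <= x -> x <= y -> y <= 1 / 10 -> dTleft x <= dTleft y.
Proof.
move=> x0; rewrite le_eqVlt => /predU1P[->//|xy] y1.
have ab := @Ta_bounds R.
have [w1 c1] : exists w, cbrt (x - 8^-1) = - w by exists (- cbrt (x - 8^-1)); rewrite opprK.
have [w2 c2] : exists w, cbrt (y - 8^-1) = - w by exists (- cbrt (y - 8^-1)); rewrite opprK.
have w1E : w1 ^+ 3 = 8^-1 - x by rewrite -[w1]opprK -c1 exprNn cbrtK; ring.
have w2E : w2 ^+ 3 = 8^-1 - y by rewrite -[w2]opprK -c2 exprNn cbrtK; ring.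
have w1u : w1 <= 1 / 2 by rewrite -ler_cube w1E; lra.
have w21 : w2 < w1 by rewrite -ltr_cube w1E w2E; lra.
have w2l : 29 / 10 ^+ 2 <= w2 by rewrite -ler_cube w2E; lra.
rewrite /dTleft c1 c2 !sqrrN !opprK.
have yE : y = x + (w1 ^+ 3 - w2 ^+ 3) by rewrite w1E w2E; ring.
set h := w1 ^+ 3 - w2 ^+ 3 in yE.
have hE : h = (w1 - w2) * (w1 ^+ 2 + w1 * w2 + w2 ^+ 2) by rewrite /h; ring.
have h1 : 1 - h <= expR (- h) by exact: expRN_ge.
have -> : expR (- y) = expR (- x) * expR (- h) by rewrite -expRD yE opprD.
rewrite -mulrA ler_wpM2l ?expR_ge0//.
have k2 : 0 <= (3 * w2 ^+ 2)^-1 - Ta + w2.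
  suff : 1 <= (3 * w2 ^+ 2)^-1 by lra.
  by apply: inv3sqr_ge; [lra|lra|nra].
apply: (@le_trans _ _ ((1 - h) * ((3 * w2 ^+ 2)^-1 - Ta + w2))); last first.
  by rewrite ler_wpM2r.
rewrite -subr_ge0.
have w1n : w1 != 0 by lra.
have w2n : w2 != 0 by lra.
rewrite (_ : _ - _ = (w1 - w2) / (3 * w2 ^+ 2) * ((w1 + w2) / w1 ^+ 2 - 3 * w2 ^+ 2 -
   (w1 ^+ 2 + w1 * w2 + w2 ^+ 2) * (1 + 3 * w2 ^+ 2 * (w2 - Ta)))); last first.
  by rewrite hE; field; rewrite w1n w2n.
apply: mulr_ge0; first by rewrite divr_ge0// ?mulr_ge0// ?sqr_ge0//; lra.
have s2 : w2 ^+ 2 <= w2 / 2 by nra.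
have a1 : w1 ^+ 2 + w1 * w2 + w2 ^+ 2 <= 3 / 4 by nra.
have a0 : 0 <= w1 ^+ 2 + w1 * w2 + w2 ^+ 2 by nra.
have a2 : 1 + 3 * w2 ^+ 2 * (w2 - Ta) <= 1.
  have : 0 <= w2 ^+ 2 by exact: sqr_ge0.
  nra.
have a3 : 4 * (w1 + w2) <= (w1 + w2) / w1 ^+ 2.
  rewrite ler_pdivlMr; last by rewrite exprn_gt0//; lra.
  have : w1 ^+ 2 <= 1 / 4 by nra.
  nra.
have : (w1 ^+ 2 + w1 * w2 + w2 ^+ 2) * (1 + 3 * w2 ^+ 2 * (w2 - Ta)) <= 3 / 4 by nra.
lra.
Qed.

Lemma Tleft_at17 : 695 / 10 ^+ 3 <= Tleft (17 / 10 ^+ 2 : R).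
Proof.
have e := @expRN_bounds5 R (17 / 10 ^+ 2) ltac:(lra).
have := @Tleft_bounds R (17 / 10 ^+ 2) (355 / 10 ^+ 3) (356 / 10 ^+ 3) (84 / 10 ^+ 2) 1 ltac:(lra) ltac:(lra) ltac:(lra) ltac:(lra).
lra.
Qed.

Lemma Tleft_at12 : Tleft (12 / 10 ^+ 2 : R) < 34 / 10 ^+ 2.
Proof.
have e := @expRN_bounds5 R (12 / 10 ^+ 2) ltac:(lra).
have := @Tleft_bounds R (12 / 10 ^+ 2) (- (172 / 10 ^+ 3)) (- (170 / 10 ^+ 3)) (88 / 10 ^+ 2) (89 / 10 ^+ 2) ltac:(lra) ltac:(lra) ltac:(lra) ltac:(lra).
lra.
Qed.

Lemma Tleft_at059 : Tleft (59 / 10 ^+ 3 : R) < 12 / 10 ^+ 2.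
Proof.
have e := @expRN_bounds5 R (59 / 10 ^+ 3) ltac:(lra).
have := @Tleft_bounds R (59 / 10 ^+ 3) (- (405 / 10 ^+ 3)) (- (404 / 10 ^+ 3)) (94 / 10 ^+ 2) (943 / 10 ^+ 3) ltac:(lra) ltac:(lra) ltac:(lra) ltac:(lra).
lra.
Qed.

Lemma Tleft_at085 : 17 / 10 ^+ 2 < Tleft (85 / 10 ^+ 3 : R).
Proof.
have e := @expRN_bounds5 R (85 / 10 ^+ 3) ltac:(lra).
have := @Tleft_bounds R (85 / 10 ^+ 3) (- (342 / 10 ^+ 3 + 1 / 10 ^+ 4)) (- (341 / 10 ^+ 3)) (918 / 10 ^+ 3) (943 / 10 ^+ 3) ltac:(lra) ltac:(lra) ltac:(lra) ltac:(lra).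
lra.
Qed.

Lemma Tleft_at04 : 85 / 10 ^+ 3 < Tleft (4 / 10 ^+ 2 : R).
Proof.
have e := @expRN_bounds5 R (4 / 10 ^+ 2) ltac:(lra).
have := @Tleft_bounds R (4 / 10 ^+ 2) (- (44 / 10 ^+ 2)) (- (439 / 10 ^+ 3)) (96 / 10 ^+ 2) (97 / 10 ^+ 2) ltac:(lra) ltac:(lra) ltac:(lra) ltac:(lra).
lra.
Qed.

End numerics.

Section numerical_values.
Context {R : realType}.
Implicit Types (x y z u v w c : R).

(** The argument of the exponential is divided by k and the enclosure raised to the power k, which
    keeps the degree 5 Taylor bounds sharp enough to survive the 19th power. *)
Lemma Tright_bounds x y k e1 e2 h1 h2 : 0 <= x -> 10 * x / 3 - 1 = k%:R * y ->
  0 <= e1 -> e1 <= expR (- y) <= e2 -> 0 <= h1 -> h1 <= 10 * x / 3 * e1 ^+ k ->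
  10 * x / 3 * e2 ^+ k <= h2 ->
  (789 / 10 ^+ 3 + 2 / 10 ^+ 4) * h1 ^+ 19 + (23 / 10 ^+ 3 + 288 / 10 ^+ 6 + 528 / 10 ^+ 9) <= Tright x <=
  (789 / 10 ^+ 3 + 4 / 10 ^+ 4) * h2 ^+ 19 + (23 / 10 ^+ 3 + 288 / 10 ^+ 6 + 529 / 10 ^+ 9).
Proof.
move=> x0 xy e0 /andP[e1y ye2] h0 hh1 hh2.
have bb := @Tb_bounds R; have cb := @Theight_bounds R; have c0 := @Theight_gt0 R.
have hE : hump x = 10 * x / 3 * expR (- y) ^+ k.
  by rewrite /hump -expRM_natl mulrN -xy opprB.
have x30 : 0 <= 10 * x / 3 by rewrite divr_ge0// mulr_ge0.
have l : h1 <= hump x.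
  by rewrite hE (le_trans hh1)// ler_wpM2l// lerXn2r// nnegrE// expR_ge0.
have r : hump x <= h2.
  rewrite hE (le_trans _ hh2)// ler_wpM2l// lerXn2r// nnegrE ?expR_ge0//.
  by rewrite (le_trans _ ye2)// expR_ge0.
have l19 : h1 ^+ 19 <= hump x ^+ 19 by rewrite lerXn2r// nnegrE// (le_trans h0).
have r19 : hump x ^+ 19 <= h2 ^+ 19.
  by rewrite lerXn2r// nnegrE ?(le_trans _ r)// (le_trans h0).
have h19 : 0 <= h1 ^+ 19 by rewrite exprn_ge0.
rewrite /Tright {hE l r hh1 hh2}; move: (h1 ^+ 19) (h2 ^+ 19) (hump x ^+ 19) l19 r19 h19 => p q r pr rq p0.
have r0 : 0 <= r by exact: le_trans pr.
clear e1y ye2 e0 x0 xy x30.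
have hl : (789 / 10 ^+ 3 + 2 / 10 ^+ 4) * p <= Theight * r by apply: ler_pM; [lra|exact: p0|lra|exact: pr].
have hr : Theight * r <= (789 / 10 ^+ 3 + 4 / 10 ^+ 4) * q by apply: ler_pM; [lra|exact: r0|lra|exact: rq].
move: (Theight * r) hl hr => t hl hr; clear cb c0; lra.
Qed.

Lemma Tleft_at023321 : (61 / 10 ^+ 3 + 711 / 10 ^+ 6) <= Tleft ((23 / 10 ^+ 3 + 320 / 10 ^+ 6 + 780 / 10 ^+ 9) : R) <= (61 / 10 ^+ 3 + 715 / 10 ^+ 6).
Proof.
have e := @expRN_bounds5 R (23 / 10 ^+ 3 + 320 / 10 ^+ 6 + 780 / 10 ^+ 9) ltac:(lra).
have := @Tleft_bounds R (23 / 10 ^+ 3 + 320 / 10 ^+ 6 + 780 / 10 ^+ 9) (- (466 / 10 ^+ 3 + 743 / 10 ^+ 6)) (- (466 / 10 ^+ 3 + 742 / 10 ^+ 6)) (976 / 10 ^+ 3 + 949 / 10 ^+ 6) (976 / 10 ^+ 3 + 950 / 10 ^+ 6) ltac:(lra) ltac:(lra) ltac:(lra) ltac:(lra).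
lra.
Qed.

Lemma Tleft_at061665 : (124 / 10 ^+ 3 + 324 / 10 ^+ 6) <= Tleft ((61 / 10 ^+ 3 + 665 / 10 ^+ 6) : R) <= (124 / 10 ^+ 3 + 328 / 10 ^+ 6).
Proof.
have e := @expRN_bounds5 R (61 / 10 ^+ 3 + 665 / 10 ^+ 6) ltac:(lra).
have := @Tleft_bounds R (61 / 10 ^+ 3 + 665 / 10 ^+ 6) (- (398 / 10 ^+ 3 + 610 / 10 ^+ 6)) (- (398 / 10 ^+ 3 + 609 / 10 ^+ 6)) (940 / 10 ^+ 3 + 197 / 10 ^+ 6) (940 / 10 ^+ 3 + 198 / 10 ^+ 6) ltac:(lra) ltac:(lra) ltac:(lra) ltac:(lra).
lra.
Qed.

Lemma Tleft_at12427 : (390 / 10 ^+ 3 + 702 / 10 ^+ 6) <= Tleft ((124 / 10 ^+ 3 + 270 / 10 ^+ 6) : R) <= (390 / 10 ^+ 3 + 706 / 10 ^+ 6).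
Proof.
have e := @expRN_bounds5 R (124 / 10 ^+ 3 + 270 / 10 ^+ 6) ltac:(lra).
have := @Tleft_bounds R (124 / 10 ^+ 3 + 270 / 10 ^+ 6) (- (90 / 10 ^+ 3 + 42 / 10 ^+ 6)) (- (90 / 10 ^+ 3 + 41 / 10 ^+ 6)) (883 / 10 ^+ 3 + 141 / 10 ^+ 6) (883 / 10 ^+ 3 + 142 / 10 ^+ 6) ltac:(lra) ltac:(lra) ltac:(lra) ltac:(lra).
lra.
Qed.

Lemma Tleft_at12438 : (394 / 10 ^+ 3 + 875 / 10 ^+ 6) <= Tleft ((124 / 10 ^+ 3 + 380 / 10 ^+ 6) : R) <= (394 / 10 ^+ 3 + 879 / 10 ^+ 6).
Proof.
have e := @expRN_bounds5 R (124 / 10 ^+ 3 + 380 / 10 ^+ 6) ltac:(lra).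
have := @Tleft_bounds R (124 / 10 ^+ 3 + 380 / 10 ^+ 6) (- (85 / 10 ^+ 3 + 271 / 10 ^+ 6)) (- (85 / 10 ^+ 3 + 270 / 10 ^+ 6)) (883 / 10 ^+ 3 + 44 / 10 ^+ 6) (883 / 10 ^+ 3 + 45 / 10 ^+ 6) ltac:(lra) ltac:(lra) ltac:(lra) ltac:(lra).
lra.
Qed.

Lemma Tleft_at023385 : (61 / 10 ^+ 3 + 805 / 10 ^+ 6) <= Tleft ((23 / 10 ^+ 3 + 385 / 10 ^+ 6) : R) <= (61 / 10 ^+ 3 + 809 / 10 ^+ 6).
Proof.
have e := @expRN_bounds5 R (23 / 10 ^+ 3 + 385 / 10 ^+ 6) ltac:(lra).
have := @Tleft_bounds R (23 / 10 ^+ 3 + 385 / 10 ^+ 6) (- (466 / 10 ^+ 3 + 645 / 10 ^+ 6)) (- (466 / 10 ^+ 3 + 644 / 10 ^+ 6)) (976 / 10 ^+ 3 + 886 / 10 ^+ 6) (976 / 10 ^+ 3 + 887 / 10 ^+ 6) ltac:(lra) ltac:(lra) ltac:(lra) ltac:(lra).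
lra.
Qed.

Lemma Tleft_at0618 : (124 / 10 ^+ 3 + 577 / 10 ^+ 6) <= Tleft ((61 / 10 ^+ 3 + 800 / 10 ^+ 6) : R) <= (124 / 10 ^+ 3 + 581 / 10 ^+ 6).
Proof.
have e := @expRN_bounds5 R (61 / 10 ^+ 3 + 800 / 10 ^+ 6) ltac:(lra).
have := @Tleft_bounds R (61 / 10 ^+ 3 + 800 / 10 ^+ 6) (- (398 / 10 ^+ 3 + 327 / 10 ^+ 6)) (- (398 / 10 ^+ 3 + 326 / 10 ^+ 6)) (940 / 10 ^+ 3 + 70 / 10 ^+ 6) (940 / 10 ^+ 3 + 71 / 10 ^+ 6) ltac:(lra) ltac:(lra) ltac:(lra) ltac:(lra).
lra.
Qed.

Lemma Tleft_at12457 : (403 / 10 ^+ 3 + 449 / 10 ^+ 6) <= Tleft ((124 / 10 ^+ 3 + 570 / 10 ^+ 6) : R) <= (403 / 10 ^+ 3 + 453 / 10 ^+ 6).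
Proof.
have e := @expRN_bounds5 R (124 / 10 ^+ 3 + 570 / 10 ^+ 6) ltac:(lra).
have := @Tleft_bounds R (124 / 10 ^+ 3 + 570 / 10 ^+ 6) (- (75 / 10 ^+ 3 + 479 / 10 ^+ 6)) (- (75 / 10 ^+ 3 + 478 / 10 ^+ 6)) (882 / 10 ^+ 3 + 876 / 10 ^+ 6) (882 / 10 ^+ 3 + 877 / 10 ^+ 6) ltac:(lra) ltac:(lra) ltac:(lra) ltac:(lra).
lra.
Qed.

Lemma Tleft_at023288 : (61 / 10 ^+ 3 + 665 / 10 ^+ 6) <= Tleft ((23 / 10 ^+ 3 + 288 / 10 ^+ 6 + 528 / 10 ^+ 9) : R) <= (61 / 10 ^+ 3 + 669 / 10 ^+ 6).
Proof.
have e := @expRN_bounds5 R (23 / 10 ^+ 3 + 288 / 10 ^+ 6 + 528 / 10 ^+ 9) ltac:(lra).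
have := @Tleft_bounds R (23 / 10 ^+ 3 + 288 / 10 ^+ 6 + 528 / 10 ^+ 9) (- (466 / 10 ^+ 3 + 792 / 10 ^+ 6)) (- (466 / 10 ^+ 3 + 791 / 10 ^+ 6)) (976 / 10 ^+ 3 + 980 / 10 ^+ 6) (976 / 10 ^+ 3 + 981 / 10 ^+ 6) ltac:(lra) ltac:(lra) ltac:(lra) ltac:(lra).
lra.
Qed.

Lemma Tleft_at061715 : (124 / 10 ^+ 3 + 418 / 10 ^+ 6) <= Tleft ((61 / 10 ^+ 3 + 715 / 10 ^+ 6) : R) <= (124 / 10 ^+ 3 + 422 / 10 ^+ 6).
Proof.
have e := @expRN_bounds5 R (61 / 10 ^+ 3 + 715 / 10 ^+ 6) ltac:(lra).
have := @Tleft_bounds R (61 / 10 ^+ 3 + 715 / 10 ^+ 6) (- (398 / 10 ^+ 3 + 505 / 10 ^+ 6)) (- (398 / 10 ^+ 3 + 504 / 10 ^+ 6)) (940 / 10 ^+ 3 + 150 / 10 ^+ 6) (940 / 10 ^+ 3 + 151 / 10 ^+ 6) ltac:(lra) ltac:(lra) ltac:(lra) ltac:(lra).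
lra.
Qed.

Lemma Tright_at34 : (695 / 10 ^+ 3) < Tright ((340 / 10 ^+ 3) : R).
Proof.
have e := @expRN_bounds5 R ((400 / 10 ^+ 3) / 3) ltac:(lra).
have := @Tright_bounds (340 / 10 ^+ 3) ((400 / 10 ^+ 3) / 3) 1%N (875 / 10 ^+ 3 + 170 / 10 ^+ 6) (875 / 10 ^+ 3 + 180 / 10 ^+ 6) (991 / 10 ^+ 3 + 850 / 10 ^+ 6) (991 / 10 ^+ 3 + 880 / 10 ^+ 6) ltac:(lra) ltac:(lra) ltac:(lra) ltac:(lra) ltac:(lra) ltac:(lra) ltac:(lra).
lra.
Qed.

Lemma Tright_at403 : Tright ((403 / 10 ^+ 3) : R) < (340 / 10 ^+ 3).
Proof.
have e := @expRN_bounds5 R ((1 + 30 / 10 ^+ 3) / 6) ltac:(lra).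
have := @Tright_bounds (403 / 10 ^+ 3) ((1 + 30 / 10 ^+ 3) / 6) 2%N (842 / 10 ^+ 3 + 250 / 10 ^+ 6) (842 / 10 ^+ 3 + 270 / 10 ^+ 6) (952 / 10 ^+ 3 + 940 / 10 ^+ 6) (952 / 10 ^+ 3 + 990 / 10 ^+ 6) ltac:(lra) ltac:(lra) ltac:(lra) ltac:(lra) ltac:(lra) ltac:(lra) ltac:(lra).
lra.
Qed.

Lemma Tright_at403' : (330 / 10 ^+ 3) < Tright ((403 / 10 ^+ 3) : R).
Proof.
have e := @expRN_bounds5 R ((1 + 30 / 10 ^+ 3) / 6) ltac:(lra).
have := @Tright_bounds (403 / 10 ^+ 3) ((1 + 30 / 10 ^+ 3) / 6) 2%N (842 / 10 ^+ 3 + 250 / 10 ^+ 6) (842 / 10 ^+ 3 + 270 / 10 ^+ 6) (952 / 10 ^+ 3 + 940 / 10 ^+ 6) (952 / 10 ^+ 3 + 990 / 10 ^+ 6) ltac:(lra) ltac:(lra) ltac:(lra) ltac:(lra) ltac:(lra) ltac:(lra) ltac:(lra).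
lra.
Qed.

Lemma Tright_at444 : (170 / 10 ^+ 3) < Tright ((444 / 10 ^+ 3) : R).
Proof.
have e := @expRN_bounds5 R ((1 + 440 / 10 ^+ 3) / 6) ltac:(lra).
have := @Tright_bounds (444 / 10 ^+ 3) ((1 + 440 / 10 ^+ 3) / 6) 2%N (786 / 10 ^+ 3 + 620 / 10 ^+ 6) (786 / 10 ^+ 3 + 640 / 10 ^+ 6) (915 / 10 ^+ 3 + 780 / 10 ^+ 6) (915 / 10 ^+ 3 + 830 / 10 ^+ 6) ltac:(lra) ltac:(lra) ltac:(lra) ltac:(lra) ltac:(lra) ltac:(lra) ltac:(lra).
lra.
Qed.

Lemma Tright_at5 : (40 / 10 ^+ 3) < Tright ((500 / 10 ^+ 3) : R).
Proof.
have e := @expRN_bounds5 R (2 / 12) ltac:(lra).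
have := @Tright_bounds (500 / 10 ^+ 3) (2 / 12) 4%N (846 / 10 ^+ 3 + 480 / 10 ^+ 6) (846 / 10 ^+ 3 + 490 / 10 ^+ 6) (855 / 10 ^+ 3 + 680 / 10 ^+ 6) (855 / 10 ^+ 3 + 730 / 10 ^+ 6) ltac:(lra) ltac:(lra) ltac:(lra) ltac:(lra) ltac:(lra) ltac:(lra) ltac:(lra).
lra.
Qed.

Lemma Tright_at695 : Tright ((695 / 10 ^+ 3) : R) < (23 / 10 ^+ 3 + 385 / 10 ^+ 6).
Proof.
have e := @expRN_bounds5 R ((3 + 950 / 10 ^+ 3) / 24) ltac:(lra).
have := @Tright_bounds (695 / 10 ^+ 3) ((3 + 950 / 10 ^+ 3) / 24) 8%N (848 / 10 ^+ 3 + 247 / 10 ^+ 6) (848 / 10 ^+ 3 + 249 / 10 ^+ 6) (620 / 10 ^+ 3 + 929 / 10 ^+ 6) (620 / 10 ^+ 3 + 942 / 10 ^+ 6) ltac:(lra) ltac:(lra) ltac:(lra) ltac:(lra) ltac:(lra) ltac:(lra) ltac:(lra).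
lra.
Qed.

Lemma Tright_at392 : (392 / 10 ^+ 3) < Tright ((392 / 10 ^+ 3) : R).
Proof.
have e := @expRN_bounds5 R ((920 / 10 ^+ 3) / 6) ltac:(lra).
have := @Tright_bounds (392 / 10 ^+ 3) ((920 / 10 ^+ 3) / 6) 2%N (857 / 10 ^+ 3 + 840 / 10 ^+ 6) (857 / 10 ^+ 3 + 850 / 10 ^+ 6) (961 / 10 ^+ 3 + 560 / 10 ^+ 6) (961 / 10 ^+ 3 + 590 / 10 ^+ 6) ltac:(lra) ltac:(lra) ltac:(lra) ltac:(lra) ltac:(lra) ltac:(lra) ltac:(lra).
lra.
Qed.

Lemma Tright_at394 : Tright ((394 / 10 ^+ 3) : R) < (394 / 10 ^+ 3).
Proof.
have e := @expRN_bounds5 R ((940 / 10 ^+ 3) / 6) ltac:(lra).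
have := @Tright_bounds (394 / 10 ^+ 3) ((940 / 10 ^+ 3) / 6) 2%N (854 / 10 ^+ 3 + 980 / 10 ^+ 6) (854 / 10 ^+ 3 + 990 / 10 ^+ 6) (960 / 10 ^+ 3 + 30 / 10 ^+ 6) (960 / 10 ^+ 3 + 60 / 10 ^+ 6) ltac:(lra) ltac:(lra) ltac:(lra) ltac:(lra) ltac:(lra) ltac:(lra) ltac:(lra).
lra.
Qed.

End numerical_values.

(** * Lower bounds on slopes along one to four steps *)

Section slopes.
Context {R : realType}.
Implicit Types (x y z u v w c l : R) (f df : R -> R).

(** Since f is strictly decreasing, it takes the value 1/8 at most once; a single point is excluded
    and [growth_avoiding] applies to the opposite of the composite. *)
Lemma growth_comp f df u v l : u < v -> continuous f ->
  (forall x, u < x < v -> is_derive x 1 f (df x) /\ df x < 0) ->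
  (forall x, u < x < v -> f x != 8^-1 -> l <= - df x * dTleft (f x)) ->
  l * (v - u) <= Tleft (f u) - Tleft (f v).
Proof.
move=> uv cf H1 H2.
have anti x y : u < x -> x < y -> y < v -> f y < f x.
  move=> ux xy yv.
  have D z : z \in `]x, y[ -> is_derive z 1 f (df z).
    rewrite in_itv/= => /andP[xz zy]; have [] // := H1 z _.
    by rewrite (lt_trans ux xz) (lt_trans zy yv).
  have [c] := MVT xy D (continuous_subspaceT cf).
  rewrite in_itv/= => /andP[xc cy] h.
  rewrite -subr_lt0 h nmulr_rlt0 ?subr_gt0//.
  by have [] // := H1 c _; rewrite (lt_trans ux xc) (lt_trans cy yv).
have [c Hc] : exists c, forall x, u < x < v -> x != c -> f x != 8^-1.
  have [[c cuv fc]|no] := pselect (exists2 c, u < c < v & f c = 8^-1); last first.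
    by exists 0 => x xuv _; apply/eqP => fx; apply: no; exists x.
  exists c => x /andP[ux xv] xc; rewrite -fc.
  case/andP: cuv => uc cv; case: (ltgtP x c) xc => // xc _.
    by rewrite gt_eqF// anti.
  by rewrite lt_eqF// anti.
have cg : continuous (fun x => - Tleft (f x)).
  move=> x; apply: cvgN; apply: (@continuous_comp _ _ _ f (@Tleft R)); first exact: cf.
  exact: continuous_Tleft.
pose F x := - Tleft (f x); pose dF x := - df x * dTleft (f x).
have HF x : u < x < v -> x != c -> is_derive x 1 F (dF x) /\ l <= dF x.
  move=> xuv xc; have [fd _] := H1 x xuv; split; last exact: (H2 x xuv (Hc x xuv xc)).
  have D := @is_derive_Tleft R (f x) (Hc x xuv xc).
  have E := @is_derive1_comp R (@Tleft R) f x _ _ D fd.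
  rewrite (_ : dF x = - (dTleft (f x) * df x)); last by rewrite /dF mulNr mulrC.
  exact: is_deriveN.
have := @growth_avoiding R F dF u v c l (ltW uv) cg HF.
by move=> /le_trans; apply; rewrite /F opprK addrC.
Qed.

Lemma dTright_rate z r : 0 < z -> 19 * (10 / 3 - z^-1) >= r ->
  r * (Tright z - Tb) <= - dTright z.
Proof.
move=> z0 hr; rewrite /dTright -mulrN mulrC ler_wpM2l//.
  by rewrite subr_ge0 ltW// Tright_gtb.
by lra.
Qed.

Lemma rate_ge z z0 : 0 < z0 -> z0 <= z -> 19 * (10 / 3 - z0^-1) <= 19 * (10 / 3 - z^-1) :> R.
Proof.
move=> z00 z0z; rewrite ler_wpM2l// lerB// lef_pV2 ?posrE; [by []|lra|lra].
Qed.

(** One step suffices on this gap: the right branch stays well above [Tb] and its logarithmic rate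
    is at least 7. *)
Lemma slope_XA z : 34 / 10 ^+ 2 <= z <= 403 / 10 ^+ 3 -> 2 <= - dTright z.
Proof.
move=> /andP[z1 z2].
have h := @Tright_at403' R; have bb := @Tb_bounds R.
have hz : Tright (403 / 10 ^+ 3) <= Tright z by apply: Tright_le; lra.
have r : 7 <= 19 * (10 / 3 - z^-1).
  apply: (@le_trans _ _ (19 * (10 / 3 - (34 / 10 ^+ 2)^-1))); [lra|apply: rate_ge; lra].
have := @dTright_rate z 7 ltac:(lra) r; lra.
Qed.

Lemma rate_XB z : 444 / 10 ^+ 3 <= z -> 20 <= 19 * (10 / 3 - z^-1).
Proof. by move=> z1; apply: (@le_trans _ _ (19 * (10 / 3 - (444 / 10 ^+ 3)^-1))); [lra|apply: rate_ge; lra]. Qed.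

(** Two steps. A height of at least 0.12 - [Tb] makes the first slope exceed 1, and the left branch
    contributes 1.16. *)
Lemma slope_i z : 444 / 10 ^+ 3 <= z -> 12 / 10 ^+ 2 <= Tright z <= 17 / 10 ^+ 2 ->
  Tright z != 8^-1 -> 101 / 10 ^+ 2 <= - dTright z * dTleft (Tright z).
Proof.
move=> z1 /andP[y1 y2] y8; have bb := @Tb_bounds R.
have h1 := @dTright_rate z 20 ltac:(lra) (rate_XB z z1).
have h2 : 116 / 10 ^+ 2 <= dTleft (Tright z) by apply: dTleft_ge1; lra.
apply: le_trans (_ : 1 * (116 / 10 ^+ 2) <= _); first by lra.
by apply: ler_pM; lra.
Qed.

(** Three steps. The first slope is only bounded below by 0.7; the slopes 1.16 and 1.46 of the left
    branch make up for it. *)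
Lemma slope_ii z y3 : 444 / 10 ^+ 3 <= z -> 59 / 10 ^+ 3 <= Tright z <= 1 / 10 ->
  12 / 10 ^+ 2 <= y3 <= 17 / 10 ^+ 2 ->
  y3 != 8^-1 -> 101 / 10 ^+ 2 <= - (dTleft (Tright z) * dTright z) * dTleft y3.
Proof.
move=> z1 /andP[y1 y2] y3b y8; have bb := @Tb_bounds R.
have h1 := @dTright_rate z 20 ltac:(lra) (rate_XB z z1).
have h2 : 116 / 10 ^+ 2 <= dTleft (Tright z) by apply: dTleft_ge1; lra.
have h3 : 146 / 10 ^+ 2 <= dTleft y3 by exact: dTleft_ge2.
apply: (@le_trans _ _ (116 / 10 ^+ 2 * (7 / 10) * (146 / 10 ^+ 2))); first by lra.
rewrite -mulrN; apply: ler_pM; [lra|lra| |exact: h3].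
by apply: ler_pM; lra.
Qed.

(** The second image of [Tb]. It lies between 5.7e-4 and 7e-4 below 1/8, the place of the vertical
    tangent. *)
Definition beta : R := Tleft (Tleft Tb).

Lemma beta_bounds : (124 / 10 ^+ 3 + 300 / 10 ^+ 6) <= beta <= 124 / 10 ^+ 3 + 422 / 10 ^+ 6.
Proof.
rewrite /beta.
have [c1 c2] : 61 / 10 ^+ 3 + 665 / 10 ^+ 6 <= Tleft (Tb : R) /\ Tleft (Tb : R) <= 61 / 10 ^+ 3 + 715 / 10 ^+ 6.
  have bb := @Tb_bounds R.
  have a1 : Tleft (23 / 10 ^+ 3 + 288 / 10 ^+ 6 + 528 / 10 ^+ 9) <= Tleft (Tb : R).
    by apply: Tleft_le; lra.
  have a2 : Tleft (Tb : R) <= Tleft (23 / 10 ^+ 3 + 320 / 10 ^+ 6 + 780 / 10 ^+ 9).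
    by clear a1; apply: Tleft_le; lra.
  clear bb; split.
    by clear a2; have h1 := @Tleft_at023288 R; lra.
  by clear a1; have h2 := @Tleft_at023321 R; lra.
have b1 : Tleft (61 / 10 ^+ 3 + 665 / 10 ^+ 6) <= Tleft (Tleft (Tb : R)).
  by apply: Tleft_le; lra.
have b2 : Tleft (Tleft (Tb : R)) <= Tleft (61 / 10 ^+ 3 + 715 / 10 ^+ 6).
  by clear b1; apply: Tleft_le; lra.
clear c1 c2; apply/andP; split.
  by clear b2; have h := @Tleft_at061665 R; lra.
by clear b1; have h := @Tleft_at061715 R; lra.
Qed.

Lemma Tleft_ge0 x : 0 <= x <= 1 -> x <= 3 / 10 -> 0 <= Tleft x.
Proof.
move=> x01 x3; have := Tb_le_T x x01; rewrite TmapE_left//; have := @Tb_bounds R; lra.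
Qed.

Lemma dTleft_ge0 x : 0 <= x <= 1 / 10 -> 0 <= dTleft x.
Proof.
move=> x01; have x8 : x != 8^-1 by rewrite lt_eqF//; lra.
by have := @dTleft_ge1 R x ltac:(lra) x8; lra.
Qed.

(* By convexity the secant slope of [Tleft \o Tleft] on [Tb, y] is at most its
   slope at [y]. *)
Lemma secant_le y : Tb < y -> y <= 1 / 10 -> Tleft y <= 1 / 10 ->
  Tleft (Tleft y) - beta <= (y - Tb) * (dTleft y * dTleft (Tleft y)).
Proof.
move=> by_ y1 Ty1; have bb := @Tb_bounds R.
have cc : continuous (fun x : R => Tleft (Tleft x)).
  move=> x; apply: (@continuous_comp _ _ _ (@Tleft R) (@Tleft R)); exact: continuous_Tleft.
have D x : x \in `]Tb, y[ -> is_derive x 1 (fun x => Tleft (Tleft x)) (dTleft (Tleft x) * dTleft x).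
  rewrite in_itv/= => /andP[bx xy].
  have Txy : Tleft x <= Tleft y by apply: Tleft_le; lra.
  apply: is_derive1_comp; apply: is_derive_Tleft; rewrite lt_eqF//; lra.
have [c] := MVT by_ D (continuous_subspaceT cc).
rewrite in_itv/= => /andP[bc cy]; rewrite -/beta => ->.
have Tc : 0 <= Tleft c by apply: Tleft_ge0; lra.
have Tcy : Tleft c <= Tleft y by apply: Tleft_le; lra.
have Ty0 : 0 <= Tleft y by apply: Tleft_ge0; lra.
rewrite [leRHS]mulrC ler_wpM2r ?subr_ge0 ?(ltW by_)// mulrC; apply: ler_pM.
- by apply: dTleft_ge0; lra.
- by apply: dTleft_ge0; lra.
- by apply: dTleft_homo; lra.
- by apply: dTleft_homo; lra.
Qed.

(** Here v is the cube root of y - 1/8 and g = 1/8 - [beta], so that v^3 + g is y - [beta], while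
    the slope of the left branch at y is exp (-y) (1 - 3 v^2 (a + v)) / (3 v^2). The product of
    distance and slope is thus bounded below on both sides of v = 0. *)
Lemma return_slope_poly (g a v : R) : 57 / 10 ^+ 5 <= g -> a <= 507 / 10 ^+ 3 -> 0 <= a ->
  - (3 / 10 ^+ 2) <= v <= 356 / 10 ^+ 3 ->
  (142 / 10 ^+ 3) * v ^+ 2 <= (v ^+ 3 + g) * (1 - 3 * v ^+ 2 * (a + v)).
Proof.
move=> g0 a1 a0 /andP[v0 v1].
have [v15|v15] := leP v (15 / 10 ^+ 2).
  have s1 : 15 / 10 ^+ 2 * v ^+ 2 <= v ^+ 3 + g.
    (* This cubic is v^3 - 0.15 v^2 + 0.0005; its double root is placed near the minimum of (v^3 +
       g) / v^2. *)
    have : 0 <= (v - 1 / 10) ^+ 2 * (v + 1 / 20).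
      by rewrite mulr_ge0 ?sqr_ge0//; clear -v0; lra.
    by clear -g0; lra.
  have v2 : v ^+ 2 <= (15 / 10 ^+ 2) ^+ 2 by clear -v0 v15; nra.
  have f1 : 955 / 10 ^+ 3 <= 1 - 3 * v ^+ 2 * (a + v).
    have := sqr_ge0 v; clear -v15 v2 a1 => p.
    by have : v ^+ 2 * (a + v) <= v ^+ 2 * (657 / 10 ^+ 3); [apply: ler_wpM2l; lra|lra].
  apply: (@le_trans _ _ (15 / 10 ^+ 2 * v ^+ 2 * (955 / 10 ^+ 3))).
    by have := sqr_ge0 v; clear; lra.
  apply: ler_pM; [|clear; lra|exact: s1|exact: f1].
  by have := sqr_ge0 v; clear; lra.
(* For larger v the term v^3 alone is enough. Powers of v are reduced with the chord of v^2 over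
   [0.15, 0.356] and its tangent at 0.15. *)
have vv : v ^+ 2 <= 506 / 10 ^+ 3 * v - (53 / 10 ^+ 3 + 4 / 10 ^+ 4).
  have : 0 <= (v - 15 / 10 ^+ 2) * (356 / 10 ^+ 3 - v) by apply: mulr_ge0; clear -v15 v1; lra.
  by clear; lra.
have vv' : 3 / 10 * v - 225 / 10 ^+ 4 <= v ^+ 2.
  by have := sqr_ge0 (v - 15 / 10 ^+ 2); clear; lra.
have v3 : v ^+ 3 <= 506 / 10 ^+ 3 * v ^+ 2 - (53 / 10 ^+ 3 + 4 / 10 ^+ 4) * v.
  have := ler_wpM2l (_ : 0 <= v) vv; rewrite (_ : v * v ^+ 2 = v ^+ 3); last by ring.
  by move=> /(_ ltac:(clear -v15; lra)); clear; lra.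
have v4 : v ^+ 4 <= 506 / 10 ^+ 3 * v ^+ 3 - (53 / 10 ^+ 3 + 4 / 10 ^+ 4) * v ^+ 2.
  have := ler_wpM2l (_ : 0 <= v) v3; rewrite (_ : v * v ^+ 3 = v ^+ 4); last by ring.
  by move=> /(_ ltac:(clear -v15; lra)); clear; lra.
have v30 : 0 <= v ^+ 3 by rewrite exprn_ge0//; clear -v15; lra.
have av : a * v ^+ 3 <= 507 / 10 ^+ 3 * v ^+ 3 by apply: ler_wpM2r; [exact: v30|exact: a1].
have vF : 142 / 10 ^+ 3 <= v * (1 - 3 * v ^+ 2 * (a + v)).
  rewrite (_ : v * _ = v - 3 * (a * v ^+ 3) - 3 * v ^+ 4); last by ring.
  by clear -v15 v1 vv vv' v3 v4 av; lra.
have F0 : 0 <= 1 - 3 * v ^+ 2 * (a + v).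
  have vp : 0 < v by clear -v15; lra.
  rewrite -(@pmulr_rge0 _ v _ vp).
  by apply: le_trans vF; clear; lra.
set F := 1 - _ in vF F0 *.
apply: (@le_trans _ _ (v ^+ 3 * F)); last by apply: ler_wpM2r; [exact: F0|rewrite lerDl; clear -g0; lra].
rewrite (_ : v ^+ 3 * F = v * F * v ^+ 2); last by ring.
by apply: ler_wpM2r; [exact: sqr_ge0|exact: vF].
Qed.

(** Bookkeeping for the chain rule in [slope_iii]: t is the height above [Tb] after the first step,
    s the distance to [beta] two steps later. *)
Lemma slope_product r t d2 d3 d4 s dR : 0 <= d2 -> 0 <= d3 -> 0 <= d4 -> 0 <= r ->
  r * t <= - dR -> s <= t * (d2 * d3) -> r * s * d4 <= - (d3 * (d2 * dR)) * d4 :> R.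
Proof.
move=> d20 d30 d40 r0 h1 h2; rewrite ler_wpM2r//.
apply: (@le_trans _ _ (r * (t * (d2 * d3)))); first by rewrite ler_wpM2l.
rewrite -!mulrN (_ : r * _ = d3 * (d2 * (r * t))); last by ring.
by rewrite !ler_wpM2l.
Qed.

(** Four steps. The first slope is at least 25.33 (Tright z - Tb); [secant_le] turns this, after two
    more steps, into 25.33 (y4 - beta), and the last step is taken near the vertical tangent. By
    [return_slope_poly] the product is at least 25.33 * 0.843 * 0.142 / 3 > 1.01, where 0.843 bounds
    the exponential. *)
Lemma slope_iii z : 5 / 10 <= z -> Tright z <= 1 / 10 -> Tleft (Tright z) <= 1 / 10 ->
  let y4 := Tleft (Tleft (Tright z)) in
  y4 <= 17 / 10 ^+ 2 -> y4 != 8^-1 -> - (3 / 10 ^+ 2) <= cbrt (y4 - 8^-1) ->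
  101 / 10 ^+ 2 <= - (dTleft (Tleft (Tright z)) * (dTleft (Tright z) * dTright z)) * dTleft y4.
Proof.
move=> z1 y2 y3 y4 y417 y48 v3.
have z0 : 0 < z by clear -z1; lra.
have y20 : 0 <= Tright z.
  by have := Tright_gtb z z0; have := @Tb_bounds R; clear; lra.
have y30 : 0 <= Tleft (Tright z) by apply: Tleft_ge0; clear -y2 y20; lra.
have y40 : beta <= y4.
  have tb := @Tb_bounds R; have tz := Tright_gtb z z0.
  have b1 : Tleft (Tb : R) <= Tleft (Tright z) by apply: Tleft_le; clear -tb tz y2; lra.
  have b0 : 0 <= Tleft (Tb : R) by apply: Tleft_ge0; clear -tb; lra.
  by rewrite /y4 /beta; apply: Tleft_le => //; clear -y3; lra.
have bb := beta_bounds; have ab := @Ta_bounds R.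
have h := @slope_product (25 + 33 / 10 ^+ 2) (Tright z - Tb) (dTleft (Tright z))
  (dTleft (Tleft (Tright z))) (dTleft y4) (y4 - beta) (dTright z).
apply: le_trans (h _ _ _ _ _ _); last 6 first.
- by apply: dTleft_ge0; rewrite y20.
- by apply: dTleft_ge0; rewrite y30.
- have : 116 / 10 ^+ 2 <= dTleft y4 by apply: dTleft_ge1 => //; clear -y40 bb y417; lra.
  by clear; lra.
- by clear; lra.
- apply: dTright_rate => //.
  by apply: (@le_trans _ _ (19 * (10 / 3 - (5 / 10)^-1))); [clear; lra|apply: rate_ge => //; clear; lra].
- by apply: secant_le => //; exact: Tright_gtb.
clear h.
have vu : cbrt (y4 - 8^-1) <= 356 / 10 ^+ 3 by rewrite ler_cbrtl; clear -y417; lra.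
have v0 : cbrt (y4 - 8^-1) != 0 by rewrite cbrt_eq0 subr_eq0.
have yE : y4 = cbrt (y4 - 8^-1) ^+ 3 + 8^-1 by rewrite cbrtK subrK.
have e : 843 / 10 ^+ 3 <= expR (- y4).
  apply: (@le_trans _ _ (expR (- (17 / 10 ^+ 2)))); last by rewrite ler_expR lerN2.
  by have := @expRN_bounds5 R (17 / 10 ^+ 2) ltac:(clear; lra); clear; lra.
have g0 : 57 / 10 ^+ 5 <= 8^-1 - beta by clear -bb; lra.
have [a0 a1] : 0 <= (Ta : R) /\ Ta <= 507 / 10 ^+ 3 :> R by clear -ab; split; lra.
have := return_slope_poly (8^-1 - beta) Ta _ g0 a1 a0 (introT andP (conj v3 vu)).
clear bb ab g0 a0 a1.
rewrite /dTleft; move: (cbrt (y4 - 8^-1)) v0 v3 vu yE => v v0 v3 vu yE.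
have -> : v ^+ 3 + (8^-1 - beta) = y4 - beta by rewrite yE; ring.
move=> key.
have v2 : 0 < v ^+ 2 by rewrite exprn_even_gt0.
have v23 : 0 < 3 * v ^+ 2 by apply: mulr_gt0.
have -> : (3 * v ^+ 2)^-1 - Ta - v = (1 - 3 * v ^+ 2 * (Ta + v)) / (3 * v ^+ 2) by field.
rewrite [expR _ * _]mulrA mulrA ler_pdivlMr//.
set K := 1 - _ in key *; set E := expR _ in e *.
rewrite (_ : (25 + 33 / 10 ^+ 2) * (y4 - beta) * (E * K) = (25 + 33 / 10 ^+ 2) * E * ((y4 - beta) * K)); last by ring.
apply: (@le_trans _ _ ((25 + 33 / 10 ^+ 2) * (843 / 10 ^+ 3) * ((142 / 10 ^+ 3) * v ^+ 2))).
  by clear -v2; lra.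
apply: ler_pM; [clear; lra|clear -v2; lra| |exact: key].
by clear -e; lra.
Qed.

End slopes.

(** Values of the map become variables, so that [lra] works only from the linear facts kept about
    them. *)
Ltac glra :=
  repeat match goal with H : is_true _ |- _ => revert H end;
  repeat match goal with
    | |- context [@dTleft ?R ?t] => generalize (@dTleft R t)
    | |- context [@dTright ?R ?t] => generalize (@dTright R t)
    | |- context [@Tleft ?R ?t] => generalize (@Tleft R t)
    | |- context [@Tright ?R ?t] => generalize (@Tright R t)
    | |- context [@Tmap ?R ?t] => generalize (@Tmap R t)
    | |- context [@Tb ?R] => generalize (@Tb R)
  end; intros; lra.

(** * Reaching the fixed point from everywhere *)

Section reachability.
Context {R : realType}.
Implicit Types x y z u v w c l : R.

Lemma Tmap_01 x : 0 <= x <= 1 -> 0 <= Tmap x <= 1.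
Proof.
move=> x01; have := Tb_le_T x x01; have := @Tb_bounds R; have := @Tmax_bounds R.
have : Tmap x <= Tmax by apply: T_le_Tmax; case/andP: x01.
by clear; glra.
Qed.

Lemma IVT_between (f : R -> R) u v y : u <= v -> continuous f ->
  f u <= y <= f v \/ f v <= y <= f u -> exists2 x, u <= x <= v & f x = y.
Proof.
move=> uv cf H.
have h : Num.min (f u) (f v) <= y <= Num.max (f u) (f v).
  by rewrite ge_min le_max; case: H => /andP[-> ->]; rewrite ?orbT.
have [x xuv fx] := IVT uv (continuous_subspaceT cf) h.
by exists x => //; move: xuv; rewrite in_itv.
Qed.

Lemma fixed_point : exists2 p : R, 392 / 10 ^+ 3 <= p <= 394 / 10 ^+ 3 & Tmap p = p.
Proof.
have c : continuous (fun x : R => Tright x - x).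
  by move=> x; apply: cvgB; [exact: continuous_Tright|exact: cvg_id].
have [||p pI /eqP] := IVT_between _ (392 / 10 ^+ 3) (394 / 10 ^+ 3) 0 _ c.
- by clear; glra.
- by right; have := @Tright_at392 R; have := @Tright_at394 R; clear; glra.
by rewrite subr_eq0 => /eqP Tp; exists p => //; rewrite TmapE_right//; clear -pI; glra.
Qed.

Local Notation noise := (129 / 10 ^+ 6).

(* [P] plays the role of the set of points from which a neighbourhood of the
   fixed point [p] is reachable under noise of amplitude [noise]. *)
Lemma noise_reaches (P : R -> Prop) (p : R) :
  392 / 10 ^+ 3 <= p <= 394 / 10 ^+ 3 -> P p ->
  (forall x y, 0 <= x <= 1 -> 0 <= y <= 1 ->
    `|Tmap x - y| <= noise / 2 -> P y -> P x) ->
  forall x, 0 <= x <= 1 -> P x.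
Proof.
move=> pI Pp backward.
have noise_gt0 : 0 < noise :> R by clear; glra.

have backT x : 0 <= x <= 1 -> P (Tmap x) -> P x.
move=> x01; apply: backward => //; first exact: Tmap_01.
by rewrite subrr normr0 divr_ge0// ltW.

(* From just above [Tb] the orbit passes near 0.0617 and 0.1243. So close to 1/8 the left branch is
   steep enough that an interval shorter than the noise covers the whole range allowed for p. *)
have good_Tb : P (Tb + noise / 4).
have bb := @Tb_bounds R.
have h1 := @Tleft_at023321 R; have h2 := @Tleft_at023288 R.
have P1 : P (61 / 10 ^+ 3 + 665 / 10 ^+ 6).
  have [||y yI Ty] := IVT_between _ (124 / 10 ^+ 3 + 270 / 10 ^+ 6) (124 / 10 ^+ 3 + 380 / 10 ^+ 6) p _ continuous_Tleft.
  - by clear; glra.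
  - by left; have := @Tleft_at12427 R; have := @Tleft_at12438 R; clear -pI; glra.
  have Py : P y.
    apply: backT; first by clear -yI; glra.
    by rewrite TmapE_left ?Ty//; clear -yI; glra.
  apply: backward Py; [by clear; glra|by clear -yI; glra|].
  rewrite TmapE_left; last by clear; glra.
  by have := @Tleft_at061665 R; rewrite ler_norml; clear -yI; glra.
apply: backward P1; [by clear -bb; glra|by clear; glra|].
rewrite TmapE_left; last by clear -bb; glra.
have a1 : Tleft (23 / 10 ^+ 3 + 288 / 10 ^+ 6 + 528 / 10 ^+ 9) <= Tleft (Tb + noise / 4) :> R.
  by apply: Tleft_le; clear -bb; glra.
have a2 : Tleft (Tb + noise / 4) <= Tleft (23 / 10 ^+ 3 + 320 / 10 ^+ 6 + 780 / 10 ^+ 9) :> R.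
  by apply: Tleft_le; clear -bb; glra.
by rewrite ler_norml; clear -a1 a2 h1 h2; glra.

(* Aiming at [Tb + noise / 4] rather than at [Tb] makes every value in [Tb, Tb + 3 noise / 4] lie
   within noise / 2 of the target. *)
have good1 z : 0 <= z <= 1 -> Tmap z <= Tb + 3 / 4 * noise -> P z.
move=> z01 zb; have lb := Tb_le_T z z01; have bb := @Tb_bounds R.
apply: backward good_Tb => //; first by clear -bb; glra.
by rewrite ler_norml; clear -lb zb noise_gt0; glra.

(* Three explicit good intervals: [0.695, 1] is sent close to [Tb], [0.17, 0.34] is sent into
   [0.695, 1], and [0.403, 0.444] into [0.17, 0.34]. *)
have good1' z : 695 / 10 ^+ 3 <= z <= 1 -> P z.
move=> zI; apply: good1; first by clear -zI; glra.
have bb := @Tb_bounds R; have h := @Tright_at695 R.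
rewrite TmapE_right; last by clear -zI; glra.
have : Tright z <= Tright (695 / 10 ^+ 3) by apply: Tright_le; clear -zI; glra.
by clear -bb h; glra.

have good2 z : 17 / 10 ^+ 2 <= z <= 34 / 10 ^+ 2 -> P z.
move=> zI; apply: backT; first by clear -zI; glra.
apply: good1'; apply/andP; split; last first.
  by apply: le_trans (T_le_Tmax z _) _; have := @Tmax_bounds R; clear -zI; glra.
have [z3|z3] := leP z (3 / 10).
  rewrite TmapE_left//; apply: le_trans (@Tleft_at17 R) _.
  by apply: Tleft_le; clear -zI z3; glra.
rewrite TmapE_right ?(ltW z3)//; apply: le_trans (ltW (@Tright_at34 R)) _.
by apply: Tright_le; clear -zI z3; glra.

have good3 z : 403 / 10 ^+ 3 <= z <= 444 / 10 ^+ 3 -> P z.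
move=> zI; apply: backT; first by clear -zI; glra.
apply: good2; rewrite TmapE_right; last by clear -zI; glra.
have h1 : Tright z <= Tright (403 / 10 ^+ 3) by apply: Tright_le; clear -zI; glra.
have h2 : Tright (444 / 10 ^+ 3) <= Tright z by apply: Tright_le; clear -zI; glra.
by have := @Tright_at444 R; have := @Tright_at403 R; clear -h1 h2; glra.

(* A segment of positive length without good points. By [backT] a good point in its image would pull
   back, so images under a branch are bad again. *)
pose bad u v := [/\ 0 <= u, u < v, v <= 1 & forall x, u <= x <= v -> ~ P x].

(* A segment that misses the three good intervals lies in one of the gaps between them. *)
have bad_loc u v : bad u v -> [\/ v < 17 / 10 ^+ 2,
  34 / 10 ^+ 2 < u /\ v < 403 / 10 ^+ 3 | 444 / 10 ^+ 3 < u /\ v < 695 / 10 ^+ 3].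
case=> u0 uv v1 nP.
have skip s t : (forall x, s <= x <= t -> P x) -> s <= t -> v < s \/ t < u.
  move=> Pst st; have [vs|vs] := ltP v s; [by left|right].
  have [tu//|tu] := ltP t u.
  have [su|su] := leP s u.
    by have := nP u _ (Pst u _); rewrite lexx su tu (ltW uv) => /(_ isT isT).
  by have := nP s _ (Pst s _); rewrite lexx vs st (ltW su) => /(_ isT isT).
have [h1|h1] := skip (17 / 10 ^+ 2) (34 / 10 ^+ 2) good2 ltac:(clear; glra); first by constructor 1.
have [h2|h2] := skip (403 / 10 ^+ 3) (444 / 10 ^+ 3) good3 ltac:(clear; glra); first by constructor 2.
have [h3|h3] := skip (695 / 10 ^+ 3) 1 good1' ltac:(clear; glra); first by constructor 3.
by exfalso; clear -h3 v1 uv; glra.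

have bad_left u v : bad u v -> v <= 3 / 10 -> bad (Tleft u) (Tleft v).
case=> u0 uv v1 nP v3; split.
- by apply: Tleft_ge0; clear -u0 uv v3; glra.
- exact: Tleft_lt.
- rewrite -TmapE_left//; by case/andP: (Tmap_01 v ltac:(clear -u0 uv v1; glra)).
move=> y yuv Py; have [x xuv xy] := IVT_between _ u v y (ltW uv) continuous_Tleft (or_introl yuv).
apply: (nP x xuv); apply: backT; first by clear -xuv u0 v1; glra.
by rewrite TmapE_left ?xy//; clear -xuv v3; glra.

have bad_right u v : bad u v -> 3 / 10 <= u -> bad (Tright v) (Tright u).
case=> u0 uv v1 nP u3; split.
- rewrite -TmapE_right; last by clear -u3 uv; glra.
  by case/andP: (Tmap_01 v ltac:(clear -u0 uv v1; glra)).
- exact: Tright_lt.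
- rewrite -TmapE_right//; by case/andP: (Tmap_01 u ltac:(clear -u0 uv v1; glra)).
move=> y yuv Py; have [x xuv xy] := IVT_between _ u v y (ltW uv) continuous_Tright (or_intror yuv).
apply: (nP x xuv); apply: backT; first by clear -xuv u0 v1; glra.
by rewrite TmapE_right ?xy//; clear -xuv u3; glra.

(* In the first two gaps one step expands. In the third, the image falls into the first gap, and the
   left branch is iterated until the image passes 0.34. *)
have bad_expand u v : bad u v -> exists u' v', bad u' v' /\ 101 / 10 ^+ 2 * (v - u) <= v' - u'.
move=> B; have [u0 uv v1 nP] := B.
have [v17|[u34 v403]|[u444 v695]] := bad_loc _ _ B.
- have v3 : v <= 3 / 10 by clear -v17; glra.
  exists (Tleft u), (Tleft v); split; first exact: bad_left.
  apply: (@growth_avoiding R (@Tleft R) (@dTleft R) u v 8^-1 _ (ltW uv) continuous_Tleft).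
  move=> x xuv x8; split; first exact: is_derive_Tleft.
  have : 116 / 10 ^+ 2 <= dTleft x by apply: dTleft_ge1 => //; clear -u0 v17 xuv; glra.
  by clear; glra.
- have u3 : 3 / 10 <= u by clear -u34; glra.
  exists (Tright v), (Tright u); split; first exact: bad_right.
  have c : continuous (fun x => - Tright x : R) by move=> x; apply: cvgN; exact: continuous_Tright.
  have D x : u < x < v -> x != 0 -> is_derive x 1 (fun x => - Tright x) (- dTright x) /\ 101 / 10 ^+ 2 <= - dTright x.
    move=> xuv x0; have := is_derive_Tright x x0; split; first exact: is_deriveN.
    have := @slope_XA R x ltac:(clear -xuv u34 v403; glra); clear; glra.
  have := @growth_avoiding R (fun x => - Tright x) (fun x => - dTright x) u v 0 _ (ltW uv) c D.
  by move=> /le_trans; apply; rewrite opprK addrC.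
have u3 : 3 / 10 <= u by clear -u444; glra.
have D x : u < x < v -> is_derive x 1 (@Tright R) (dTright x) /\ dTright x < 0.
  move=> xuv; split; first by apply: is_derive_Tright; rewrite gt_eqF//; clear -xuv u444; glra.
  by apply: dTright_lt0; clear -xuv u444; glra.
have mT x y : u <= x -> x <= y -> Tright y <= Tright x.
  by move=> ux xy; apply: Tright_le => //; clear -ux u3; glra.
have B1 := bad_right _ _ B u3.
have y17 : Tright u < 17 / 10 ^+ 2.
  have h : Tright u <= Tright (403 / 10 ^+ 3) by apply: Tright_le; clear -u444; glra.
  have h' := @Tright_at403 R; have [_ vu _ _] := B1.
  by case: (bad_loc _ _ B1) => [//|[a _]|[a _]]; exfalso; clear -h h' a vu; glra.
(* Otherwise v itself would be good by [good1]; this keeps the image at a definite distance from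
   [Tb]. *)
have tb : Tb + 3 / 4 * noise < Tright v.
  rewrite ltNge; apply/negP => h; apply: (nP v); first by rewrite lexx ltW.
  apply: good1; first by clear -u0 uv v1; glra.
  by rewrite TmapE_right//; clear -u3 uv; glra.
have bb := @Tb_bounds R.
have y3 : Tright u <= 3 / 10 by clear -y17; glra.
have B2 := bad_left _ _ B1 y3.
have range x : u < x < v -> Tright v <= Tright x <= Tright u.
  by move=> /andP[ux xv]; apply/andP; split; apply: mT => //; [exact: ltW|exact: ltW|exact: ltW].
have lo : 23 / 10 ^+ 3 + 385 / 10 ^+ 6 <= Tright v by move: tb; clear -bb; glra.
have at12 y : y <= 17 / 10 ^+ 2 -> 34 / 10 ^+ 2 < Tleft y -> 0 <= y -> 12 / 10 ^+ 2 <= y.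
  move=> y17' Ty y0; rewrite leNgt; apply/negP => y12.
  have := @Tleft_at12 R; have : Tleft y <= Tleft (12 / 10 ^+ 2) by apply: Tleft_le; clear -y12 y0; glra.
  by clear -Ty; glra.
(* first return at time 2 *)
have x17 x : u < x < v -> Tright x <= 17 / 10 ^+ 2 by move=> /range; clear -y17; glra.
have [z17|z34] : Tleft (Tright u) < 17 / 10 ^+ 2 \/ 34 / 10 ^+ 2 < Tleft (Tright v).
- by case: (bad_loc _ _ B2) => [|[a _]|[a _]]; [by left|by right|right; clear -a; glra].
  2: {
  exists (Tleft (Tright v)), (Tleft (Tright u)); split=> //.
  apply: (@growth_comp R (@Tright R) (@dTright R) u v _ uv continuous_Tright D) => x xuv x8.
  have xr := range x xuv.
  apply: slope_i; [by clear -xuv u444; glra| |exact: x8].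
  rewrite x17// andbT; apply: (@le_trans _ _ (Tright v)); last by case/andP: xr.
  apply: at12 => //; last by clear -lo; glra.
  by case: B1 => _ b _ _; clear -y17 b; glra. }
have B3 := bad_left _ _ B2 ltac:(clear -z17; glra).
have c2 : continuous (fun x : R => Tleft (Tright x)).
  by move=> x; apply: (@continuous_comp _ _ _ (@Tright R) (@Tleft R)); [exact: continuous_Tright|exact: continuous_Tleft].
have y2u : Tright u <= 1 / 10.
  rewrite leNgt; apply/negP => h; have := @Tleft_at085 R.
  have : Tleft (85 / 10 ^+ 3) <= Tleft (Tright u) by apply: Tleft_le; clear -y17 h; glra.
  by clear -z17; glra.
have D2 x : u < x < v -> is_derive x 1 (fun x => Tleft (Tright x)) (dTleft (Tright x) * dTright x) /\
    dTleft (Tright x) * dTright x < 0.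
  move=> xuv; have xr := range x xuv; have [d n] := D x xuv.
  have x8 : Tright x != 8^-1 by rewrite lt_eqF//; clear -y2u xr; glra.
  split; first by apply: is_derive1_comp; exact: is_derive_Tleft.
  rewrite pmulr_rlt0//; have : 116 / 10 ^+ 2 <= dTleft (Tright x); last by clear; glra.
  by apply: dTleft_ge1 => //; clear -y2u xr lo; glra.
have range2 x : u < x < v -> Tleft (Tright v) <= Tleft (Tright x) <= Tleft (Tright u).
  by move=> /range xr; apply/andP; split; apply: Tleft_le; clear -xr lo y17; glra.
have pos2 : 0 <= Tleft (Tright v) by case: B2.
have [w17|w34] : Tleft (Tleft (Tright u)) < 17 / 10 ^+ 2 \/ 34 / 10 ^+ 2 < Tleft (Tleft (Tright v)).
- by case: (bad_loc _ _ B3) => [|[a _]|[a _]]; [by left|by right|right; clear -a; glra].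
  2: {
  exists (Tleft (Tleft (Tright v))), (Tleft (Tleft (Tright u))); split=> //.
  apply: (@growth_comp R (fun x => Tleft (Tright x)) _ u v _ uv c2 D2) => x xuv x8.
  have xr := range x xuv; have xr2 := range2 x xuv.
  have v12 : 12 / 10 ^+ 2 <= Tleft (Tright v).
    by apply: at12 => //; case: B2 => _ b _ _; clear -z17 b; glra.
  have v59 : 59 / 10 ^+ 3 <= Tright v.
    rewrite leNgt; apply/negP => h; have := @Tleft_at059 R.
    have : Tleft (Tright v) <= Tleft (59 / 10 ^+ 3) by apply: Tleft_le; clear -lo h; glra.
    by clear -v12; glra.
  apply: slope_ii; [by clear -xuv u444; glra|by clear -v59 y2u xr; glra| |exact: x8].
  by clear -v12 z17 xr2; glra. }
have B4 := bad_left _ _ B3 ltac:(clear -w17; glra).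
have c3 : continuous (fun x : R => Tleft (Tleft (Tright x))).
  by move=> x; apply: (@continuous_comp _ _ _ (fun x => Tleft (Tright x)) (@Tleft R)); [exact: c2|exact: continuous_Tleft].
have y3u : Tleft (Tright u) <= 85 / 10 ^+ 3.
  rewrite leNgt; apply/negP => h; have := @Tleft_at085 R.
  have : Tleft (85 / 10 ^+ 3) <= Tleft (Tleft (Tright u)) by apply: Tleft_le; clear -z17 h; glra.
  by clear -w17; glra.
have y2u' : Tright u <= 4 / 10 ^+ 2.
  rewrite leNgt; apply/negP => h; have := @Tleft_at04 R.
  have : Tleft (4 / 10 ^+ 2) <= Tleft (Tright u) by apply: Tleft_le; clear -y2u h; glra.
  by clear -y3u; glra.
have u5 : 5 / 10 <= u.
  rewrite leNgt; apply/negP => h; have := @Tright_at5 R.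
  have : Tright (500 / 10 ^+ 3) <= Tright u by apply: Tright_le; clear -u3 h; glra.
  by clear -y2u'; glra.
have D3 x : u < x < v -> is_derive x 1 (fun x => Tleft (Tleft (Tright x)))
      (dTleft (Tleft (Tright x)) * (dTleft (Tright x) * dTright x)) /\
    dTleft (Tleft (Tright x)) * (dTleft (Tright x) * dTright x) < 0.
  move=> xuv; have xr := range2 x xuv; have [d n] := D2 x xuv.
  have x8 : Tleft (Tright x) != 8^-1 by rewrite lt_eqF//; clear -y3u xr; glra.
  split; first exact: (@is_derive1_comp R (@Tleft R) (fun x => Tleft (Tright x)) x _ _ (is_derive_Tleft _ x8) d).
  rewrite pmulr_rlt0//; have : 116 / 10 ^+ 2 <= dTleft (Tleft (Tright x)); last by clear; glra.
  by apply: dTleft_ge1 => //; clear -y3u xr pos2; glra.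
have range3 x : u < x < v -> Tleft (Tleft (Tright v)) <= Tleft (Tleft (Tright x)) <= Tleft (Tleft (Tright u)).
  by move=> /range2 xr; apply/andP; split; apply: Tleft_le; clear -xr y3u pos2; glra.
have pos3 : 0 <= Tleft (Tleft (Tright v)) by case: B3.
(* past the noise level, the fourth iterate falls beyond the second good set *)
have lo2 : 61 / 10 ^+ 3 + 800 / 10 ^+ 6 <= Tleft (Tright v).
  have h := @Tleft_at023385 R.
  have : Tleft (23 / 10 ^+ 3 + 385 / 10 ^+ 6) <= Tleft (Tright v).
    by apply: Tleft_le; case: B1 => _ b _ _; clear -lo b y2u; glra.
  by clear -h; glra.
have lo3 : 124 / 10 ^+ 3 + 570 / 10 ^+ 6 <= Tleft (Tleft (Tright v)).
  have h := @Tleft_at0618 R.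
  have : Tleft (61 / 10 ^+ 3 + 800 / 10 ^+ 6) <= Tleft (Tleft (Tright v)).
    by apply: Tleft_le; case: B2 => _ b _ _; clear -lo2 b y3u; glra.
  by clear -h; glra.
have lo4 : 403 / 10 ^+ 3 < Tleft (Tleft (Tleft (Tright v))).
  have h := @Tleft_at12457 R.
  have : Tleft (124 / 10 ^+ 3 + 570 / 10 ^+ 6) <= Tleft (Tleft (Tleft (Tright v))).
    by apply: Tleft_le; case: B3 => _ b _ _; clear -lo3 b w17; glra.
  by clear -h; glra.
have v444 : 444 / 10 ^+ 3 < Tleft (Tleft (Tleft (Tright v))).
  have [_ b _ _] := B4.
  by case: (bad_loc _ _ B4) => [a|[_ a]|[a _]//]; exfalso; clear -a b lo4; glra.
exists (Tleft (Tleft (Tleft (Tright v)))), (Tleft (Tleft (Tleft (Tright u)))); split=> //.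
apply: (@growth_comp R (fun x => Tleft (Tleft (Tright x))) _ u v _ uv c3 D3) => x xuv x8.
have xr := range x xuv; have xr2 := range2 x xuv; have xr3 := range3 x xuv.
apply: slope_iii.
- by clear -xuv u5; glra.
- by clear -xr y2u; glra.
- by clear -xr2 y3u; glra.
- by clear -xr3 w17; glra.
- exact: x8.
have y4v : Tleft (Tleft (Tleft (Tright v))) <= Tleft (Tleft (Tleft (Tright x))).
  by apply: Tleft_le; clear -xr3 pos3 w17; glra.
(* If the cube root were below -0.03, the next image would be at most 0.444, whereas the fourth
   image of the interval lies above 0.444. *)
rewrite leNgt; apply/negP => vneg.
have : Tleft (Tleft (Tleft (Tright x))) <= 444 / 10 ^+ 3.
  move: vneg xr3; set y := Tleft (Tleft (Tright x)) => vneg xr3.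
  have ab := @Ta_bounds R.
  have e : expR (- y) <= 883 / 10 ^+ 3.
    apply: (@le_trans _ _ (expR (- (124 / 10 ^+ 3 + 5 / 10 ^+ 4)))); last first.
      by have := @expRN_bounds5 R (124 / 10 ^+ 3 + 5 / 10 ^+ 4) ltac:(clear; glra); clear; glra.
    by rewrite ler_expR lerN2; clear -xr3 lo3; glra.
  have t : (Ta + cbrt (y - 8^-1)) * expR (- y) <= (476 / 10 ^+ 3 + 1 / 10 ^+ 4) * (883 / 10 ^+ 3) :> R.
    have [n|n] := leP 0 (Ta + cbrt (y - 8^-1)).
      by apply: ler_pM; [exact: n|exact: expR_ge0|clear -ab vneg; glra|exact: e].
    apply: (@le_trans _ _ 0); last by clear; glra.
    by rewrite nmulr_rle0// expR_ge0.
  by rewrite /Tleft; clear -t bb; glra.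
by clear -v444 y4v; glra.
(* Each expansion adds at least d / 100 to a length bounded by 1; k counts the expansions still to
   be made. *)
have main k u v : bad u v -> forall d, 0 < d -> d <= v - u -> 1 < (v - u) + k%:R * (d / 100) -> False.
  elim: k u v => [|k IH] u v B d d0 dv.
    by case: B => u0 uv v1 _; rewrite mul0r; clear -u0 v1; glra.
  have [u' [v' [B' ex]]] := bad_expand u v B.
  rewrite -natr1 => big; apply: (IH u' v' B' d d0); first by clear -ex dv d0; glra.
  by clear -ex dv big; glra.
move=> x x01; pose T0 := Tmap x.
have T01 := Tb_le_T x x01; have bb := @Tb_bounds R.
have Tm : Tmap x <= Tmax by apply: T_le_Tmax; case/andP: x01.
have mm := @Tmax_bounds R.
have [[y yI Py]|no] := pselect (exists2 y, Tmap x <= y <= Tmap x + noise / 2 & P y).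
  apply: backward Py => //; first by clear -yI T01 Tm mm bb; glra.
  by rewrite ler_norml; clear -yI; glra.
(* Without a good point within reach of x, the interval reached upwards by the noise would itself be
   bad, and [main] excludes this. *)
have B : bad (Tmap x) (Tmap x + noise / 2).
  split; [clear -T01 bb; glra|clear; glra|clear -Tm mm; glra|].
  by move=> y yI Py; apply: no; exists y.
exfalso.
have [k kb] : exists k : nat, 1 < k%:R * (noise / 2 / 100) :> R.
  exists (Num.bound (1 / (noise / 2 / 100) : R)).
  rewrite -ltr_pdivrMr; last by clear; glra.
  by apply: archi_boundP; clear; glra.
apply: (main k _ _ B (noise / 2)); [by clear; glra|by clear; glra|].
by move: kb; clear; glra.
Qed.

End reachability.

(** * Noise operators *)

Section kernel_operators.
Context {R : realType} {d : measure_display} {T : measurableType d}.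
Variable m : {sigma_finite_measure set T -> \bar R}.
Notation leb := (@lebesgue_measure R).
Notation T_R := (measurableTypeR R).

(** The reference measure m is left general: Lebesgue measure for densities, the stationary
    probability, and Stieltjes measures all occur. *)
Definition Kop (k : T * T_R -> R) (u : T -> R) (y : T_R) : R :=
  \int[m]_x (k (x, y) * u x).

Lemma integrable_bounded_mul (f u : T -> R) (M : R) :
  measurable_fun setT f -> (forall x, `|f x| <= M) ->
  m.-integrable setT (EFin \o u) -> m.-integrable setT (EFin \o (fun x => f x * u x)).
Proof.
move=> mf fM iu; have M0 : 0 <= `|M| by [].
have mu_ : measurable_fun setT u by apply/measurable_EFinP; exact: measurable_int iu.
apply: (@le_integrable _ _ _ m setT _ _ (fun x => (`|M|)%:E * (EFin \o u) x)%E) => //.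
- by apply/measurable_EFinP; exact: measurable_funM.
- move=> x _ /=; rewrite lee_fin !normrM normr_id ler_wpM2r//.
  by rewrite (le_trans (fM x))// ler_norm.
- exact: integrableZl.
Qed.

Section bounded_kernel.
Variables (k : T * T_R -> R) (M C : R) (u : T -> R).
Hypotheses (mk : measurable_fun setT k) (kM : forall z, `|k z| <= M).
Hypothesis kC : forall x, (\int[leb]_y (`|k (x, y)|)%:E <= C%:E)%E.
Hypothesis iu : m.-integrable setT (EFin \o u).

Let mu_ : measurable_fun setT u.
Proof. by apply/measurable_EFinP; exact: measurable_int iu. Qed.

Let mkx x : measurable_fun setT (fun y => k (x, y)).
Proof. exact: measurableT_comp. Qed.

Let mky y : measurable_fun setT (fun x => k (x, y)).
Proof. exact: measurableT_comp. Qed.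

Let mF (phi : T_R -> R) : measurable_fun setT phi ->
  measurable_fun setT (fun z : T * T_R => phi z.2 * (k z * u z.1)).
Proof.
move=> mphi; apply: measurable_funM; first exact: measurableT_comp.
by apply: measurable_funM => //; exact: measurableT_comp.
Qed.

Lemma Kop_section_integrable y : m.-integrable setT (EFin \o (fun x => k (x, y) * u x)).
Proof. exact: (@integrable_bounded_mul _ _ M). Qed.

Let int_abs : (\int[m]_x \int[leb]_y (`|k (x, y) * u x|)%:E <= C%:E * \int[m]_x (`|u x|)%:E)%E.
Proof.
have C0 : 0 <= C by rewrite -lee_fin (le_trans _ (kC point))// integral_ge0.
rewrite -ge0_integralZl//; last first.
- by apply/measurable_EFinP; exact: measurableT_comp.
apply: ge0_le_integral => //.
- by move=> x _; rewrite integral_ge0.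
- apply: (@measurable_fun_fubini_tonelli_F _ _ _ _ _ leb (fun z : T * T_R => (`|k z * u z.1|)%:E)) => //.
  apply/measurable_EFinP; apply: measurableT_comp => //.
  by apply: measurable_funM => //; exact: measurableT_comp.
- by apply: emeasurable_funM => //; apply/measurable_EFinP; exact: measurableT_comp.
move=> x _; under eq_integral do rewrite normrM EFinM muleC.
rewrite ge0_integralZl//; last first.
  by apply/measurable_EFinP; exact: measurableT_comp.
by rewrite muleC lee_wpmul2r// lee_fin.
Qed.

Let norm_fin : (C%:E * \int[m]_x (`|u x|)%:E < +oo)%E.
Proof.
have [_ h] := integrableP _ _ _ iu.
by rewrite lte_mul_pinfty// lee_fin -lee_fin (le_trans _ (kC point))// integral_ge0.
Qed.

Lemma Kop_measurable : measurable_fun setT (Kop k u).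
Proof.
have mG : measurable_fun setT (fun z : T * T_R => k z * u z.1).
  by apply: measurable_funM => //; exact: measurableT_comp.
have iF : (m \x leb)%E.-integrable setT (EFin \o (fun z : T * T_R => k z * u z.1)).
  apply/integrable12ltyP; first exact/measurable_EFinP.
  by apply: le_lt_trans int_abs norm_fin.
apply/measurable_EFinP; have := measurable_fubini_G iF.
apply: eq_measurable_fun => y _.
rewrite /fubini_G /Kop /Rintegral/= fineK//.
exact: integrable_fin_num (Kop_section_integrable y).
Qed.

Let norm_le : (\int[leb]_y (`|Kop k u y|)%:E <= C%:E * \int[m]_x (`|u x|)%:E)%E.
Proof.
apply: le_trans int_abs.
have mG : measurable_fun setT (fun z : T * T_R => (`|k z * u z.1|)%:E).
  apply/measurable_EFinP; apply: measurableT_comp => //.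
  by apply: measurable_funM => //; exact: measurableT_comp.
rewrite (@fubini_tonelli _ _ _ _ _ m leb (fun z => (`|k z * u z.1|)%:E))//.
apply: ge0_le_integral => //.
- by apply/measurable_EFinP; apply: measurableT_comp => //; exact: Kop_measurable.
- exact: (@measurable_fun_fubini_tonelli_G _ _ _ _ _ m (fun z => (`|k z * u z.1|)%:E)).
move=> y _; rewrite EFin_normr_Rintegral//; last exact: Kop_section_integrable.
apply: le_abse_integral => //.
exact: measurable_int (Kop_section_integrable y).
Qed.

Lemma Kop_integrable : leb.-integrable setT (EFin \o Kop k u).
Proof.
apply/integrableP; split; first by apply/measurable_EFinP; exact: Kop_measurable.
exact: le_lt_trans norm_le norm_fin.
Qed.

Lemma Kop_norm : \int[leb]_y `|Kop k u y| <= C * \int[m]_x `|u x|.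
Proof.
rewrite -lee_fin EFinM /Rintegral !fineK//.
- exact: integrable_fin_num (integrable_norm iu).
- exact: integrable_fin_num (integrable_norm Kop_integrable).
Qed.

Lemma Kop_bound y : `|Kop k u y| <= M * \int[m]_x `|u x|.
Proof.
apply: le_trans (le_normr_Rintegral _ (Kop_section_integrable y)) _ => //.
rewrite -RintegralZl//; last exact: integrable_norm.
apply: le_Rintegral => //.
- exact: integrable_norm (Kop_section_integrable y).
- have := integrableZl (mu := m) (D := setT) measurableT M (integrable_norm iu).
  by apply: eq_integrable.
by move=> x _; rewrite normrM ler_wpM2r.
Qed.

(** Fubini, with absolute convergence from the bound on phi and the mass bound [kC]. It serves with
    phi constant for total masses, an indicator for densities, a hitting probability for Doeblin's
    condition, and a derivative for integration by parts. *)
Lemma Kop_dual (phi : T_R -> R) (B : R) :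
  measurable_fun setT phi -> (forall y, `|phi y| <= B) ->
  \int[leb]_y (phi y * Kop k u y) =
  \int[m]_x ((\int[leb]_y (phi y * k (x, y))) * u x).
Proof.
move=> mphi phiB.
have B0 : 0 <= B by exact: le_trans (phiB point).
have ik x : leb.-integrable setT (EFin \o (fun y => k (x, y))).
  apply/integrableP; split; first exact/measurable_EFinP.
  by apply: le_lt_trans (kC x) _; exact: ltry.
have ipk x : leb.-integrable setT (EFin \o (fun y => phi y * k (x, y))).
  apply: (@le_integrable _ _ _ leb setT _ _ (fun y => B%:E * (EFin \o (fun y => k (x, y))) y)%E) => //.
  - by apply/measurable_EFinP; exact: measurable_funM.
  - by move=> y _ /=; rewrite lee_fin !normrM ler_wpM2r// (ger0_norm B0).
  - by apply: integrableZl => //; exact: ik.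
have iF : (m \x leb)%E.-integrable setT (EFin \o (fun z : T * T_R => phi z.2 * (k z * u z.1))).
  apply/integrable12ltyP; first by apply/measurable_EFinP; exact: mF.
  apply: (@le_lt_trans _ _ (B%:E * (C%:E * \int[m]_x (`|u x|)%:E))%E); last first.
    by rewrite lte_mul_pinfty.
  apply: (@le_trans _ _ (B%:E * \int[m]_x \int[leb]_y (`|k (x, y) * u x|)%:E)%E); last first.
    by rewrite lee_wpmul2l// int_abs.
  have mG : measurable_fun setT (fun z : T * T_R => (`|k z * u z.1|)%:E).
    apply/measurable_EFinP; apply: measurableT_comp => //.
    by apply: measurable_funM => //; exact: measurableT_comp.
  have mH : measurable_fun setT (fun z : T * T_R => (`|phi z.2 * (k z * u z.1)|)%:E).
    by apply/measurable_EFinP; apply: measurableT_comp => //; exact: mF.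
  rewrite -ge0_integralZl//; last 2 first.
  - exact: (@measurable_fun_fubini_tonelli_F _ _ _ _ _ leb (fun z => (`|k z * u z.1|)%:E)).
  - by move=> x _; rewrite integral_ge0.
  apply: ge0_le_integral => //.
  - by move=> x _; rewrite integral_ge0.
  - exact: (@measurable_fun_fubini_tonelli_F _ _ _ _ _ leb (fun z => (`|phi z.2 * (k z * u z.1)|)%:E)).
  - apply: emeasurable_funM => //.
    exact: (@measurable_fun_fubini_tonelli_F _ _ _ _ _ leb (fun z => (`|k z * u z.1|)%:E)).
  move=> x _.
  have mku : measurable_fun setT (fun y => k (x, y) * u x).
    by apply: measurable_funM; [exact: mkx|exact: measurable_cst].
  rewrite -ge0_integralZl//; last first.
    by apply/measurable_EFinP; apply: measurableT_comp.
  apply: ge0_le_integral => //.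
  - by apply/measurable_EFinP; apply: measurableT_comp => //; apply: measurable_funM => //; exact: mku.
  - by apply: emeasurable_funM => //; apply/measurable_EFinP; apply: measurableT_comp => //; exact: mku.
  by move=> y _; rewrite -EFinM lee_fin normrM ler_wpM2r.
rewrite /Rintegral; congr fine.
have := Fubini iF => /= E.
transitivity (\int[leb]_y \int[m]_x (phi y * (k (x, y) * u x))%:E)%E.
  apply: eq_integral => y _; rewrite EFinM /Kop /Rintegral fineK; last first.
    exact: integrable_fin_num (Kop_section_integrable y).
  under [RHS]eq_integral do rewrite EFinM.
  by rewrite integralZl//; exact: Kop_section_integrable.
rewrite -E; apply: eq_integral => x _.
under eq_integral do rewrite mulrA EFinM.
rewrite integralZr//; last exact: ipk.
by rewrite EFinM fineK//; exact: integrable_fin_num (ipk x).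
Qed.

End bounded_kernel.
End kernel_operators.

(** * Reflection at the boundary of [0, 1] *)

Section folding.
Context {R : realType}.
Notation leb := (@lebesgue_measure R).
Notation T_R := (measurableTypeR R).
Implicit Types x y z : R.

Lemma fold01_lbound x : has_inf (range (fun i : int => `|x - 2 * i%:~R|)).
Proof.
split; first by exists `|x - 2 * 0%:~R|, 0.
by exists 0 => _ [i _ <-].
Qed.

Lemma fold01_le x y : fold01 x <= fold01 y + `|x - y|.
Proof.
rewrite -lerBlDr; apply: lb_le_inf; first by case: (fold01_lbound y).
move=> _ [i _ <-]; rewrite lerBlDr.
apply: (@le_trans _ _ `|x - 2 * i%:~R|).
  by apply: ge_inf; [case: (fold01_lbound x)|exists i].
have := ler_normD (x - y) (y - 2 * i%:~R); rewrite subrKA; lra.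
Qed.

Lemma continuous_fold01 : continuous (@fold01 R).
Proof.
move=> x; apply/cvgrPdist_le => e e0; near=> y.
have xy : `|x - y| <= e.
  by near: y; apply/nbhs_ballP; exists e => // y; rewrite /ball/= => /ltW.
rewrite ler_norml.
have := fold01_le x y; have := fold01_le y x; rewrite (distrC y x); lra.
Unshelve. all: by end_near. Qed.

Lemma measurable_fold01 : measurable_fun setT (@fold01 R : T_R -> T_R).
Proof. exact: continuous_measurable_fun continuous_fold01. Qed.

(** Distinct even integers are at least 2 apart, so one within distance 1 of x is a nearest one. *)
Lemma fold01E x (j : int) : `|x - 2 * j%:~R| <= 1 -> fold01 x = `|x - 2 * j%:~R|.
Proof.
move=> xj; apply/le_anti/andP; split.
  by apply: ge_inf; [case: (fold01_lbound x)|exists j].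
apply: lb_le_inf; first by case: (fold01_lbound x).
move=> _ [i _ <-]; have [->//|ij] := eqVneq i j.
apply: (le_trans (xj)).
have h1 : 2 <= `|2 * (j%:~R - i%:~R) : R|.
  rewrite normrM gtr0_norm// ler_peMr// -intrB -intr_norm -[1](mulr1z (1 : R)) ler_int.
  by rewrite -gtz0_ge1 normr_gt0 subr_eq0 eq_sym.
have h2 : `|2 * (j%:~R - i%:~R) : R| <= `|x - 2 * i%:~R| + `|x - 2 * j%:~R|.
  have -> : 2 * (j%:~R - i%:~R) = (x - 2 * i%:~R) - (x - 2 * j%:~R) :> R by ring.
  exact: ler_normB.
lra.
Qed.

Lemma fold01_id x : 0 <= x <= 1 -> fold01 x = x.
Proof.
move=> x01; rewrite (@fold01E x 0) mulr0 subr0 ?ger0_norm//; lra.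
Qed.

Lemma fold01_cases x : -1 <= x <= 2 -> [\/ fold01 x = x, fold01 x = - x | fold01 x = 2 - x].
Proof.
move=> x12; have [x0|x0] := leP x 0.
  by constructor 2; rewrite (@fold01E x 0) mulr0 subr0 ?ler0_norm//; lra.
have [x1|x1] := leP x 1.
  by constructor 1; rewrite fold01_id//; lra.
by constructor 3; rewrite (@fold01E x 1) mulr1z mulr1 ler0_norm; lra.
Qed.

Lemma lebesgue_measureD (c : R) (A : set T_R) : measurable A ->
  leb ((fun x => x + c) @^-1` A) = leb A.
Proof.
move=> mA; pose s : T_R -> T_R := fun x => x + c.
have ms : measurable_fun setT s by exact: measurable_funD.
transitivity (pushforward leb s A) => //.
apply/esym/lebesgue_measure_unique => //= _ [[a b]] _ <-.
rewrite /pushforward/=.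
have -> : s @^-1` `]a, b] = `]a - c, b - c]%classic.
  by apply/seteqP; split=> x; rewrite /s/= !in_itv/= ltrBlDr lerBrDr.
rewrite !lebesgue_measure_itv/= !lte_fin ltrD2r.
by case: ifP => // _; rewrite -!EFinB; congr (_%:E); ring.
Qed.

Lemma lebesgue_measure_subl (c : R) (A : set T_R) : measurable A ->
  leb ((fun x => c - x) @^-1` A) = leb A.
Proof.
move=> mA; pose s : T_R -> T_R := fun x => x + c.
have ms : measurable_fun setT s by exact: measurable_funD.
have mB : measurable (s @^-1` A) by rewrite -[X in measurable X]setTI; exact: ms.
transitivity (leb (s @^-1` A)); last exact: lebesgue_measureD.
rewrite -(lebesgue_measureN mB) /pushforward; congr (leb _).
by apply/seteqP; split => x; rewrite /s/= addrC.
Qed.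

(** For shifts of size at most 1 the folding is one of three isometries, each of which preserves
    null sets. This gives absolute continuity even when the noise is reflected. *)
Lemma fold01_null z (A : set T_R) : measurable A -> leb A = 0 -> 0 <= z <= 1 ->
  leb ([set t | `|t| <= 1 /\ A (fold01 (z + t))]) = 0.
Proof.
move=> mA A0 z01.
pose B1 := (fun t => t + z) @^-1` A; pose B2 := (fun t => - z - t) @^-1` A.
pose B3 := (fun t => 2 - z - t) @^-1` A.
have m1 : measurable B1.
  by rewrite /B1 -[X in measurable X]setTI; apply: measurable_funD.
have m2 : measurable B2.
  by rewrite /B2 -[X in measurable X]setTI; apply: measurable_funB.
have m3 : measurable B3.
  by rewrite /B3 -[X in measurable X]setTI; apply: measurable_funB.
have B0 : leb (B1 `|` B2 `|` B3) = 0.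
  apply/eqP; rewrite -measure_le0.
  apply: le_trans (measureU2 _ _ _) _ => //; first exact: measurableU.
  have e3 : leb B3 = 0 by rewrite /B3 lebesgue_measure_subl.
  have e1 : leb B1 = 0 by rewrite /B1 lebesgue_measureD.
  have e2 : leb B2 = 0 by rewrite /B2 lebesgue_measure_subl.
  rewrite [X in (_ + X)%E](_ : _ = 0%E)// adde0.
  by apply: le_trans (measureU2 _ _ _) _ => //; rewrite [X in (X + _)%E](_ : _ = 0%E)// add0e [X in (X <= _)%E](_ : _ = 0%E).
apply/eqP; rewrite -measure_le0 -B0; apply: le_measure; rewrite ?inE.
- rewrite (_ : [set t | _] = [set t | `|t| <= 1] `&` (fun t => fold01 (z + t)) @^-1` A)//.
  apply: measurableI.
    rewrite (_ : [set t : R | _] = `[-1, 1]%classic); first exact: measurable_itv.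
    by apply/seteqP; split => t /=; rewrite in_itv/= ler_norml.
  rewrite -[X in measurable X]setTI.
  have h : measurable_fun setT (fun t : T_R => fold01 (z + t) : T_R).
    by apply: (measurableT_comp measurable_fold01); exact: measurable_funD.
  exact: h.
- by apply: measurableU => //; exact: measurableU.
move=> t [] /=; rewrite ler_norml => t1.
have [e|e|e] := fold01_cases (z + t) ltac:(lra); rewrite e => At.
- by left; left; rewrite /B1/= addrC.
- by left; right; rewrite /B2/= -opprD.
- by right; rewrite /B3/= (_ : 2 - z - t = 2 - (z + t)); [|ring].
Qed.

End folding.

(** * Kernels of the noise with and without reflection *)

Section noise_kernel.
Context {R : realType}.
Notation leb := (@lebesgue_measure R).
Notation T_R := (measurableTypeR R).
Variable xi : R.
Hypothesis xi_gt0 : 0 < xi.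
Variable tau : T_R -> T_R.
Hypothesis mtau : measurable_fun setT tau.
Implicit Types x y t : R.

(** Density, at the second coordinate, of the noisy image of the first one when no reflection takes
    place. *)
Definition nbump (tau : T_R -> T_R) (z : T_R * T_R) : R :=
  xi^-1 * \1_(`[- (xi / 2), xi / 2]) (z.2 - tau z.1).

Let xi_inv_ge0 : 0 <= xi^-1. Proof. by rewrite invr_ge0 ltW. Qed.

Lemma measurable_nbump : measurable_fun setT (nbump tau).
Proof.
apply: measurable_funM; first exact: measurable_cst.
apply: (@measurableT_comp _ _ _ _ _ _ (\1_(`[- (xi / 2), xi / 2]) : T_R -> T_R)
  _ (fun z : T_R * T_R => z.2 - tau z.1 : T_R)); first exact: measurable_indic.
apply: measurable_funB; first exact: measurable_snd.
exact: measurableT_comp.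
Qed.

Lemma nbump_le z : `|nbump tau z| <= xi^-1.
Proof.
rewrite /nbump normrM (ger0_norm xi_inv_ge0) ler_piMr//.
by rewrite indicE; case: (_ \in _); rewrite ?normr0 ?normr1.
Qed.

Lemma nbumpE (z : T_R * T_R) :
  nbump tau z = xi^-1 * \1_(`[tau z.1 - xi / 2, tau z.1 + xi / 2]) z.2.
Proof.
rewrite /nbump !indicE; congr (_ * (_)%:R); congr nat_of_bool.
by apply/idP/idP; rewrite !inE/= !in_itv/=; lra.
Qed.

Lemma integral_scaled_indic (B : set T_R) : measurable B ->
  (\int[leb]_y (xi^-1 * \1_B y)%:E = (xi^-1)%:E * leb B)%E.
Proof.
move=> mB; under eq_integral do rewrite EFinM.
rewrite ge0_integralZl//; last by apply/measurable_EFinP; exact: measurable_indic.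
by rewrite integral_indic// setIT.
Qed.

Lemma leb_window (c : R) : leb `[c - xi / 2, c + xi / 2] = xi%:E.
Proof.
rewrite lebesgue_measure_itv/= lte_fin ltrD2l ifT; last by rewrite gtrN// divr_gt0.
by rewrite -EFinB opprD opprK addrACA subrr add0r -splitr.
Qed.

Lemma leb_window0 : leb `[- (xi / 2), xi / 2] = xi%:E.
Proof. by have := leb_window 0; rewrite sub0r add0r. Qed.

Lemma nbump_mass x : (\int[leb]_y (`|nbump tau (x, y)|)%:E = 1)%E.
Proof.
under eq_integral => y _.
  rewrite nbumpE/= ger0_norm; last by rewrite mulr_ge0// indicE.
  over.
by rewrite integral_scaled_indic// leb_window -EFinM mulVf// gt_eqF.
Qed.

Lemma rho_unifE t : rho_unif xi t = xi^-1 * \1_(`[- (xi / 2), xi / 2]) t.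
Proof. by []. Qed.

Variable A : set T_R.
Hypothesis mA : measurable A.

(** The integrand of [reflconv] evaluated at A: first coordinate the starting point, second the
    noise. *)
Definition fold_kernel (z : T_R * T_R) : R :=
  rho_unif xi z.2 * \1_A (fold01 (tau z.1 + z.2)).

Let mfold (x : T_R) : measurable [set t : T_R | A (fold01 (tau x + t))].
Proof.
rewrite -[X in measurable X]setTI.
have h : measurable_fun setT (fun t : T_R => fold01 (tau x + t) : T_R).
  by apply: (measurableT_comp measurable_fold01); exact: measurable_funD.
exact: h.
Qed.

Lemma measurable_fold_kernel : measurable_fun setT fold_kernel.
Proof.
apply: measurable_funM.
  apply: measurable_funM; first exact: measurable_cst.
  apply: (@measurableT_comp _ _ _ _ _ _ (\1_(`[- (xi / 2), xi / 2]) : T_R -> T_R)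
    _ (fun z : T_R * T_R => z.2 : T_R)); last exact: measurable_snd.
  exact: measurable_indic.
apply: (@measurableT_comp _ _ _ _ _ _ (\1_A : T_R -> T_R)
  _ (fun z : T_R * T_R => fold01 (tau z.1 + z.2) : T_R)); first exact: measurable_indic.
apply: (measurableT_comp measurable_fold01).
apply: measurable_funD; last exact: measurable_snd.
exact: measurableT_comp.
Qed.

Lemma fold_kernelE x t : fold_kernel (x, t) =
  xi^-1 * \1_(`[- (xi / 2), xi / 2] `&` [set t | A (fold01 (tau x + t))]) t.
Proof.
rewrite /fold_kernel rho_unifE -mulrA; congr (_ * _).
by rewrite !indicE -natrM mulnb in_setI.
Qed.

Lemma fold_kernel_le z : `|fold_kernel z| <= xi^-1.
Proof.
case: z => x t; rewrite fold_kernelE normrM (ger0_norm xi_inv_ge0) ler_piMr//.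
by rewrite indicE; case: (_ \in _); rewrite ?normr0 ?normr1.
Qed.

Lemma fold_kernel_mass x : (\int[leb]_t (`|fold_kernel (x, t)|)%:E <= 1%:E)%E.
Proof.
under eq_integral => t _.
  rewrite fold_kernelE/= ger0_norm; last by rewrite mulr_ge0// indicE.
  over.
rewrite integral_scaled_indic//; last by apply: measurableI.
rewrite -(nbump_mass x).
under [leRHS]eq_integral => y _.
  rewrite nbumpE/= ger0_norm; last by rewrite mulr_ge0// indicE.
  over.
rewrite integral_scaled_indic//; apply: lee_wpmul2l; first by rewrite lee_fin.
apply: (@le_trans _ _ (leb `[- (xi / 2), xi / 2])).
  by apply: le_measure; rewrite ?inE//; apply: measurableI.
by rewrite leb_window0 leb_window.
Qed.

Definition fold_mass x : R := \int[leb]_t fold_kernel (x, t).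

Lemma fold_massE x : fold_mass x = xi^-1 *
  fine (leb (`[- (xi / 2), xi / 2] `&` [set t | A (fold01 (tau x + t))])).
Proof.
rewrite /fold_mass /Rintegral.
under eq_integral do rewrite fold_kernelE.
rewrite integral_scaled_indic//; last by apply: measurableI.
rewrite fineM// ge0_fin_numE//.
apply: (@le_lt_trans _ _ (leb `[- (xi / 2), xi / 2])).
  by apply: le_measure; rewrite ?inE//; apply: measurableI.
by rewrite leb_window0 ltry.
Qed.

Lemma fold_mass_null x : leb A = 0%E -> xi <= 2 -> 0 <= tau x <= 1 -> fold_mass x = 0.
Proof.
move=> A0 xi2 tx; rewrite fold_massE.
rewrite (_ : leb _ = 0%E) ?mulr0//.
apply/eqP; rewrite -measure_le0 -(fold01_null (tau x) A mA A0 tx).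
apply: le_measure; rewrite ?inE.
- exact: measurableI.
- rewrite (_ : [set t | _] = `[-1, 1]%classic `&` [set t | A (fold01 (tau x + t))]).
    exact: measurableI.
  apply/seteqP; split => t /=.
    by move=> [? ?]; split => //; rewrite in_itv/= -ler_norml.
  by move=> [+ ?]; rewrite in_itv/= -ler_norml => ?.
move=> t [] /=; rewrite in_itv/= => t1 At; split => //.
by rewrite ler_norml; lra.
Qed.

(** At distance xi / 2 from 0 and 1 the noisy point remains in [0, 1], where [fold01] is the
    identity, and only a translation is left. *)
Lemma fold_mass_nbump x : xi / 2 <= tau x <= 1 - xi / 2 ->
  fold_mass x = \int[leb]_y (\1_A y * nbump tau (x, y)).
Proof.
move=> tx; rewrite fold_massE /Rintegral.
under eq_integral => y _.
  rewrite nbumpE/= mulrCA (_ : \1_A y * _ = \1_(A `&` `[tau x - xi / 2, tau x + xi / 2]) y); last first.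
    by rewrite !indicE -natrM mulnb in_setI.
  over.
rewrite integral_scaled_indic; last by apply: measurableI.
have mB : measurable (A `&` `[tau x - xi / 2, tau x + xi / 2]) by exact: measurableI.
rewrite -(lebesgue_measureD (tau x) _ mB).
rewrite (_ : _ @^-1` _ = `[- (xi / 2), xi / 2] `&` [set t | A (fold01 (tau x + t))]); last first.
  apply/seteqP; split => t /=; rewrite !in_itv/=.
    move=> [At tI]; split; first by lra.
    by rewrite fold01_id addrC//; lra.
  move=> [tI]; rewrite fold01_id; last by lra.
  by rewrite addrC; split => //; lra.
rewrite fineM// ge0_fin_numE//.
apply: (@le_lt_trans _ _ (leb `[- (xi / 2), xi / 2])).
  by apply: le_measure; rewrite ?inE//; apply: measurableI.
by rewrite leb_window0 ltry.
Qed.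

End noise_kernel.

Lemma Rintegral_eq0 {d} {T : measurableType d} {R : realType}
    (m : {measure set T -> \bar R}) (f : T -> R) :
  (forall x, f x = 0) -> \int[m]_x f x = 0.
Proof. by move=> f0; rewrite /Rintegral integral0_eq// => x _; rewrite f0. Qed.

(** * Image of a measure under a map followed by noise *)

Section noise_density.
Context {R : realType}.
Notation leb := (@lebesgue_measure R).
Notation T_R := (measurableTypeR R).
Variables (xi : R) (xi_gt0 : 0 < xi).
Variable tau : T_R -> T_R.
Hypotheses (mtau : measurable_fun setT tau) (tau01 : forall x, I01 x -> 0 <= (tau x : R) <= 1).
Variables (m : {sigma_finite_measure set T_R -> \bar R}) (u : T_R -> R).
Hypothesis iu : m.-integrable setT (EFin \o u).
Hypothesis u0 : forall x, ~ I01 x -> u x = 0.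
Variable mu : set R -> \bar R.
Hypothesis muE : forall A : set T_R, measurable A ->
  mu A = (\int[m]_(x in A) (u x)%:E)%E.

Lemma noise_sectionE (A : set T_R) t : measurable A ->
  ((rho_unif xi t)%:E * ext0 (transfer tau mu) ((fun x => x + t)%R @^-1` (fold01 @^-1` A)))%E =
  (Kop m (fold_kernel xi tau A) u t)%:E.
Proof.
move=> mA; set B := (X in ext0 _ X).
have mB : measurable (I01 `&` tau @^-1` (B `&` I01) : set T_R).
  apply: measurableI; first exact: measurable_itv.
  rewrite -[X in measurable X]setTI; apply: mtau => //.
  apply: measurableI; last exact: measurable_itv.
  have h : measurable_fun setT (fun x : T_R => fold01 (x + t) : T_R).
    by apply: (measurableT_comp measurable_fold01); exact: measurable_funD.
  by rewrite /B -[X in measurable X]setTI; exact: h.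
rewrite /ext0 /transfer muE//.
have kE x : fold_kernel xi tau A (x, t) * u x =
    rho_unif xi t * (u x * \1_(I01 `&` tau @^-1` (B `&` I01)) x).
  rewrite /fold_kernel/= -mulrA; congr (_ * _); rewrite mulrC.
  have [Ix|/u0 ->] := pselect (I01 x); last by rewrite !mul0r.
  congr (_ * _); rewrite !indicE; congr (_%:R); congr nat_of_bool.
  apply/idP/idP; rewrite !inE/=; last by case=> _ [].
  move=> At; split => //; split => //; rewrite /I01/= in_itv/=; exact: tau01.
rewrite /Kop /Rintegral; under [in RHS]eq_integral do rewrite kE EFinM.
have i1 : m.-integrable setT (fun x => (u x * \1_(I01 `&` tau @^-1` (B `&` I01)) x)%:E).
  under eq_fun do rewrite mulrC.
  apply: (@integrable_bounded_mul _ _ _ m (\1_(I01 `&` tau @^-1` (B `&` I01))) u 1) => //.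
  by move=> x; rewrite indicE; case: (_ \in _); rewrite ?normr0 ?normr1.
rewrite integralZl// fineK; last first.
  by apply: fin_numM => //; exact: integrable_fin_num.
congr (_ * _)%E.
rewrite [LHS]integral_mkcond. apply: eq_integral => x _.
by rewrite patchE indicE/=; case: ifPn => _; rewrite ?mulr1 ?mulr0.
Qed.

(** Exchange of the integral over the noise with the one over the starting point: [Kop_dual] for the
    constant function 1. *)
Lemma LnoiseE (A : set T_R) : measurable A ->
  Lnoise xi tau mu A = (\int[m]_x (fold_mass xi tau A x * u x))%:E.
Proof.
move=> mA.
have mk : measurable_fun setT (fold_kernel xi tau A) by apply: measurable_fold_kernel.
have kM := fold_kernel_le xi xi_gt0 tau A.
have kC x : (\int[leb]_t (`|fold_kernel xi tau A (x, t)|)%:E <= 1%:E)%E.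
  by apply: fold_kernel_mass.
have h := @Kop_dual R _ T_R m (fold_kernel xi tau A) xi^-1 1 u mk kM kC iu (cst 1) 1
  (measurable_cst _) (fun _ => eq_ler _ _ (normr1 _)).
rewrite /fold_mass; under [in RHS]eq_Rintegral => x _.
  under eq_Rintegral => t _ do rewrite -[fold_kernel _ _ _ _]mul1r.
  over.
rewrite -h /Lnoise /reflconv /convolution.
under eq_integral => t _ do rewrite noise_sectionE//.
under [in RHS]eq_Rintegral do rewrite mul1r.
rewrite /Rintegral fineK//; apply: integrable_fin_num => //.
exact: (Kop_integrable m _ xi^-1 1 u).
Qed.

(** Stated with reflection allowed, so that it applies to the stationary measures for the whole
    range of delta. *)
Lemma Lnoise_null (A : set T_R) : xi <= 2 -> measurable A -> leb A = 0%E ->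
  Lnoise xi tau mu A = 0%E.
Proof.
move=> xi2 mA A0; rewrite LnoiseE//; congr EFin.
apply: Rintegral_eq0 => x; have [Ix|/u0 ->] := pselect (I01 x); last by rewrite mulr0.
by rewrite fold_mass_null ?mul0r//; exact: tau01.
Qed.

Hypothesis tau_in : forall x, I01 x -> xi / 2 <= (tau x : R) <= 1 - xi / 2.

Lemma Pop_out (y : T_R) : ~ I01 y -> Kop m (nbump xi tau) u y = 0.
Proof.
move=> Iy; apply: Rintegral_eq0 => x; have [Ix|/u0 ->] := pselect (I01 x); last by rewrite mulr0.
rewrite nbumpE/= indicE memNset ?mulr0 ?mul0r// => /=; rewrite in_itv/= => yI.
apply: Iy; rewrite /I01/= in_itv/=; have := tau_in x Ix; move: (tau x : R) yI => z; lra.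
Qed.

Lemma Lnoise_density : is_density (Lnoise xi tau mu) (Kop m (nbump xi tau) u).
Proof.
have mk : measurable_fun setT (nbump xi tau) by apply: measurable_nbump.
have kM := nbump_le xi xi_gt0 tau.
have kC x : (\int[leb]_y (`|nbump xi tau (x, y)|)%:E <= 1%:E)%E by rewrite nbump_mass.
have iK := Kop_integrable m _ xi^-1 1 u mk kM kC iu.
split; first by apply: integrableS iK => //; exact: measurable_itv.
move=> A mA; rewrite LnoiseE//.
have h := @Kop_dual R _ T_R m (nbump xi tau) xi^-1 1 u mk kM kC iu (\1_A) 1
  (measurable_indic mA) (fun y => _).
transitivity (\int[leb]_y (\1_A y * Kop m (nbump xi tau) u y))%:E.
  rewrite h; last by move=> y; rewrite indicE; case: (_ \in _); rewrite ?normr0 ?normr1.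
  congr EFin; apply: eq_Rintegral => x _.
  have [Ix|/u0 ->] := pselect (I01 x); last by rewrite !mulr0.
  by rewrite fold_mass_nbump//; exact: tau_in.
rewrite /Rintegral fineK; last first.
  apply: integrable_fin_num => //.
  apply: (@integrable_bounded_mul _ _ _ leb (\1_A) _ 1) => //.
  by move=> x; rewrite indicE; case: (_ \in _); rewrite ?normr0 ?normr1.
rewrite /meas integral_mkcond [RHS]integral_mkcond; apply: eq_integral => y _.
rewrite !patchE in_setT indicE in_setI.
have [Iy|Iy] := pselect (I01 y).
  by rewrite (mem_set Iy) andbT; case: ifPn => _; rewrite ?mul1r ?mul0r.
by rewrite Pop_out// mulr0; case: ifPn.
Qed.

End noise_density.

(** * Contraction of zero-average densities *)

Section integrable_line.
Context {R : realType}.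
Notation leb := (@lebesgue_measure R).
Notation T_R := (measurableTypeR R).
Implicit Types u v : T_R -> R.

Definition integ u : Prop := leb.-integrable setT (EFin \o u).

Lemma integ_measurable u : integ u -> measurable_fun setT u.
Proof. by move=> iu; apply/measurable_EFinP; exact: measurable_int iu. Qed.

Lemma integD u v : integ u -> integ v -> integ (fun x => u x + v x).
Proof. by move=> iu iv; apply: eq_integrable (integrableD measurableT iu iv). Qed.

Lemma integB u v : integ u -> integ v -> integ (fun x => u x - v x).
Proof. by move=> iu iv; apply: eq_integrable (integrableB measurableT iu iv). Qed.

Lemma integZ a u : integ u -> integ (fun x => a * u x).
Proof. by move=> iu; apply: eq_integrable (integrableZl measurableT a iu). Qed.

Lemma integ_norm u : integ u -> integ (fun x => `|u x|).
Proof. by move=> iu; apply: eq_integrable (integrable_norm iu). Qed.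

Lemma integ_le u v : measurable_fun setT u -> integ v ->
  (forall x, `|u x| <= v x) -> integ u.
Proof.
move=> mu iv uv; apply: (le_integrable measurableT _ _ iv).
  exact/measurable_EFinP.
by move=> x _ /=; rewrite lee_fin (le_trans (uv x))// ler_norm.
Qed.

Lemma integ_bounded_mul (f u : T_R -> R) (M : R) :
  measurable_fun setT f -> (forall x, `|f x| <= M) -> integ u ->
  integ (fun x => f x * u x).
Proof. exact: (integrable_bounded_mul leb). Qed.

Lemma RintD u v : integ u -> integ v ->
  \int[leb]_x (u x + v x) = \int[leb]_x u x + \int[leb]_x v x.
Proof. by move=> iu iv; rewrite RintegralD. Qed.

Lemma RintB u v : integ u -> integ v ->
  \int[leb]_x (u x - v x) = \int[leb]_x u x - \int[leb]_x v x.
Proof. by move=> iu iv; rewrite RintegralB. Qed.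

Lemma RintZ a u : integ u -> \int[leb]_x (a * u x) = a * \int[leb]_x u x.
Proof. by move=> iu; rewrite RintegralZl. Qed.

Lemma Rint_le u v : integ u -> integ v -> (forall x, u x <= v x) ->
  \int[leb]_x u x <= \int[leb]_x v x.
Proof. by move=> iu iv uv; apply: le_Rintegral => // x _; exact: uv. Qed.

Lemma Rint_norm_ge0 u : 0 <= \int[leb]_x `|u x|.
Proof. by apply: Rintegral_ge0 => x _. Qed.

Lemma leb_itv (a b : R) : a <= b -> leb `[a, b] = (b - a)%:E.
Proof.
move=> ab; rewrite lebesgue_measure_itv/= lte_fin.
have [//|ba] := ltP a b.
by rewrite (@le_anti _ _ a b) ?subrr// ab ba.
Qed.

Lemma leb_itv_lty (a b : R) : (leb `[a, b] < +oo)%E.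
Proof.
rewrite lebesgue_measure_itv/=; case: ifPn => // ab.
by rewrite -EFinB ltry.
Qed.

Lemma integ_indic (a b : R) : integ (\1_(`[a, b]) : T_R -> R).
Proof.
apply/integrableP; split; first by apply/measurable_EFinP; exact: measurable_indic.
under eq_integral => x _.
  rewrite /= ger0_norm; last by rewrite indicE.
  over.
by rewrite integral_indic// setIT; exact: leb_itv_lty.
Qed.

Lemma Rint_indic (a b : R) : a <= b -> \int[leb]_x (\1_(`[a, b]) x) = b - a.
Proof.
by move=> ab; rewrite /Rintegral integral_indic// setIT; exact: (congr1 fine (leb_itv _ _ ab)).
Qed.

End integrable_line.

(** * The noise operator on densities and its dual *)

Section noise_operator.
Context {R : realType}.
Notation leb := (@lebesgue_measure R).
Notation T_R := (measurableTypeR R).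
Variables (xi : R) (xi_gt0 : 0 < xi).
Implicit Types (u v : T_R -> R) (tau : T_R -> T_R).

Definition Pop tau u : T_R -> R := Kop leb (nbump xi tau) u.

Let nbump_massle tau x : (\int[leb]_y (`|nbump xi tau (x, y)|)%:E <= 1%:E)%E.
Proof. by rewrite nbump_mass. Qed.

Lemma nbump_ge0 tau z : 0 <= nbump xi tau z.
Proof. by rewrite /nbump; apply: mulr_ge0; [rewrite invr_ge0 ltW|rewrite indicE]. Qed.

Section fixed_tau.
Variable tau : T_R -> T_R.
Hypothesis mtau : measurable_fun setT tau.

Let mb : measurable_fun setT (nbump xi tau). Proof. exact: measurable_nbump. Qed.

Let kM : forall z, `|nbump xi tau z| <= xi^-1. Proof. exact: nbump_le. Qed.

Let kC := nbump_massle tau.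

Lemma Pop_integ u : integ u -> integ (Pop tau u).
Proof.
by move=> iu; exact: (Kop_integrable leb _ xi^-1 1 u mb kM kC iu).
Qed.

Lemma Pop_norm u : integ u -> \int[leb]_y `|Pop tau u y| <= \int[leb]_x `|u x|.
Proof.
by move=> iu; rewrite -[leRHS]mul1r; exact: (Kop_norm leb _ xi^-1 1 u mb kM kC iu).
Qed.

Lemma Pop_bound u y : integ u -> `|Pop tau u y| <= xi^-1 * \int[leb]_x `|u x|.
Proof. by move=> iu; exact: (Kop_bound leb _ xi^-1 u mb kM iu). Qed.

Lemma Pop_section u y : integ u -> integ (fun x => nbump xi tau (x, y) * u x).
Proof.
by move=> iu; exact: (Kop_section_integrable leb _ xi^-1 u mb kM iu).
Qed.

Lemma PopB u v y : integ u -> integ v ->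
  Pop tau (fun x => u x - v x) y = Pop tau u y - Pop tau v y.
Proof.
move=> iu iv; rewrite /Pop /Kop -RintB; [|exact: Pop_section..].
by under eq_Rintegral do rewrite mulrBr.
Qed.

Lemma PopD u v y : integ u -> integ v ->
  Pop tau (fun x => u x + v x) y = Pop tau u y + Pop tau v y.
Proof.
move=> iu iv; rewrite /Pop /Kop -RintD; [|exact: Pop_section..].
by under eq_Rintegral do rewrite mulrDr.
Qed.

Lemma PopZ a u y : integ u -> Pop tau (fun x => a * u x) y = a * Pop tau u y.
Proof.
move=> iu; rewrite /Pop /Kop -RintZ; last exact: Pop_section.
by under eq_Rintegral do rewrite mulrCA.
Qed.

Lemma Pop_ge0 u y : (forall x, 0 <= u x) -> 0 <= Pop tau u y.
Proof. by move=> u0; apply: Rintegral_ge0 => x _; apply: mulr_ge0 => //; exact: nbump_ge0. Qed.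

(** Expected value of phi after one noisy step from x. *)
Definition Uop (phi : T_R -> R) x := \int[leb]_y (phi y * nbump xi tau (x, y)).

Lemma Pop_dual u (phi : T_R -> R) (B : R) : integ u ->
  measurable_fun setT phi -> (forall y, `|phi y| <= B) ->
  \int[leb]_y (phi y * Pop tau u y) = \int[leb]_x (Uop phi x * u x).
Proof.
by move=> iu mphi phiB; exact: (Kop_dual leb _ xi^-1 1 u mb kM kC iu phi B mphi phiB).
Qed.

Lemma nbump_integ x : integ (fun y => nbump xi tau (x, y)).
Proof.
apply/integrableP; split; first by apply/measurable_EFinP; exact: measurableT_comp.
by rewrite /= nbump_mass// ltry.
Qed.

Lemma Rint_bump x : \int[leb]_y (nbump xi tau (x, y)) = 1.
Proof.
rewrite /Rintegral -[RHS]/(fine (1%:E)) -(nbump_mass _ xi_gt0 tau x); congr fine.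
by apply: eq_integral => y _; rewrite ger0_norm// nbump_ge0.
Qed.

Lemma Pop_mass u : integ u -> \int[leb]_y Pop tau u y = \int[leb]_x u x.
Proof.
move=> iu; have := @Pop_dual u (cst 1) 1 iu (measurable_cst _) (fun _ => eq_ler _ _ (normr1 _)).
under eq_Rintegral do rewrite mul1r.
move=> ->; apply: eq_Rintegral => x _; rewrite /Uop.
by under eq_Rintegral do rewrite mul1r; rewrite Rint_bump mul1r.
Qed.

Section dual_operator.
Variable phi : T_R -> R.
Hypotheses (mphi : measurable_fun setT phi) (phi01 : forall y, 0 <= phi y <= 1).

Lemma Uop_section x : integ (fun y => phi y * nbump xi tau (x, y)).
Proof.
apply: (@integ_bounded_mul _ _ _ 1) => //; last exact: nbump_integ.
by move=> y; have /andP[? ?] := phi01 y; rewrite ger0_norm.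
Qed.

Lemma Uop_ge0 x : 0 <= Uop phi x.
Proof.
by apply: Rintegral_ge0 => y _; have /andP[? _] := phi01 y; rewrite mulr_ge0// nbump_ge0.
Qed.

Lemma Uop_01 x : 0 <= Uop phi x <= 1.
Proof.
rewrite Uop_ge0/= -(Rint_bump x); apply: Rint_le; [exact: Uop_section|exact: nbump_integ|].
by move=> y; have /andP[? ?] := phi01 y; rewrite ler_piMl// nbump_ge0.
Qed.

Lemma measurable_Uop : measurable_fun setT (Uop phi).
Proof.
apply/measurable_EFinP.
have mf : measurable_fun setT (fun z : T_R * T_R => (phi z.2 * nbump xi tau z)%:E).
  by apply/measurable_EFinP; apply: measurable_funM => //; exact: measurableT_comp.
have := measurable_fun_fubini_tonelli_F (m2 := leb) _ mf.
move=> /(_ _)-h; apply: eq_measurable_fun (h _) => [x _|z]; last first.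
  by have /andP[? _] := phi01 z.2; rewrite lee_fin mulr_ge0// nbump_ge0.
rewrite /fubini_F /Uop /Rintegral/= fineK//.
exact: integrable_fin_num (Uop_section x).
Qed.

End dual_operator.

Lemma Uop_le (phi psi : T_R -> R) x :
  measurable_fun setT phi -> (forall y, 0 <= phi y <= 1) ->
  measurable_fun setT psi -> (forall y, 0 <= psi y <= 1) ->
  (forall y, phi y <= psi y) -> Uop phi x <= Uop psi x.
Proof.
move=> mphi phi01 mpsi psi01 le; apply: Rint_le; [exact: Uop_section|exact: Uop_section|].
by move=> y; rewrite ler_wpM2r// nbump_ge0.
Qed.

Lemma UopZ (phi : T_R -> R) c x :
  measurable_fun setT phi -> (forall y, 0 <= phi y <= 1) ->
  Uop (fun y => c * phi y) x = c * Uop phi x.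
Proof.
move=> mphi phi01; rewrite /Uop -RintZ; last exact: Uop_section.
by under eq_Rintegral do rewrite -mulrA.
Qed.

(** Only the part [a, b] of the noise window is kept; there the kernel equals [xi^-1]. *)
Lemma Uop_lbound (phi : T_R -> R) c a b x :
  measurable_fun setT phi -> (forall y, 0 <= phi y <= 1) -> 0 <= c -> a <= b ->
  tau x - xi / 2 <= a -> b <= tau x + xi / 2 ->
  (forall y, a <= y <= b -> c <= phi y) -> c * (xi^-1 * (b - a)) <= Uop phi x.
Proof.
move=> mphi phi01 c0 ab ta tb cphi.
rewrite -Rint_indic// mulrA -RintZ; last exact: integ_indic.
apply: Rint_le; [by apply: integZ; exact: integ_indic|exact: Uop_section|move=> y].
have [yab|yab] := boolP (a <= y <= b); last first.
  rewrite [X in X <= _](_ : _ = 0); last first.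
    by rewrite indicE memNset ?mulr0//= in_itv/=; exact/negP.
  by rewrite mulr_ge0 ?nbump_ge0//; have /andP[] := phi01 y.
rewrite nbumpE/= !indicE !mem_set/=.
- by rewrite !mulr1 ler_wpM2r ?invr_ge0 ?(ltW xi_gt0) ?cphi.
- by rewrite in_itv/=; move: yab ta tb => /andP[]; move: (tau x : R) => t; lra.
- by rewrite in_itv/=.
Qed.

End fixed_tau.

(** * Doeblin's condition around the fixed point *)

Section doeblin.
Variable tau : T_R -> T_R.
Hypotheses (mtau : measurable_fun setT tau) (ctau : continuous (tau : R -> R)).
Hypothesis tau_in : forall x, I01 x -> xi / 2 <= (tau x : R) <= 1 - xi / 2.
Variable p : R.
Hypotheses (p01 : 0 <= p <= 1) (taup : tau p = p :> R).
Hypothesis reach : forall P : R -> Prop, P p ->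
  (forall x y : R, 0 <= x <= 1 -> 0 <= y <= 1 -> `|tau x - y : R| <= xi / 2 -> P y -> P x) ->
  forall x, 0 <= x <= 1 -> P x.
Variable eta : R.
Hypotheses (eta_gt0 : 0 < eta) (eta_le : eta <= xi / 4).
Hypothesis tau_eta : forall x : R, `|x - p| <= eta -> `|tau x - p : R| <= xi / 4.

(** Probability that the noisy orbit of x is within eta of p at time n. *)
Definition hit n : T_R -> R := iter n (Uop tau) (\1_(`[p - eta, p + eta])).

Let hit_spec n : measurable_fun setT (hit n) /\ forall y, 0 <= hit n y <= 1.
Proof.
elim: n => [|n [mh h01]].
  split; first exact: measurable_indic.
  by move=> y; rewrite /hit/= indicE; case: (_ \in _); rewrite ?lexx ?ler01.
by split; [exact: measurable_Uop|move=> y; exact: Uop_01].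
Qed.

Lemma measurable_hit n : measurable_fun setT (hit n).
Proof. by case: (hit_spec n). Qed.

Lemma hit_01 n y : 0 <= hit n y <= 1.
Proof. by case: (hit_spec n). Qed.

(** Lower bound for the probability of still being within eta of p one step later. *)
Let c := xi^-1 * (eta + eta).

Let c_gt0 : 0 < c. Proof. by rewrite mulr_gt0 ?invr_gt0 ?addr_gt0. Qed.

Lemma hit1_ge (x : R) : `|x - p| <= eta -> c <= hit 1 x.
Proof.
move=> /tau_eta; rewrite ler_norml => tx.
rewrite (_ : c = 1 * (xi^-1 * ((p + eta) - (p - eta)))); last by rewrite /c; ring.
have := eta_gt0; have := eta_le => h1 h2.
apply: (Uop_lbound _ _ (hit 0) _ _ _ _ (measurable_hit 0) (hit_01 0)) => //; first by lra.
- by move: tx; move: (tau x : R) => t; lra.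
- by move: tx; move: (tau x : R) => t; lra.
by move=> y yB; rewrite /hit/= indicE mem_set//= in_itv.
Qed.

(** One more step near p costs at most a factor c; the case n = 0 propagates by monotonicity of the
    dual operator. This allows different hitting times to be synchronised. *)
Lemma hitS_ge n x : c * hit n x <= hit n.+1 x.
Proof.
elim: n x => [|n IH] x.
  rewrite {1}/hit/= indicE; have [|_] := boolP (x \in _); last first.
    by rewrite mulr0; have /andP[] := hit_01 1 x.
  rewrite inE/= in_itv/= mulr1 => xB; apply: hit1_ge.
  by rewrite ler_norml; lra.
have c1 : c <= 1.
  by rewrite /c ler_pdivrMl// mulr1; move: eta_le xi_gt0; lra.
rewrite -[leLHS](UopZ tau mtau (hit n) _ _ (measurable_hit n) (hit_01 n)).
have h01 y : 0 <= c * hit n y <= 1.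
  have /andP[? ?] := hit_01 n y.
  by rewrite mulr_ge0 ?(ltW c_gt0)//= mulr_ile1// ltW.
have mch : measurable_fun setT (fun y => c * hit n y).
  by apply: measurable_funM => //; exact: measurable_hit.
exact: (@Uop_le tau mtau _ (hit n.+1) x mch h01 (measurable_hit n.+1) (hit_01 n.+1) IH).
Qed.

Lemma hitD_ge n k x : c ^+ k * hit n x <= hit (n + k) x.
Proof.
elim: k => [|k IH]; first by rewrite expr0 mul1r addn0.
rewrite addnS exprS -mulrA; apply: le_trans (hitS_ge _ _).
by rewrite ler_wpM2l// ltW.
Qed.

(** The reachability principle is applied to hitting with probability bounded below on a
    neighbourhood. In the backward step tau x' is within xi / 2 + r / 4 of y, so its noise window
    contains an interval of length r / 4 inside the r-ball of y; r <= xi keeps this interval within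
    the window. *)
Lemma hit_pos (x : R) : 0 <= x <= 1 ->
  exists n a r, [/\ 0 < a, 0 < r & forall x', `|x' - x| <= r -> a <= hit n x'].
Proof.
suff h : forall x : R, 0 <= x <= 1 -> exists n a r,
    [/\ 0 < a, 0 < r, r <= xi & forall x', `|x' - x| <= r -> a <= hit n x'].
  by move=> /h [n [a [r [? ? _ ?]]]]; exists n, a, r.
apply: reach.
  exists 1%N, c, eta; split => //; first by have := eta_le; have := xi_gt0; lra.
  exact: hit1_ge.
move=> {}x y x01 y01 txy [n [a [r [a0 r0 rxi hr]]]].
have r40 : 0 < r / 4 by rewrite divr_gt0.
have [d /= d0 hd] : exists2 d : R, 0 < d & forall x', `|x - x'| < d -> `|tau x - tau x' : R| < r / 4.
  have /cvgrPdist_lt /(_ _ r40) := ctau x.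
  by move=> /nbhs_ballP[d /= d0 hd]; exists d => // x' xx'; exact: hd.
have d1 : 0 < Num.min (d / 2) xi by rewrite lt_min divr_gt0// xi_gt0.
exists n.+1, (a * (xi^-1 * (r / 4))), (Num.min (d / 2) xi); split => //.
- by rewrite !mulr_gt0// ?invr_gt0// divr_gt0.
- by rewrite ge_min lexx orbT.
move=> x'; rewrite le_min => /andP[xx' _].
have tx' : `|tau x - tau x' : R| < r / 4.
  by apply: hd; rewrite distrC (le_lt_trans xx')//; lra.
have tyx' : `|tau x' - y : R| <= xi / 2 + r / 4.
  move: txy tx'; rewrite ltr_norml !ler_norml; move: (tau x : R) (tau x' : R) => t t'; lra.
have [yt|ty] := leP y (tau x').
  rewrite (_ : r / 4 = (y + r / 2) - (y + r / 4)); last by lra.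
  apply: (Uop_lbound _ _ (hit n) _ _ _ _ (measurable_hit n) (hit_01 n) (ltW a0)) => //; first by lra.
  - move: tyx'; rewrite ler_norml; move: (tau x' : R) => t'; lra.
  - move: yt; move: (tau x' : R) => t'; lra.
  - by move=> z z1; apply: hr; rewrite ler_norml; lra.
rewrite (_ : r / 4 = (y - r / 4) - (y - r / 2)); last by lra.
apply: (Uop_lbound _ _ (hit n) _ _ _ _ (measurable_hit n) (hit_01 n) (ltW a0)) => //; first by lra.
- move: ty; move: (tau x' : R) => t'; lra.
- move: tyx'; rewrite ler_norml; move: (tau x' : R) => t'; lra.
- by move=> z z1; apply: hr; rewrite ler_norml; lra.
Qed.

Lemma hit_uniform : exists N eps, 0 < eps /\ forall x : R, 0 <= x <= 1 -> eps <= hit N x.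
Proof.
have /compact_near_coveringP cpt := @segment_compact R 0 1.
(* The threshold depends on n only. From a local bound a at time n0, [hitD_ge] gives a c^(n - n0),
   which exceeds c^n / (n + 1) for large n, so compactness yields one time for all x. *)
have : \forall n \near \oo, `[0, 1]%classic `<=`
    (fun x : R => c ^+ n * (n.+1%:R)^-1 <= hit n x).
  apply: cpt => x /=; rewrite in_itv/= => /hit_pos[n [a [r [a0 r0 hr]]]].
  exists ([set x' | `|x' - x| <= r], [set k | (n + Num.truncn (c ^+ n / a) <= k)%N]).
    split => /=.
      by apply/nbhs_ballP; exists r => // x'; rewrite /ball/= distrC => /ltW.
    by exists (n + Num.truncn (c ^+ n / a))%N.
  move=> [x' k] [/= /hr ax' nk].
  have nk' : (n <= k)%N by rewrite (leq_trans _ nk)// leq_addr.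
  have := hitD_ge n (k - n) x'; rewrite subnKC//; apply: le_trans.
  rewrite -{1}(subnK nk') exprD -mulrA ler_wpM2l ?exprn_ge0 ?(ltW c_gt0)//.
    apply: (le_trans _ ax'); rewrite ler_pdivrMr// mulrC -ler_pdivrMr//.
  apply: le_trans (ltW (Num.Theory.truncnS_gt _)) _.
  by rewrite ler_nat ltnS (leq_trans _ nk)// leq_addl.
move=> [N _ /(_ N (leqnn N)) h]; exists N, (c ^+ N * (N.+1%:R)^-1); split.
  by rewrite mulr_gt0 ?exprn_gt0 ?invr_gt0.
by move=> x x01; apply: h; rewrite /= in_itv.
Qed.

Lemma iter_Pop_integ n u : integ u -> integ (iter n (Pop tau) u).
Proof. by move=> iu; elim: n => //= n IH; exact: Pop_integ. Qed.

Lemma iter_Pop_ge0 n u : (forall x, 0 <= u x) -> forall x, 0 <= iter n (Pop tau) u x.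
Proof. by move=> u0; elim: n => //= n IH x; exact: Pop_ge0. Qed.

Lemma iter_Pop_mass n u : integ u -> \int[leb]_x iter n (Pop tau) u x = \int[leb]_x u x.
Proof.
by move=> iu; elim: n => //= n <-; apply: Pop_mass => //; exact: iter_Pop_integ.
Qed.

Lemma iter_PopB n u v : integ u -> integ v ->
  iter n (Pop tau) (fun x => u x - v x) =
  (fun x => iter n (Pop tau) u x - iter n (Pop tau) v x).
Proof.
move=> iu iv; elim: n => //= n ->; apply/funext => x.
by apply: PopB => //; exact: iter_Pop_integ.
Qed.

Lemma iter_Pop_hit n u : integ u ->
  \int[leb]_x (\1_(`[p - eta, p + eta]) x * iter n (Pop tau) u x) =
  \int[leb]_x (hit n x * u x).
Proof.
elim: n u => [|n IH] u iu //.
rewrite iterSr IH; last exact: Pop_integ.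
apply: (Pop_dual tau mtau u (hit n) 1 iu (measurable_hit n)) => y.
by have /andP[? ?] := hit_01 n y; rewrite ger0_norm.
Qed.

(** After N steps at least eps times the mass is within eta of p. From there the kernel of one step
    equals [xi^-1] on the whole eta-ball, because the image is within xi / 4 of p and eta is at most
    xi / 4. *)
Lemma hit_lbound N eps u (y : R) : (forall x : R, 0 <= x <= 1 -> eps <= hit N x) ->
  integ u -> (forall x, 0 <= u x) -> (forall x, ~ I01 x -> u x = 0) ->
  `|y - p| <= eta -> xi^-1 * (eps * \int[leb]_x u x) <= iter N.+1 (Pop tau) u y.
Proof.
move=> heps iu u0 uI yp; set w := iter N (Pop tau) u.
have iw : integ w by exact: iter_Pop_integ.
have w0 : forall x, 0 <= w x by exact: iter_Pop_ge0.
have i1w : integ (fun x => \1_(`[p - eta, p + eta]) x * w x).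
  apply: (@integ_bounded_mul _ _ _ 1) => //.
  by move=> x; rewrite indicE; case: (_ \in _); rewrite ?normr0 ?normr1.
have ihu : integ (fun x => hit N x * u x).
  apply: (@integ_bounded_mul _ _ _ 1 (measurable_hit N)) => //.
  by move=> x; have /andP[? ?] := hit_01 N x; rewrite ger0_norm.
apply: (@le_trans _ _ (xi^-1 * \int[leb]_x (\1_(`[p - eta, p + eta]) x * w x))).
  rewrite ler_wpM2l ?invr_ge0 ?(ltW xi_gt0)// iter_Pop_hit// -RintZ//.
  apply: Rint_le => //; first exact: integZ.
  move=> x; have [Ix|/uI ->] := pselect (I01 x); last by rewrite !mulr0.
  by rewrite ler_wpM2r//; apply: heps; move: Ix; rewrite /I01/= in_itv.
rewrite -RintZ//; apply: Rint_le; [exact: integZ|exact: Pop_section|move=> x].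
rewrite mulrA ler_wpM2r//; have [xB|xB] := boolP (`|x - p| <= eta); last first.
  rewrite indicE memNset ?mulr0 ?nbump_ge0//= in_itv/=.
  by move: xB; rewrite ler_norml => /negP xB h; apply: xB; lra.
rewrite /nbump/= !indicE !mem_set//=; last first.
- by move: xB; rewrite in_itv/= ler_norml; lra.
have := tau_eta x xB; have := eta_le; have := xi_gt0; move: yp.
by rewrite in_itv/= !ler_norml; move: (tau x : R) => t; lra.
Qed.

(** Positive and negative parts of a zero-average density have equal mass, and both images are at
    least a near p. There the absolute value of their difference is smaller than their sum by 2 a,
    which integrates to the fraction q of the norm. *)
Lemma Pop_contraction : exists N theta, theta < 1 /\
  forall u, integ u -> (forall x, ~ I01 x -> u x = 0) -> \int[leb]_x u x = 0 ->
    \int[leb]_x `|iter N (Pop tau) u x| <= theta * \int[leb]_x `|u x|.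
Proof.
have [N [eps [eps0 heps]]] := hit_uniform.
pose q := xi^-1 * eps * (eta + eta).
have q0 : 0 < q by rewrite !mulr_gt0 ?invr_gt0 ?addr_gt0.
exists N.+1, (1 - q); split; first by lra.
move=> u iu uI u0; have mu := integ_measurable _ iu.
pose v1 x := Num.max (u x) 0; pose v2 x := Num.max (- u x) 0.
have v1_0 x : 0 <= v1 x by rewrite /v1 le_max lexx orbT.
have v2_0 x : 0 <= v2 x by rewrite /v2 le_max lexx orbT.
have uE x : u x = v1 x - v2 x.
  by rewrite /v1 /v2; have [h|h] := leP (u x) 0; have [h'|h'] := leP (- u x) 0; lra.
have nuE x : `|u x| = v1 x + v2 x.
  rewrite /v1 /v2; have [h|h] := leP (u x) 0; have [h'|h'] := leP (- u x) 0.
  - by rewrite ler0_norm//; lra.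
  - by rewrite ler0_norm//; lra.
  - by rewrite ger0_norm; lra.
  - by rewrite ger0_norm; lra.
have iv1 : integ v1.
  apply: integ_le (integ_norm _ iu) _; first exact: measurable_maxr.
  by move=> x; rewrite ger0_norm// nuE lerDl.
have iv2 : integ v2.
  apply: integ_le (integ_norm _ iu) _.
    by apply: measurable_maxr => //; exact: measurable_funN.
  by move=> x; rewrite ger0_norm// nuE lerDr.
have v1I x : ~ I01 x -> v1 x = 0 by move=> /uI h; rewrite /v1 h maxxx.
have v2I x : ~ I01 x -> v2 x = 0 by move=> /uI h; rewrite /v2 h oppr0 maxxx.
have eI : \int[leb]_x v1 x = \int[leb]_x v2 x.
  apply/eqP; rewrite -subr_eq0 -RintB// -[eqbRHS]u0; apply/eqP.
  by apply: eq_Rintegral => x _; rewrite uE.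
have nI : \int[leb]_x `|u x| = \int[leb]_x v1 x + \int[leb]_x v1 x.
  by rewrite {2}eI -RintD//; apply: eq_Rintegral => x _; rewrite nuE.
set I := \int[leb]_x v1 x in nI eI.
pose a := xi^-1 * (eps * I).
pose B : T_R -> R := \1_(`[p - eta, p + eta]).
pose g x := iter N.+1 (Pop tau) v1 x + iter N.+1 (Pop tau) v2 x - (a + a) * B x.
have ig : integ g.
  apply: integB; last by apply: integZ; exact: integ_indic.
  by apply: integD; exact: iter_Pop_integ.
have -> : (1 - q) * \int[leb]_x `|u x| = \int[leb]_x g x.
  rewrite RintB//; last 2 first.
  - by apply: integD; exact: iter_Pop_integ.
  - by apply: integZ; exact: integ_indic.
  rewrite RintD ?RintZ ?Rint_indic//; last 4 first.
  - by move: eta_gt0; lra.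
  - exact: integ_indic.
  - exact: iter_Pop_integ.
  - exact: iter_Pop_integ.
  rewrite !iter_Pop_mass// nI -eI -/I /a /q; ring.
apply: Rint_le => //; first exact/integ_norm/iter_Pop_integ.
move=> y; rewrite (_ : u = fun x => v1 x - v2 x); last exact/funext.
rewrite iter_PopB// /g /B.
set w1 := iter N.+1 _ v1 y; set w2 := iter N.+1 _ v2 y.
have w1_0 : 0 <= w1 by exact: iter_Pop_ge0.
have w2_0 : 0 <= w2 by exact: iter_Pop_ge0.
have [yB|yB] := boolP (`|y - p| <= eta); last first.
  rewrite indicE memNset ?mulr0 ?subr0/=; last first.
    by rewrite in_itv/=; move: yB; rewrite ler_norml => /negP yB h; apply: yB; lra.
  by rewrite ler_norml; lra.
have a1 : a <= w1 by exact: hit_lbound.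
have a2 : a <= w2 by rewrite /a eI; exact: hit_lbound.
rewrite indicE mem_set/=; last by rewrite in_itv/=; move: yB; rewrite ler_norml; lra.
by rewrite mulr1 ler_norml; lra.
Qed.

End doeblin.
End noise_operator.

(** * The Neumann series for functions on the line *)

Section neumann_line.
Context {R : realType}.
Notation leb := (@lebesgue_measure R).
Notation T_R := (measurableTypeR R).
Variables (xi : R) (xi_gt0 : 0 < xi).
Variable tau : T_R -> T_R.
Hypothesis mtau : measurable_fun setT tau.
Hypothesis tau_in : forall x, I01 x -> xi / 2 <= (tau x : R) <= 1 - xi / 2.
Variables (N : nat) (theta : R).
Hypothesis theta_lt1 : theta < 1.
Hypothesis contr : forall u : T_R -> R, integ u -> (forall x, ~ I01 x -> u x = 0) ->
  \int[leb]_x u x = 0 ->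
  \int[leb]_x `|iter N (Pop xi tau) u x| <= theta * \int[leb]_x `|u x|.
Implicit Types u v w h : T_R -> R.

Local Notation P := (Pop xi tau).

Let iter_integ n u : integ u -> integ (iter n P u).
Proof. exact: iter_Pop_integ. Qed.

Let iter_mass n u : integ u -> \int[leb]_x iter n P u x = \int[leb]_x u x.
Proof. exact: iter_Pop_mass. Qed.

Lemma iter_Pop_out n u : (forall x, ~ I01 x -> u x = 0) ->
  forall x, ~ I01 x -> iter n P u x = 0.
Proof.
by move=> uI; elim: n => //= n IH x Ix; apply: Pop_out.
Qed.

Lemma integ_sum n (F : nat -> T_R -> R) : (forall k, integ (F k)) ->
  integ (fun x => \sum_(k < n) F k x).
Proof.
move=> iF; elim: n => [|n IH].
  under eq_fun do rewrite big_ord0.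
  by apply: eq_integrable (integrable0 _ _) => //.
by under eq_fun do rewrite big_ord_recr/=; exact: integD.
Qed.

Lemma Rint_norm_sum n (F : nat -> T_R -> R) : (forall k, integ (F k)) ->
  \int[leb]_x `|\sum_(k < n) F k x| <= \sum_(k < n) \int[leb]_x `|F k x|.
Proof.
move=> iF; elim: n => [|n IH].
  rewrite big_ord0 Rintegral_eq0// => x; by rewrite big_ord0 normr0.
rewrite big_ord_recr/=; apply: le_trans (lerD IH (lexx _)).
rewrite -RintD; [|apply: integ_norm; exact: integ_sum|exact: integ_norm].
apply: Rint_le.
- apply: integ_norm; exact: integ_sum.
- by apply: integD; apply: integ_norm => //; exact: integ_sum.
by move=> x; rewrite big_ord_recr/=; exact: ler_normD.
Qed.

Lemma iter_Pop_norm n u : integ u ->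
  \int[leb]_x `|iter n P u x| <= \int[leb]_x `|u x|.
Proof.
move=> iu; elim: n => //= n IH; apply: le_trans IH.
by apply: Pop_norm => //; exact: iter_integ.
Qed.

(** Telescoping w = P^N w + sum over k < N of P^k (w - P w): the first term is absorbed by the
    contraction, each of the others is bounded by the norm of w - P w. All comparisons of stationary
    densities go through this bound. *)
Lemma resolvent_bound w : integ w -> (forall x, ~ I01 x -> w x = 0) ->
  \int[leb]_x w x = 0 ->
  \int[leb]_x `|w x| <= N%:R / (1 - theta) * \int[leb]_x `|w x - P w x|.
Proof.
move=> iw wI w0; pose e x := w x - P w x.
have iP : integ (P w) by exact: Pop_integ.
have ie : integ e by exact: integB.
have wE n x : w x = iter n P w x + \sum_(k < n) iter k P e x.
  elim: n => [|n IH]; first by rewrite big_ord0 addr0.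
  rewrite big_ord_recr/= {1}IH /e iter_PopB// -iterSr/=; ring.
have h1 : \int[leb]_x `|w x| <= theta * \int[leb]_x `|w x| + N%:R * \int[leb]_x `|e x|.
  apply: le_trans (lerD (contr w iw wI w0) (lexx _)).
  apply: (@le_trans _ _ (\int[leb]_x `|iter N P w x| + \int[leb]_x `|\sum_(k < N) iter k P e x|)).
    rewrite -RintD; last 2 first.
    - by apply: integ_norm; exact: iter_integ.
    - apply: integ_norm; apply: (integ_sum N (fun k => iter k P e)) => k; exact: iter_integ.
    apply: Rint_le; first exact: integ_norm.
      apply: integD; apply: integ_norm; first exact: iter_integ.
      by apply: (integ_sum N (fun k => iter k P e)) => k; exact: iter_integ.
    by move=> x; rewrite {1}(wE N x) ler_normD.
  rewrite lerD2l; apply: (le_trans (Rint_norm_sum N (fun k => iter k P e) _)).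
    by move=> k; exact: iter_integ.
  apply: (@le_trans _ _ (\sum_(k < N) \int[leb]_x `|e x|)).
    by apply: ler_sum => k _; exact: iter_Pop_norm.
  by rewrite sumr_const card_ord mulr_natl.
have t1 : 0 < 1 - theta by rewrite subr_gt0.
rewrite mulrAC ler_pdivlMr// mulrBr mulr1 [_ * theta]mulrC; lra.
Qed.

Section series.
Variable h : T_R -> R.
Hypotheses (ih : integ h) (hI : forall x, ~ I01 x -> h x = 0) (h0 : \int[leb]_x h x = 0).

Let v n := iter n P h.
Let s n := \int[leb]_x `|v n x|.
Let iv n : integ (v n). Proof. exact: iter_integ. Qed.
Let vI n x : ~ I01 x -> v n x = 0. Proof. exact: iter_Pop_out. Qed.
Let s_ge0 n : 0 <= s n. Proof. exact: Rint_norm_ge0. Qed.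

(** Shifting the index by N contracts, so a partial sum is at most N s 0 plus theta times itself. *)
Let s_bound n : \sum_(k < n) s k <= N%:R * s 0 / (1 - theta).
Proof.
have t1 : 0 < 1 - theta by rewrite subr_gt0.
rewrite ler_pdivlMr// mulrBr mulr1.
have h1 : \sum_(k < n) s k <= \sum_(k < N + n) s k.
  by rewrite addnC big_split_ord/= lerDl; apply: sumr_ge0.
have h2 : \sum_(k < N + n) s k <= N%:R * s 0 + theta * \sum_(k < n) s k.
  rewrite big_split_ord/=; apply: lerD.
    apply: (@le_trans _ _ (\sum_(k < N) s 0)).
      by apply: ler_sum => k _; exact: iter_Pop_norm.
    by rewrite sumr_const card_ord mulr_natl.
  rewrite mulr_sumr; apply: ler_sum => k _.
  rewrite /s /v iterD; apply: contr; [exact: iter_integ|exact: iter_Pop_out|].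
  by rewrite iter_mass.
rewrite [_ * theta]mulrC; lra.
Qed.

Let cvg_s : cvgn (series s).
Proof.
apply: nondecreasing_is_cvgn.
  by apply: nondecreasing_series => n _ _.
exists (N%:R * s 0 / (1 - theta)) => _ [n _ <-].
by rewrite /series/= big_mkord.
Qed.

Let sum_s := limn (series s).

Let ser_le n : series s n <= sum_s.
Proof.
by apply: nondecreasing_cvgn_le => //; apply: nondecreasing_series => k _ _.
Qed.

Let vS_le n y : `|v n.+1 y| <= xi^-1 * s n.
Proof. exact: Pop_bound. Qed.

Let vseries y : nat -> R := series (fun n => v n.+1 y).

Let cvg_v y : cvgn (vseries y).
Proof.
apply: normed_cvg; apply: (@series_le_cvg _ _ (fun n => xi^-1 * s n)).
- by move=> n /=.
- by move=> n; rewrite mulr_ge0// invr_ge0 ltW.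
- by move=> n; exact: vS_le.
by rewrite (_ : [series _]_n = xi^-1 *: series s :> (R^nat)); [exact: is_cvgZr|
  apply/funext => n; rewrite /series/= fctE/= scaler_sumr].
Qed.

(** Pointwise sum of the series. From the second term on, [Pop_bound] controls v n.+1 uniformly by
    xi^-1 times the norm of v n, so the tail converges uniformly. *)
Let r y := h y + limn (vseries y).

Let r_sub n y : `|r y - \sum_(k < n.+1) v k y| <= xi^-1 * (sum_s - series s n).
Proof.
rewrite big_ord_recl /r /= opprD addrACA subrr add0r.
rewrite (_ : \sum_(_ < n) _ = vseries y n); last by rewrite /vseries /series/= big_mkord.
have : (fun m => `|vseries y m - vseries y n|) @ \oo --> `|limn (vseries y) - vseries y n|.
  by apply: cvg_norm; apply: cvgB; [exact: cvg_v|exact: cvg_cst].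
move=> /cvgr_to_le; apply; exists n => // m nm /=.
have -> : vseries y m - vseries y n = \sum_(n <= k < m) v k.+1 y.
  by rewrite /vseries sub_series_geq.
apply: (le_trans (ler_norm_sum _ _ _)).
apply: (@le_trans _ _ (\sum_(n <= k < m) xi^-1 * s k)).
  by apply: ler_sum => k _; exact: vS_le.
rewrite -mulr_sumr ler_wpM2l ?invr_ge0 ?(ltW xi_gt0)// -sub_series_geq//.
by rewrite lerD2r.
Qed.

Let mv n : measurable_fun setT (v n). Proof. exact: integ_measurable. Qed.

Let mlim : measurable_fun setT (fun y : T_R => limn (vseries y) : T_R).
Proof.
have mser n : measurable_fun setT (fun y : T_R => vseries y n : T_R).
  rewrite /vseries/series/=; elim: n => [|n IH].
    by under eq_fun do rewrite big_nil; exact: measurable_cst.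
  under eq_fun do rewrite big_nat_recr//=.
  by apply: measurable_funD => //; exact: (mv n.+1).
apply: (measurable_fun_cvg mser) => y _; exact: cvg_v.
Qed.

Let rI x : ~ I01 x -> r x = 0.
Proof.
move=> Ix; rewrite /r hI// add0r (_ : vseries x = cst 0) ?lim_cst//.
apply/funext => n; rewrite /vseries/series/= big1// => k _; exact: (vI k.+1).
Qed.

Let ir : integ r.
Proof.
apply: integD => //.
have iI : integ (fun y => xi^-1 * sum_s * \1_(`[0, 1]) y).
  by apply: integZ; exact: integ_indic.
apply: integ_le iI _ => // y.
have [Iy|Iy] := pselect (I01 y); last first.
  have := rI y Iy; rewrite /r hI// add0r => ->.
  by rewrite normr0 indicE memNset ?mulr0//.
rewrite indicE mem_set// mulr1.
have := r_sub 0 y; rewrite big_ord_recl big_ord0 addr0 /r [X in `|X|]addrAC subrr add0r.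
by rewrite /series/= big_geq// subr0.
Qed.

Let Rint_sub n : \int[leb]_y `|r y - \sum_(k < n.+1) v k y| <= xi^-1 * (sum_s - series s n).
Proof.
have -> : xi^-1 * (sum_s - series s n) =
    \int[leb]_y (xi^-1 * (sum_s - series s n) * \1_(`[0, 1]) y).
  by rewrite RintZ ?Rint_indic ?subr0 ?mulr1//; exact: integ_indic.
apply: Rint_le.
- by apply: integ_norm; apply: integB => //; exact: integ_sum.
- by apply: integZ; exact: integ_indic.
move=> y; have [Iy|Iy] := pselect (I01 y).
  by rewrite indicE mem_set// mulr1; exact: r_sub.
rewrite rI// big1 ?subr0 ?normr0; last by move=> k _; exact: vI.
by rewrite indicE memNset ?mulr0.
Qed.

Let cvg_tail : (fun n => xi^-1 * (sum_s - series s n)) @ \oo --> (0 : R).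
Proof.
rewrite -(mulr0 xi^-1); apply: cvgM; first exact: cvg_cst.
by rewrite -[X in _ --> X](subrr sum_s); apply: cvgB => //; exact: cvg_cst.
Qed.

Lemma neumann_exists : exists r', [/\ integ r', (forall x, ~ I01 x -> r' x = 0),
  \int[leb]_x r' x = 0 &
  (fun n => \int[leb]_x `|r' x - \sum_(k < n) iter k P h x|) @ \oo --> (0 : R)].
Proof.
exists r; split => //.
  have hn n : `|\int[leb]_x r x| <= xi^-1 * (sum_s - series s n).
    apply: (le_trans _ (Rint_sub n)).
    have -> : \int[leb]_x r x = \int[leb]_x (r x - \sum_(k < n.+1) v k x).
      rewrite RintB//; last exact: integ_sum.
      rewrite [X in _ - X](_ : _ = 0) ?subr0//.
      elim: n.+1 => [|m IH].
        by rewrite Rintegral_eq0// => x; rewrite big_ord0.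
      under eq_Rintegral do rewrite big_ord_recr/=.
      by rewrite RintD ?IH ?iter_mass ?h0 ?addr0//; exact: integ_sum.
    apply: le_normr_Rintegral => //.
    by apply: integB => //; exact: integ_sum.
  apply/eqP; rewrite -normr_le0.
  by have /cvgr_to_ge := cvg_tail; apply; exists 0%N.
rewrite -cvg_shiftS.
apply: (@squeeze_cvgr _ _ _ _ (cst 0) (fun n => xi^-1 * (sum_s - series s n))) => //.
- by exists 0%N => // n _ /=; rewrite Rint_norm_ge0/= Rint_sub.
- exact: cvg_cst.
Qed.

(** With S n the partial sums, w - P w - h = (w - S n.+1) - P (w - S n), whose norm tends to 0.
    Stated for every limit w because [resolvent1] picks an arbitrary one. *)
Lemma neumann_fixpoint w : integ w ->
  (fun n => \int[leb]_x `|w x - \sum_(k < n) iter k P h x|) @ \oo --> (0 : R) ->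
  \int[leb]_x `|w x - P w x - h x| = 0.
Proof.
move=> iw cw; apply/eqP; rewrite eq_le Rint_norm_ge0 andbT.
pose d n := \int[leb]_x `|w x - \sum_(k < n) iter k P h x|.
have iS n : integ (fun x => \sum_(k < n) iter k P h x) by exact: integ_sum.
have iPw : integ (P w) by exact: Pop_integ.
have hn n : \int[leb]_x `|w x - P w x - h x| <= d n.+1 + d n.
  pose z x := w x - \sum_(k < n) iter k P h x.
  have iz : integ z by exact: integB.
  apply: (@le_trans _ _ (d n.+1 + \int[leb]_x `|P z x|)); last first.
    by rewrite lerD2l; exact: Pop_norm.
  rewrite /d -RintD; last 2 first.
  - by apply: integ_norm; exact: integB.
  - by apply: integ_norm; exact: Pop_integ.
  apply: Rint_le.
  - by apply: integ_norm; apply: integB => //; exact: integB.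
  - by apply: integD; apply: integ_norm; [exact: integB|exact: Pop_integ].
  move=> x; rewrite /z PopB//.
  rewrite (_ : \sum_(k < n.+1) _ = h x + \sum_(k < n) iter k.+1 P h x); last by rewrite big_ord_recl.
  have -> : P (fun x => \sum_(k < n) iter k P h x) x = \sum_(k < n) iter k.+1 P h x.
    elim: (n) => [|m IH].
      rewrite big_ord0; apply: Rintegral_eq0 => t; by rewrite big_ord0 mulr0.
    rewrite big_ord_recr/= -IH -PopD//; last exact: iter_integ.
    congr (Kop _ _ _ _).
    by apply/funext => t; rewrite big_ord_recr.
  set S := bigop.body _ _ _.
  apply: (le_trans _ (ler_normB _ _)); rewrite (_ : w x - _ - _ = w x - (h x + S) - (P w x - S)); last by ring.
  exact: lexx.
have : (fun n => d n.+1 + d n) @ \oo --> (0 : R).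
  rewrite -(addr0 0); apply: cvgD => //.
  by rewrite (cvg_shiftS d).
by move=> /cvgr_to_ge; apply; exists 0%N.
Qed.

End series.
End neumann_line.

(** * Densities on [0, 1] extended by zero to the line *)

Section extension_by_zero.
Context {R : realType}.
Notation leb := (@lebesgue_measure R).
Notation T_R := (measurableTypeR R).
Implicit Types f g : R -> R.

Definition ext01 f : T_R -> R := f \_ I01.

Lemma ext01_out f x : ~ I01 x -> ext01 f x = 0.
Proof. by move=> Ix; rewrite /ext01 patchE memNset. Qed.

Lemma ext01_in f x : I01 x -> ext01 f x = f x.
Proof. by move=> Ix; rewrite /ext01 patchE mem_set. Qed.

Lemma measurable_I01 : measurable (I01 : set T_R).
Proof. exact: measurable_itv. Qed.

Lemma L1_integ f : L1 f <-> integ (ext01 f).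
Proof.
rewrite /L1 /integ (integrable_mkcond _ measurable_I01).
by rewrite (_ : (EFin \o f) \_ I01 = EFin \o ext01 f)// restrict_EFin.
Qed.

Lemma ext01_fixed f : (forall x, ~ I01 x -> f x = 0) -> ext01 f = f.
Proof.
move=> f0; apply/funext => x.
by have [Ix|Ix] := pselect (I01 x); [rewrite ext01_in|rewrite ext01_out// f0].
Qed.

Lemma ext01_integral f : L1 f ->
  (\int[leb]_(x in I01) (f x)%:E = (\int[leb]_x ext01 f x)%:E)%E.
Proof.
move=> /L1_integ h; rewrite /Rintegral fineK; last exact: integrable_fin_num.
rewrite [LHS]integral_mkcond; apply: eq_integral => x _.
by rewrite /ext01 !patchE; case: ifP.
Qed.

Lemma L1normE f : L1 f -> L1norm f = (\int[leb]_x `|ext01 f x|)%:E.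
Proof.
move=> /L1_integ h; rewrite /L1norm /Rintegral fineK; last first.
  by apply: integrable_fin_num => //; exact: integ_norm.
rewrite [LHS]integral_mkcond; apply: eq_integral => x _.
by rewrite /ext01 !patchE; case: ifP; rewrite ?normr0.
Qed.

Lemma meas_ext01 f (A : set T_R) : meas f A = (\int[leb]_(x in A) (ext01 f x)%:E)%E.
Proof.
rewrite /meas integral_mkcond [RHS]integral_mkcond; apply: eq_integral => x _.
by rewrite /ext01 !patchE in_setI; case: (_ \in A) => //=; case: (_ \in I01).
Qed.

Lemma ext01B f g : ext01 (fun x => f x - g x) = (fun x => ext01 f x - ext01 g x).
Proof.
apply/funext => x; rewrite /ext01 !patchE; case: ifP => // _.
by rewrite subrr.
Qed.

(** The difference is tested on the set where it is nonnegative and on the complement. Equality of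
    L^1 classes is expressed as a vanishing distance from here on. *)
Lemma is_density_unique (mu : set R -> \bar R) f g :
  is_density mu f -> is_density mu g -> \int[leb]_x `|ext01 f x - ext01 g x| = 0.
Proof.
move=> [/L1_integ fI hf] [/L1_integ gI hg].
have dI := integB _ _ fI gI; set d := (fun x => _) in dI.
have md : measurable_fun setT d := integ_measurable _ dI.
have d0 (A : set T_R) : measurable A -> \int[leb]_x (\1_A x * d x) = 0.
  move=> mA.
  have iA (u : T_R -> R) : integ u -> integ (fun x => \1_A x * u x).
    move=> iu; apply: (integ_bounded_mul _ _ 1 (measurable_indic mA)) => // x.
    by rewrite indicE; case: (_ \in _); rewrite ?normr0 ?normr1.
  have hu (f' : R -> R) : \int[leb]_x (\1_A x * ext01 f' x) = fine (meas f' A).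
    rewrite meas_ext01 /Rintegral; congr fine.
    rewrite [RHS]integral_mkcond; apply: eq_integral => x _.
    by rewrite patchE indicE; case: (_ \in A); rewrite ?mul1r ?mul0r.
  under eq_Rintegral do rewrite mulrBr.
  by rewrite RintB ?hu -?hf -?hg ?subrr//; exact: iA.
pose A : set T_R := [set x | 0 <= d x].
have mA : measurable A.
  rewrite (_ : A = d @^-1` `[0, +oo[); last by apply/seteqP; split => x /=; rewrite in_itv/= andbT.
  by rewrite -[X in measurable X]setTI; apply: md.
have mC : measurable (~` A) by exact: measurableC.
have iA (B : set T_R) : measurable B -> integ (fun x => \1_B x * d x).
  move=> mB; apply: (integ_bounded_mul _ _ 1 (measurable_indic mB)) => // x.
  by rewrite indicE; case: (_ \in _); rewrite ?normr0 ?normr1.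
transitivity (\int[leb]_x (\1_A x * d x - \1_(~` A) x * d x)).
  apply: eq_Rintegral => x _; rewrite -/(d x) !indicE.
  have [Ax|Ax] := pselect (A x).
    by rewrite mem_set// memNset ?mul1r ?mul0r ?subr0 ?ger0_norm//; apply.
  rewrite memNset// mem_set// mul1r mul0r sub0r ltr0_norm//.
  by rewrite ltNge; apply/negP.
by rewrite RintB ?d0 ?subrr//; exact: iA.
Qed.

Lemma dens_spec (mu : set R -> \bar R) : has_density mu -> is_density mu (dens mu).
Proof. by move=> [f hf]; exact: (@xgetPex _ (fun=> 0) [set f | is_density mu f]) (ex_intro _ f hf). Qed.

End extension_by_zero.

Section l1_distance.
Context {R : realType}.
Notation leb := (@lebesgue_measure R).
Notation T_R := (measurableTypeR R).
Implicit Types u v w : T_R -> R.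

Lemma Rint_norm_eq u v : integ u -> integ v -> \int[leb]_x `|u x - v x| = 0 ->
  \int[leb]_x `|u x| = \int[leb]_x `|v x|.
Proof.
move=> iu iv uv0; apply/eqP; rewrite -subr_eq0 -normr_le0 -uv0 -RintB; [|exact: integ_norm..].
have i1 : integ (fun x => `|u x| - `|v x|) by apply: integB; exact: integ_norm.
apply: (le_trans (le_normr_Rintegral _ i1)) => //.
apply: Rint_le; [exact: integ_norm|apply: integ_norm; exact: integB|].
by move=> x; exact: ler_dist_dist.
Qed.

Lemma Rint_eq u v : integ u -> integ v -> \int[leb]_x `|u x - v x| = 0 ->
  \int[leb]_x u x = \int[leb]_x v x.
Proof.
move=> iu iv uv0; apply/eqP; rewrite -subr_eq0 -normr_le0 -uv0 -RintB//.
by apply: le_normr_Rintegral => //; exact: integB.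
Qed.

Lemma Rint_distC u v : \int[leb]_x `|u x - v x| = \int[leb]_x `|v x - u x|.
Proof. by apply: eq_Rintegral => x _; rewrite distrC. Qed.

End l1_distance.

(** * The resolvent on L^1 of [0, 1] *)

Section neumann_L1.
Context {R : realType}.
Notation leb := (@lebesgue_measure R).
Notation T_R := (measurableTypeR R).
Variables (xi : R) (xi_gt0 : 0 < xi).
Variable tau : T_R -> T_R.
Hypothesis mtau : measurable_fun setT tau.
Hypothesis tau_in : forall x, I01 x -> xi / 2 <= (tau x : R) <= 1 - xi / 2.
Local Notation P := (Pop xi tau).

Let tau01 x : I01 x -> 0 <= (tau x : R) <= 1.
Proof. by move=> /tau_in; move: (tau x : R) xi_gt0 => t; lra. Qed.

(** By [Pop_bound], equivalent densities have images that agree at every point, not only almost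
    everywhere. *)
Lemma Pop_eq u v : integ u -> integ v -> \int[leb]_x `|u x - v x| = 0 -> P u = P v.
Proof.
move=> iu iv uv0; apply/funext => y; apply/eqP; rewrite -subr_eq0 -normr_le0 -PopB//.
have := Pop_bound xi xi_gt0 tau mtau (fun x => u x - v x) y (integB _ _ iu iv).
by rewrite uv0 mulr0.
Qed.

Lemma Lnoise_meas_density f : L1 f -> is_density (Lnoise xi tau (meas f)) (P (ext01 f)).
Proof.
move=> /L1_integ fI; apply: Lnoise_density => //.
  by move=> x; exact: ext01_out.
by move=> A mA; exact: meas_ext01.
Qed.

(** [LnoiseL1] returns an arbitrary representative, so it can be compared with the explicit kernel
    operator in L^1 distance only. *)
Lemma LnoiseL1_spec f : L1 f ->
  L1 (LnoiseL1 xi tau f) /\ \int[leb]_x `|ext01 (LnoiseL1 xi tau f) x - P (ext01 f) x| = 0.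
Proof.
move=> fI; have hd := Lnoise_meas_density f fI.
have hd' : is_density (Lnoise xi tau (meas f)) (LnoiseL1 xi tau f).
  by apply: dens_spec; exists (P (ext01 f)).
split; first by case: hd'.
rewrite -(ext01_fixed (P (ext01 f))); first exact: is_density_unique hd' hd.
by move=> x; apply: Pop_out => // ?; exact: ext01_out.
Qed.

Lemma iter_LnoiseL1_spec k h : L1 h ->
  L1 (iter k (LnoiseL1 xi tau) h) /\
  \int[leb]_x `|ext01 (iter k (LnoiseL1 xi tau) h) x - iter k P (ext01 h) x| = 0.
Proof.
move=> hI; have ih : integ (ext01 h) by exact/L1_integ.
elim: k => [|k [IH1 IH2]] /=.
  by split => //; apply: Rintegral_eq0 => x; rewrite subrr normr0.
have [h1 h2] := LnoiseL1_spec _ IH1; split; first exact: h1.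
rewrite -(Pop_eq _ _ _ _ IH2)//; first exact/L1_integ.
exact: iter_Pop_integ.
Qed.

Lemma neumann_partial n h r : L1 h -> L1 r ->
  L1norm (fun x => r x - \sum_(k < n) iter k (LnoiseL1 xi tau) h x) =
  (\int[leb]_x `|ext01 r x - \sum_(k < n) iter k P (ext01 h) x|)%:E.
Proof.
move=> hI rI; have ih : integ (ext01 h) by exact/L1_integ.
have i2 k : integ (iter k P (ext01 h)) by exact: iter_Pop_integ.
have [sI sE] : integ (ext01 (fun x => \sum_(k < n) iter k (LnoiseL1 xi tau) h x)) /\
    \int[leb]_x `|ext01 (fun x => \sum_(k < n) iter k (LnoiseL1 xi tau) h x) x -
       \sum_(k < n) iter k P (ext01 h) x| = 0.
  have e1 x : ext01 (fun x => \sum_(k < n) iter k (LnoiseL1 xi tau) h x) x =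
      \sum_(k < n) ext01 (iter k (LnoiseL1 xi tau) h) x.
    by rewrite /ext01 patchE; case: ifPn => xI; [|rewrite big1//];
      [apply: eq_bigr => k _; rewrite patchE xI|move=> k _; rewrite patchE (negbTE xI)].
  have i1 k : integ (ext01 (iter k (LnoiseL1 xi tau) h)).
    by apply/L1_integ; case: (iter_LnoiseL1_spec k h hI).
  split; first by rewrite (funext e1); exact: (integ_sum n (fun k => ext01 (iter k (LnoiseL1 xi tau) h))).
  apply/eqP; rewrite eq_le Rint_norm_ge0 andbT.
  apply: (@le_trans _ _ (\int[leb]_x `|\sum_(k < n)
      (ext01 (iter k (LnoiseL1 xi tau) h) x - iter k P (ext01 h) x)|)).
    by apply/eq_ler/eq_Rintegral => x _; rewrite e1 sumrB.
  apply: (le_trans (Rint_norm_sum n (fun k x => ext01 (iter k (LnoiseL1 xi tau) h) x - iter k P (ext01 h) x) _)).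
    by move=> k; exact: integB.
  rewrite big1// => k _; by case: (iter_LnoiseL1_spec k h hI).
have irr : integ (ext01 r) by exact/L1_integ.
have i3 : integ (fun x => \sum_(k < n) iter k P (ext01 h) x).
  exact: (integ_sum n (fun k => iter k P (ext01 h))).
rewrite L1normE; last by apply/L1_integ; rewrite ext01B; exact: integB.
congr EFin; apply: Rint_norm_eq.
- by rewrite ext01B; exact: integB.
- exact: integB.
rewrite Rint_distC ext01B -[RHS]sE; apply: eq_Rintegral => x _; congr `|_|.
by rewrite opprB addrC addrA subrK.
Qed.

Variables (N : nat) (theta : R).
Hypothesis theta_lt1 : theta < 1.
Hypothesis contr : forall u : T_R -> R, integ u -> (forall x, ~ I01 x -> u x = 0) ->
  \int[leb]_x u x = 0 ->
  \int[leb]_x `|iter N P u x| <= theta * \int[leb]_x `|u x|.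

Lemma zero_averageE h : zero_average h <-> integ (ext01 h) /\ \int[leb]_x ext01 h x = 0.
Proof.
split=> [[hI]|[hI h0]].
  by rewrite ext01_integral// => /eqP; rewrite eqe => /eqP h0; split => //; exact/L1_integ.
have h1 : L1 h by exact/L1_integ.
by split => //; rewrite ext01_integral// h0.
Qed.

Lemma neumann_sum_exists h : zero_average h ->
  exists r, is_neumann_sum (LnoiseL1 xi tau) h r.
Proof.
move=> /zero_averageE[ih h0].
have [r [ir rI r0 cr]] := neumann_exists xi xi_gt0 tau mtau tau_in N theta theta_lt1
  contr (ext01 h) ih (ext01_out h) h0.
have rE : ext01 r = r by exact: ext01_fixed.
have r1 : L1 r by apply/L1_integ; rewrite rE.
have h1 : L1 h by exact/L1_integ.
exists r; split; first by apply/zero_averageE; rewrite rE.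
under eq_fun do rewrite neumann_partial// rE.
by apply: cvg_EFin => //; exists 0%N.
Qed.

Lemma resolvent1_spec h : zero_average h ->
  let r := resolvent1 (LnoiseL1 xi tau) h in
  [/\ integ (ext01 r), \int[leb]_x ext01 r x = 0 &
      \int[leb]_x `|ext01 r x - P (ext01 r) x - ext01 h x| = 0].
Proof.
move=> h0 r.
have [r'] := neumann_sum_exists h h0.
move=> /(ex_intro (is_neumann_sum (LnoiseL1 xi tau) h) r').
move=> /(@xgetPex _ (fun=> 0) [set r | is_neumann_sum (LnoiseL1 xi tau) h r]).
rewrite -/(resolvent1 _ _) -/r => -[r0 cr].
have /zero_averageE[ir r00] := r0; split => //.
apply: (neumann_fixpoint xi xi_gt0 tau mtau _ _ _ ir) => //; first by case/zero_averageE: h0.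
have [hI _] := h0; have [rI _] := r0.
move: cr; under eq_fun do rewrite neumann_partial//.
by move=> /fine_cvg.
Qed.

End neumann_L1.

(** * Differences of monotone functions and Stieltjes measures *)

Section clamp.
Context {R : realType}.
Implicit Types a b x y : R.

(** Projection onto [a, b], used to extend functions from a segment to the line. *)
Definition clamp a b x : R := Num.max a (Num.min b x).

Lemma clampP a b x : a <= b -> a <= clamp a b x <= b.
Proof. by move=> ab; rewrite /clamp le_max lexx/= ge_max ab ge_min lexx. Qed.

Lemma clamp_id a b x : a <= x <= b -> clamp a b x = x.
Proof. by move=> /andP[ax xb]; rewrite /clamp min_r// max_r. Qed.

Lemma clamp_lo a b x : a <= b -> x <= a -> clamp a b x = a.
Proof. by move=> ab xa; rewrite /clamp min_r ?(le_trans xa ab)// max_l. Qed.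

Lemma clamp_hi a b x : a <= b -> b <= x -> clamp a b x = b.
Proof. by move=> ab bx; rewrite /clamp min_l// max_r. Qed.

Lemma clamp_le a b x y : x <= y -> clamp a b x <= clamp a b y.
Proof.
move=> xy; rewrite /clamp; case: (leP b x) => bx; case: (leP b y) => by_;
repeat (match goal with |- context [Num.max ?u ?v] => case: (leP u v) => ? end); lra.
Qed.

Lemma clamp_dist a b x y : `|clamp a b x - clamp a b y| <= `|x - y|.
Proof.
wlog xy : x y / x <= y.
  by move=> h; have [xy|/ltW xy] := leP x y; [|rewrite distrC [leRHS]distrC]; exact: h.
rewrite ler0_norm ?subr_le0 ?clamp_le// ler0_norm ?subr_le0// !opprB.
rewrite /clamp; case: (leP b x) => bx; case: (leP b y) => by_;
repeat (match goal with |- context [Num.max ?u ?v] => case: (leP u v) => ? end); lra.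
Qed.

Lemma continuous_clamp a b : continuous (clamp a b).
Proof.
move=> x; apply/cvgrPdist_lt => e e0; apply/nbhs_ballP; exists e => // y.
by rewrite /ball/= => xy; apply: le_lt_trans (clamp_dist _ _ _ _) xy.
Qed.

Lemma near_le_cst x c : x < c -> \forall z \near x, z <= c.
Proof.
move=> xc; apply/nbhs_ballP; exists (c - x); first by rewrite /= subr_gt0.
by move=> z; rewrite /ball/= ltr_norml => /andP[h _]; lra.
Qed.

Lemma near_ge_cst x c : c < x -> \forall z \near x, c <= z.
Proof.
move=> xc; apply/nbhs_ballP; exists (x - c); first by rewrite /= subr_gt0.
by move=> z; rewrite /ball/= ltr_norml => /andP[_ h]; lra.
Qed.

(** The inverse is extended by constants beyond the range of f, hence total, continuous and
    monotone, and can be composed without side conditions. Continuity at w comes from comparing with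
    the levels f (g w + e) and f (g w - e). *)
Lemma clamped_inverse (f : R -> R) a b : a < b -> {within `[a, b], continuous f} ->
  (forall x y, a <= x -> x < y -> y <= b -> f x < f y) ->
  exists g : R -> R, [/\ continuous g, (forall w w', w <= w' -> g w <= g w'),
    (forall w, a <= g w <= b), (forall w, f (g w) = clamp (f a) (f b) w) &
    (forall x, a <= x <= b -> g (f x) = x)].
Proof.
move=> ab cf inc; have fab : f a < f b by exact: inc.
have ex w : exists v, a <= v <= b /\ f v = clamp (f a) (f b) w.
  have := clampP (f a) (f b) w (ltW fab); set z := clamp _ _ _ => zab.
  have zI : Num.min (f a) (f b) <= z <= Num.max (f a) (f b).
    by rewrite min_l ?max_r ?(ltW fab).
  have [v vab fv] := IVT (ltW ab) cf zI.
  by exists v; split => //; move: vab; rewrite in_itv.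
have [g hg] := choice ex.
have gab w : a <= g w <= b by case: (hg w).
have fg w : f (g w) = clamp (f a) (f b) w by case: (hg w).
have incW x y : a <= x -> x <= y -> y <= b -> f x <= f y.
  move=> ax; rewrite le_eqVlt => /predU1P[-> //|xy yb]; exact/ltW/inc.
have gf x : a <= x <= b -> g (f x) = x.
  move=> /andP[ax xb]; have /andP[ag gb] := gab (f x).
  have := fg (f x); rewrite clamp_id; last by rewrite !incW.
  case: (ltgtP (g (f x)) x) => // h.
    by move: (inc _ _ ag h xb) => + e; rewrite e ltxx.
  by move: (inc _ _ ax h gb) => + e; rewrite e ltxx.
have gle w w' : w <= w' -> g w <= g w'.
  move=> ww'; rewrite leNgt; apply/negP => h.
  have /andP[ag' _] := gab w'; have /andP[_ gb] := gab w.
  have := inc _ _ ag' h gb; rewrite !fg ltNge; apply/negP; rewrite negbK.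
  exact: clamp_le.
exists g; split => // w; apply/cvgrPdist_le => e e0.
have /andP[ag gb] := gab w.
have h1 : \forall z \near w, g z <= g w + e.
  have [h|h] := leP b (g w + e).
    by near=> z; have /andP[_ ?] := gab z; exact: le_trans h.
  have wf : w < f (g w + e).
    apply: (@le_lt_trans _ _ (f (g w))); last by apply: inc; lra.
    rewrite fg; have [|hw] := leP w (f b).
      move=> wb; have [wa|wa] := leP w (f a); first by rewrite clamp_lo// ltW.
      by rewrite clamp_id ?(ltW wa).
    have : f (g w) < f b by apply: inc; lra.
    by rewrite fg clamp_hi ?(ltW fab) ?(ltW hw)// ltxx.
  near=> z; rewrite -[leRHS]gf; last by lra.
  by apply: gle; near: z; exact: near_le_cst.
have h2 : \forall z \near w, g w - e <= g z.
  have [h|h] := leP (g w - e) a.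
    by near=> z; have /andP[? _] := gab z; exact: le_trans h _.
  have wf : f (g w - e) < w.
    apply: (@lt_le_trans _ _ (f (g w))); first by apply: inc; lra.
    rewrite fg; have [|hw] := leP (f a) w.
      move=> wa; have [wb|wb] := leP (f b) w; first by rewrite clamp_hi// ltW.
      by rewrite clamp_id ?wa ?(ltW wb).
    have : f a < f (g w) by apply: inc; lra.
    by rewrite fg clamp_lo ?(ltW fab) ?(ltW hw)// ltxx.
  near=> z; rewrite -[leLHS]gf; last by lra.
  by apply: gle; near: z; exact: near_ge_cst.
near=> z; rewrite ler_norml.
have : g z <= g w + e by near: z.
have : g w - e <= g z by near: z.
by move=> ? ?; lra.
Unshelve. all: by end_near.
Qed.

End clamp.

(** * Continuous differences of monotone functions *)

Section monotone_differences.
Context {R : realType}.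
Implicit Types p q f : R -> R.

(** Nonnegativity gives stability under products, and boundedness gives stability of [mono_diff]
    under x -> -x. *)
Definition bmono p := [/\ continuous p, (forall x y, x <= y -> p x <= p y),
  (forall x, 0 <= p x) & exists M, forall x, p x <= M].

Definition mono_diff f := exists p q, [/\ bmono p, bmono q & forall x, f x = p x - q x].

Lemma bmonoD p q : bmono p -> bmono q -> bmono (fun x => p x + q x).
Proof.
move=> [cp mp p0 [M pM]] [cq mq q0 [M' qM]]; split.
- by move=> x; apply: cvgD; [exact: cp|exact: cq].
- by move=> x y xy; rewrite lerD ?mp ?mq.
- by move=> x; rewrite addr_ge0.
- by exists (M + M') => x; rewrite lerD.
Qed.

Lemma bmonoM p q : bmono p -> bmono q -> bmono (fun x => p x * q x).
Proof.
move=> [cp mp p0 [M pM]] [cq mq q0 [M' qM]]; split.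
- by move=> x; apply: cvgM; [exact: cp|exact: cq].
- by move=> x y xy; rewrite ler_pM ?mp ?mq.
- by move=> x; rewrite mulr_ge0.
- by exists (M * M') => x; rewrite ler_pM.
Qed.

Lemma mono_diffM f g : mono_diff f -> mono_diff g -> mono_diff (fun x => f x * g x).
Proof.
move=> [p [q [bp bq fE]]] [p' [q' [bp' bq' gE]]].
exists (fun x => p x * p' x + q x * q' x), (fun x => p x * q' x + q x * p' x); split.
- by apply: bmonoD; exact: bmonoM.
- by apply: bmonoD; exact: bmonoM.
- by move=> x; rewrite fE gE; ring.
Qed.

Lemma mono_diffB f g : mono_diff f -> mono_diff g -> mono_diff (fun x => f x - g x).
Proof.
move=> [p [q [bp bq fE]]] [p' [q' [bp' bq' gE]]].
exists (fun x => p x + q' x), (fun x => q x + p' x); split; [exact: bmonoD|exact: bmonoD|].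
by move=> x; rewrite fE gE; ring.
Qed.

Lemma mono_diff_cst c : mono_diff (fun=> c).
Proof.
have bc d : 0 <= d -> bmono (fun=> d).
  by move=> d0; split => //; [move=> x; exact: cvg_cst|exists d].
exists (fun=> Num.max c 0), (fun=> Num.max (- c) 0); split.
- by apply: bc; rewrite le_max lexx orbT.
- by apply: bc; rewrite le_max lexx orbT.
by move=> _; case: (leP c 0) => h; case: (leP (- c) 0) => h'; lra.
Qed.

Lemma mono_diff_comp f u : mono_diff f -> continuous u ->
  (forall x y, x <= y -> u x <= u y) -> mono_diff (fun x => f (u x)).
Proof.
move=> [p [q [bp bq fE]]] cu mu.
have bc p' : bmono p' -> bmono (fun x => p' (u x)).
  move=> [cp mp p0 [M pM]]; split => //.
  - by move=> x; apply: (continuous_comp (f := u) (g := p')); [exact: cu|exact: cp].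
  - by move=> x y xy; apply/mp/mu.
  - by exists M.
by exists (fun x => p (u x)), (fun x => q (u x)); split; [exact: bc|exact: bc|].
Qed.

Lemma mono_diff_opp f : mono_diff f -> mono_diff (fun x => f (- x)).
Proof.
move=> [p [q [[cp mp p0 [M pM]] [cq mq q0 [M' qM]] fE]]].
have cN p' : continuous p' -> continuous (fun x => p' (- x)).
  move=> cp' x; apply: (continuous_comp (f := fun x : R => - x) (g := p')); last exact: cp'.
  exact: opp_continuous.
have M0 : 0 <= M by exact: le_trans (p0 0) (pM 0).
have M'0 : 0 <= M' by exact: le_trans (q0 0) (qM 0).
have bN p' N N' : continuous p' -> (forall x y, x <= y -> p' x <= p' y) ->
    (forall x, 0 <= p' x) -> (forall x, p' x <= N) -> 0 <= N' ->
    bmono (fun x => N - p' (- x) + N').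
  move=> cp' mp' p'0 p'N N'0; split.
  - move=> x; apply: cvgD; last exact: cvg_cst.
    by apply: cvgB; [exact: cvg_cst|exact: (cN _ cp')].
  - by move=> x y xy; rewrite lerD2r lerD2l lerN2 mp'// lerN2.
  - by move=> x; rewrite addr_ge0// subr_ge0.
  - by exists (N + N') => x; rewrite lerD2r gerBl.
exists (fun x => M' - q (- x) + M), (fun x => M - p (- x) + M'); split.
- exact: bN.
- exact: bN.
by move=> x; rewrite fE; ring.
Qed.

Section lipschitz.
Variables (f : R -> R) (a b K : R).
Hypotheses (ab : a <= b) (K0 : 0 <= K).
Hypothesis fK : forall x y, a <= x <= b -> a <= y <= b -> `|f x - f y| <= K * `|x - y|.

Lemma lipschitz_clamp x y : `|f (clamp a b x) - f (clamp a b y)| <= K * `|x - y|.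
Proof.
apply: le_trans (fK _ _ (clampP _ _ _ ab) (clampP _ _ _ ab)) _.
by rewrite ler_wpM2l// clamp_dist.
Qed.

Lemma lipschitz_clamp_continuous : continuous (fun x => f (clamp a b x)).
Proof.
move=> x; apply/cvgrPdist_le => e e0; have K1 : 0 < K + 1 by exact: ltr_wpDl.
apply/nbhs_ballP; exists (e / (K + 1)) => [|y]; first exact: divr_gt0.
rewrite /ball/= => /ltW xy; apply: le_trans (lipschitz_clamp _ _) _.
apply: (@le_trans _ _ ((K + 1) * `|x - y|)); first by rewrite ler_wpM2r// lerDl.
by rewrite mulrC -ler_pdivlMr.
Qed.

Lemma mono_diff_lipschitz : mono_diff (fun x => f (clamp a b x)).
Proof.
(* For K-Lipschitz f both f + K x and K x are nondecreasing on the segment; C makes them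
   nonnegative. *)
pose C := `|f a| + K * (b - a) + K * `|a| + K * `|b|.
pose u := clamp a b.
have uP x : a <= u x <= b by exact: clampP.
have ucv : continuous u by exact: continuous_clamp.
have K1 x : K * - `|a| <= K * u x.
  have /andP[? _] := uP x; rewrite ler_wpM2l//; have := ler_norm (- a); rewrite normrN; lra.
have K2 x : K * u x <= K * `|b|.
  by have /andP[_ ?] := uP x; rewrite ler_wpM2l// (le_trans _ (ler_norm b)).
have Kba : 0 <= K * (b - a) by rewrite mulr_ge0// subr_ge0.
have Kb : 0 <= K * `|b| by rewrite mulr_ge0.
have fa x : `|f (u x) - f a| <= K * (b - a).
  have /andP[? ?] := uP x; apply: le_trans (fK _ _ _ _) _ => //.
    by rewrite lexx ab.
  by rewrite ler_wpM2l// ger0_norm; lra.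
have cK : continuous (fun x => K * u x + C).
  move=> x; apply: cvgD; last exact: cvg_cst.
  by apply: cvgM; [exact: cvg_cst|exact: ucv].
have fa0 := ler_norm (- f a); rewrite normrN in fa0.
exists (fun x => f (u x) + (K * u x + C)), (fun x => K * u x + C); split; last 1 first.
- by move=> x; rewrite addrK.
- split.
  + by move=> x; apply: cvgD; [exact: lipschitz_clamp_continuous|exact: cK].
  + move=> x y xy; have uxy : u x <= u y by exact: clamp_le.
    have := fK _ _ (uP x) (uP y); rewrite [`|u x - u y|]ler0_norm ?subr_le0//.
    rewrite ler_norml => /andP[_]; rewrite mulrN mulrBr; lra.
  + move=> x; have := K1 x; have := fa x; rewrite ler_norml mulrN /C; lra.
  + exists (f a + K * (b - a) + K * `|b| + C) => x.
    have := K2 x; have := fa x; rewrite ler_norml; lra.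
- split => //.
  + by move=> x y xy; rewrite lerD2r ler_wpM2l// clamp_le.
  + move=> x; have := K1 x; have := normr_ge0 (f a); rewrite mulrN /C; lra.
  + by exists (K * `|b| + C) => x; rewrite lerD2r.
Qed.

End lipschitz.

End monotone_differences.

(** * Stieltjes measures and their restriction to a window *)

Section stieltjes.
Context {R : realType}.
Notation T_R := (measurableTypeR R).

Lemma lebesgue_stieltjes_ocitv (c : cumulative R R) a b : a <= b ->
  lebesgue_stieltjes_measure c (`]a, b]%classic : set T_R) = (c b - c a)%:E.
Proof.
move=> ab; rewrite /lebesgue_stieltjes_measure /measure_extension measurable_mu_extE/=.
  rewrite wlength_itv_bnd//.
by exists (a, b).
Qed.

Lemma stieltjes_exists (p : R -> R) : continuous p -> (forall x y, x <= y -> p x <= p y) ->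
  exists m : {sigma_finite_measure set T_R -> \bar R},
    forall a b, a <= b -> m `]a, b]%classic = (p b - p a)%:E.
Proof.
move=> cp mp.
pose c : cumulative R R := HB.pack p (isCumulative.Build R _ R p mp (right_continuousW cp)).
by exists (lebesgue_stieltjes_measure c) => a b; exact: lebesgue_stieltjes_ocitv.
Qed.

Lemma stieltjes_unique (p : R -> R) (m1 m2 : {measure set T_R -> \bar R}) :
  continuous p -> (forall x y, x <= y -> p x <= p y) ->
  (forall a b, a <= b -> m1 `]a, b]%classic = (p b - p a)%:E) ->
  (forall a b, a <= b -> m2 `]a, b]%classic = (p b - p a)%:E) ->
  forall A : set T_R, measurable A -> m1 A = m2 A.
Proof.
move=> cp mp h1 h2 A mA.
pose c : cumulative R R := HB.pack p (isCumulative.Build R _ R p mp (right_continuousW cp)).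
have e (m : {measure set T_R -> \bar R}) :
    (forall a b, a <= b -> m `]a, b]%classic = (p b - p a)%:E) ->
    lebesgue_stieltjes_measure c A = m A.
  move=> hm; apply: lebesgue_stieltjes_measure_unique => // X [[a b] _ <-] /=.
  have [ab|ba] := leP a b.
    by rewrite hm//; exact: lebesgue_stieltjes_ocitv.
  by rewrite set_itv_ge ?measure0//= bnd_simp -leNgt ltW.
by rewrite -(e _ h1) (e _ h2).
Qed.

End stieltjes.

Section window_measure.
Context {R : realType}.
Notation leb := (@lebesgue_measure R).
Notation T_R := (measurableTypeR R).

(** The Stieltjes measure of p restricted to ]b, B]. The window will avoid the ends of [0, 1] and
    the singular level [Tmax]. *)
Definition window_measure (p : R -> R) (b B : R) (m : set T_R -> \bar R) :=
  (forall A : set T_R, measurable A -> m A = m (A `&` `]b, B])) /\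
  (forall c d, b <= c -> c <= d -> d <= B -> m `]c, d]%classic = (p d - p c)%:E).

Lemma window_measure_exists (p : R -> R) b B : b <= B ->
  continuous p -> (forall x y, x <= y -> p x <= p y) ->
  exists m : {finite_measure set T_R -> \bar R}, window_measure p b B m.
Proof.
move=> bB cp mp; have [m hm] := stieltjes_exists p cp mp.
have mD : measurable (`]b, B]%classic : set T_R) by exact: measurable_itv.
have moo : (m (`]b, B]%classic) < +oo)%E by rewrite hm// ltry.
exists (mfrestr mD moo); split.
  by move=> A mA; rewrite /= /mfrestr /mrestr -setIA setIid.
move=> c d bc cd dB; rewrite /= /mfrestr /mrestr setIidl ?hm//.
by move=> x /=; rewrite !in_itv/= => /andP[? ?]; lra.
Qed.

Section fixed_window.
Variables (p : R -> R) (b B : R).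
Hypotheses (b_ge0 : 0 <= b) (bB : b <= B) (B_le1 : B <= 1).
Hypotheses (cp : continuous p) (mp : forall x y, x <= y -> p x <= p y).
Variable m : {finite_measure set T_R -> \bar R}.
Hypothesis hm : window_measure p b B m.

Definition win : T_R -> R := \1_(`]b, B]).

Let mwin : measurable (`]b, B]%classic : set T_R). Proof. exact: measurable_itv. Qed.

Lemma integ_win : m.-integrable setT (EFin \o win).
Proof. exact: integrable_indic. Qed.

Lemma window_measureE (A : set T_R) : measurable A -> m A = (\int[m]_(x in A) (win x)%:E)%E.
Proof.
move=> mA; rewrite integral_indic// setIC; exact: hm.1.
Qed.

Lemma window_measure_atom c : m [set c] = 0%E.
Proof.
rewrite hm.1; last exact: measurable_set1.
have [cbB|cbB] := pselect (b < c <= B); last first.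
  rewrite (_ : _ `&` _ = set0) ?measure0//; apply/seteqP; split => // x [/= ->].
  by rewrite in_itv.
apply/eqP; rewrite -measure_le0; apply/lee_addgt0Pr => e e0; rewrite add0e.
have /cvgrPdist_lt /(_ _ e0) /nbhs_ballP[d /= d0 hd] := cp c.
pose c' := Num.max b (c - d / 2).
have c'c : c' < c by rewrite /c' gt_max; apply/andP; split; lra.
have c'd : c - d / 2 <= c' by rewrite /c' le_max lexx orbT.
have bc' : b <= c' by rewrite /c' le_max lexx.
have := hd c'; rewrite /ball/= => /(_ _)-h.
apply: (@le_trans _ _ (m `]c', c]%classic)).
  apply: le_measure; rewrite ?inE.
  - by apply: measurableI => //; exact: measurable_set1.
  - exact: measurable_itv.
  - by move=> x [/= -> _]; rewrite in_itv/= c'c lexx.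
rewrite hm.2//; [|exact: ltW|lra].
rewrite lee_fin; have := h _; rewrite ger0_norm ?subr_ge0 ?(ltW c'c)//.
have pc : p c' <= p c by apply/mp/ltW.
by rewrite ger0_norm ?subr_ge0// => h'; apply/ltW/h'; lra.
Qed.

Lemma window_measure_itv c d : c <= d ->
  m (`]b, B] `&` `[c, d]) = (p (clamp b B d) - p (clamp b B c))%:E.
Proof.
move=> cd; have /andP[bc cB] := clampP b B c bB; have /andP[bd dB] := clampP b B d bB.
have cd' := clamp_le b B c d cd.
rewrite -hm.2//; apply/eqP; rewrite eq_le; apply/andP; split; last first.
  apply: le_measure; rewrite ?inE; [exact: measurable_itv|by apply: measurableI; exact: measurable_itv|].
  move=> x /=; rewrite !in_itv/= => /andP[xc xd]; split.
    by apply/andP; split; lra.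
  have [cb|bc1] := leP c B; last first.
    by move: xc; rewrite clamp_hi ?(ltW bc1)//; lra.
  have [db|bd1] := leP b d; last first.
    by move: xd; rewrite clamp_lo ?(ltW bd1)//; lra.
  apply/andP; split.
    have [h|h] := leP b c; first by move: xc; rewrite clamp_id ?h ?cb//; lra.
    by lra.
  have [h|h] := leP d B; first by move: xd; rewrite clamp_id ?h ?db//; lra.
  by lra.
apply: (@le_trans _ _ (m ([set clamp b B c] `|` `]clamp b B c, clamp b B d]))).
  apply: le_measure; rewrite ?inE; first by apply: measurableI; exact: measurable_itv.
    by apply: measurableU; [exact: measurable_set1|exact: measurable_itv].
  move=> x [/=]; rewrite !in_itv/= => /andP[bx xB] /andP[cx xd].
  have xE : clamp b B x = x by rewrite clamp_id//; apply/andP; split; lra.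
  have h0 := clamp_le b B c x cx; rewrite xE in h0.
  have [e|ne] := eqVneq x (clamp b B c); first by left.
  by right; rewrite lt_neqAle eq_sym ne h0/= -xE clamp_le.
apply: le_trans (measureU2 _ _ _) _; [exact: measurable_set1|exact: measurable_itv|].
rewrite -[leRHS]add0e; apply: leeD => //.
by rewrite le_eqVlt; apply/orP; left; apply/eqP; exact: window_measure_atom.
Qed.

Lemma window_measure_total : \int[m]_x win x = p B - p b.
Proof.
rewrite /Rintegral integral_indic// setIT.
exact: (congr1 fine (hm.2 _ _ (lexx b) bB (lexx B))).
Qed.

Lemma Kop_window (xi : R) y : 0 < xi ->
  Kop m (nbump xi (clamp b B)) win y =
  xi^-1 * (p (clamp b B (y + xi / 2)) - p (clamp b B (y - xi / 2))).
Proof.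
move=> xi0; rewrite /Kop /Rintegral.
under eq_integral => x _.
  rewrite (_ : _ * _ = xi^-1 * \1_(`]b, B] `&` `[y - xi / 2, y + xi / 2]) x); last first.
    rewrite /nbump /win -mulrA; congr (_ * _); rewrite !indicE -natrM mulnb in_setI.
    congr ((nat_of_bool _)%:R); rewrite andbC.
    have [xI|] := boolP (x \in `]b, B]%classic) => //=; move: xI; rewrite inE/= in_itv/= => xI.
    rewrite clamp_id; last by move: xI => /andP[? ?]; apply/andP; split; lra.
    by apply/idP/idP; rewrite !inE/= !in_itv/=; lra.
  rewrite EFinM; over.
have mI : measurable (`]b, B] `&` `[y - xi / 2, y + xi / 2] : set T_R).
  by apply: measurableI; exact: measurable_itv.
rewrite ge0_integralZl//; last 2 first.
- by apply/measurable_EFinP; exact: measurable_indic.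
- by rewrite lee_fin invr_ge0 ltW.
rewrite integral_indic// setIT.
have yy : y - xi / 2 <= y + xi / 2 by lra.
by have := window_measure_itv _ _ yy => /(congr1 (fun z => fine ((xi^-1)%:E * z)%E)).
Qed.

(** Integration by parts through Fubini: phi B - phi x is the integral of dphi over [x, B], and the
    mass of ]b, t] is p t - p b. *)
Lemma window_parts (phi dphi : R -> R) (M : R) :
  (forall x : R, is_derive x 1 phi (dphi x)) -> continuous dphi -> (forall x, `|dphi x| <= M) ->
  \int[m]_x (phi x * win x) =
  phi B * p B - phi b * p b - \int[leb]_t (dphi t * (\1_(`[b, B]) t * p t)).
Proof.
move=> hphi cdphi dM.
pose k (z : T_R * T_R) : R := \1_(`[b, B]) z.2 * \1_(`[0, +oo[) (z.2 - z.1).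
have mk : measurable_fun setT k.
  apply: measurable_funM.
    apply: (@measurableT_comp _ _ _ _ _ _ (\1_(`[b, B]) : T_R -> T_R) _ (fun z : T_R * T_R => z.2 : T_R)).
      exact: measurable_indic.
    exact: measurable_snd.
  apply: (@measurableT_comp _ _ _ _ _ _ (\1_(`[0, +oo[) : T_R -> T_R) _ (fun z : T_R * T_R => z.2 - z.1 : T_R)).
    exact: measurable_indic.
  by apply: measurable_funB; [exact: measurable_snd|exact: measurable_fst].
have k01 z : `|k z| <= 1.
  by rewrite /k !indicE -natrM mulnb; case: (_ && _); rewrite ?normr0 ?normr1.
have kC x : (\int[leb]_t (`|k (x, t)|)%:E <= (B - b)%:E)%E.
  apply: (@le_trans _ _ (\int[leb]_t (\1_(`[b, B]) t)%:E)%E).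
    apply: ge0_le_integral => //.
    - apply/measurable_EFinP; apply: measurableT_comp => //.
      exact: measurableT_comp mk _.
    - by apply/measurable_EFinP; exact: measurable_indic.
    move=> t _; rewrite lee_fin /k/= !indicE -natrM mulnb.
    by case: (_ \in _); case: (_ \in _); rewrite /= ?normr0 ?normr1.
  rewrite integral_indic// setIT; by have e := leb_itv b B bB; rewrite le_eqVlt; apply/orP; left; apply/eqP; exact: e.
have mdphi : measurable_fun setT (dphi : T_R -> T_R) by exact: continuous_measurable_fun.
have := Kop_dual m k 1 (B - b) win mk k01 kC integ_win dphi M mdphi dM.
have phiB : continuous phi.
  by move=> x; apply: differentiable_continuous; apply/derivable1_diffP; case: (hphi x).
have FTC c : b <= c -> c <= B -> \int[leb]_t (dphi t * \1_(`[c, B]) t) = phi B - phi c.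
  move=> bc; rewrite le_eqVlt => /orP[/eqP->|cB].
    rewrite subrr /Rintegral (_ : (\int[_]_t _)%E = (\int[leb]_(t in [set B]) (dphi t)%:E)%E).
      by rewrite integral_set1.
    rewrite [RHS]integral_mkcond; apply: eq_integral => t _.
    rewrite patchE indicE set_itv1; case: ifP; rewrite ?mulr1 ?mulr0//.
  rewrite /Rintegral (_ : (\int[_]_t _)%E = (\int[leb]_(t in `[c, B]) (dphi t)%:E)%E); last first.
    rewrite [RHS]integral_mkcond; apply: eq_integral => t _.
    by rewrite patchE indicE; case: ifP; rewrite ?mulr1 ?mulr0.
  rewrite (continuous_FTC2 cB (F := phi)) -?EFinB//.
  - by apply: continuous_subspaceT.
  - split.
    + by move=> x _; case: (hphi x).
    + by apply: cvg_at_right_filter; exact: phiB.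
    + by apply: cvg_at_left_filter; exact: phiB.
  - by move=> x _; rewrite derive1E; case: (hphi x).
have KE t : Kop m k win t = \1_(`[b, B]) t * (p t - p b).
  rewrite /Kop /Rintegral; have [tI|tI] := boolP (t \in `[b, B]%classic); last first.
    rewrite indicE (negbTE tI) mul0r integral0_eq// => x _.
    by rewrite /k/= indicE (negbTE tI) !mul0r.
  rewrite (_ : (\int[_]_x _)%E = (\int[m]_x (\1_(`]b, t]) x)%:E)%E); last first.
    apply: eq_integral => x _; rewrite /k/= /win [X in X * _ * _]indicE tI mul1r.
    rewrite !indicE -natrM mulnb; congr ((nat_of_bool _)%:R%:E).
    move: tI; rewrite inE/= in_itv/= => tI.
    apply/andP/idP; rewrite !inE/= !in_itv/= ?andbT; first by move=> [? ?]; lra.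
    by move=> ?; split; lra.
  move: (tI); rewrite inE/= in_itv/= => /andP[bt tB].
  rewrite integral_indic// setIT indicE tI mul1r.
  exact: (congr1 fine (hm.2 _ _ (lexx b) bt tB)).
under eq_Rintegral do rewrite KE.
have ip : leb.-integrable setT (EFin \o (fun t : T_R => dphi t * (\1_(`[b, B]) t * p t))).
  have [K pK] : exists K, forall t, b <= t <= B -> `|p t| <= K.
    exists (`|p b| + `|p B|) => t /andP[bt tB].
    have := mp b t bt; have := mp t B tB; have := ler_norm (p B); have := ler_norm (- p b).
    by rewrite normrN ler_norml; have := normr_ge0 (p b); have := normr_ge0 (p B); lra.
  apply: (@integ_le _ _ (fun t => M * K * \1_(`[b, B]) t)).
  - apply: measurable_funM => //; apply: measurable_funM; first exact: measurable_indic.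
    exact: continuous_measurable_fun.
  - by apply: integZ; exact: integ_indic.
  move=> t; rewrite indicE; case: (boolP (_ \in _)) => [|_]; last by rewrite mul0r !mulr0 normr0.
  rewrite inE/= in_itv/= => /pK tK; rewrite mul1r mulr1 normrM ler_pM//.
have i1 : leb.-integrable setT (EFin \o (fun t : T_R => dphi t * \1_(`[b, B]) t)).
  under eq_fun do rewrite mulrC.
  apply: (@integ_le _ _ (fun t => M * \1_(`[b, B]) t)).
  - by apply: measurable_funM => //; exact: measurable_indic.
  - by apply: integZ; exact: integ_indic.
  move=> t; rewrite mulrC indicE; case: (boolP (_ \in _)) => _; rewrite ?mulr1 ?mulr0 ?normr0//.
rewrite (_ : \int[leb]_t _ = \int[leb]_t (dphi t * (\1_(`[b, B]) t * p t)) - p b * (phi B - phi b)); last first.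
  rewrite -(FTC b)// -RintZ// -RintB//; last exact: integZ.
  by apply: eq_Rintegral => t _; ring.
move=> e.
have iphi : m.-integrable setT (EFin \o (fun x : T_R => phi x * win x)).
  have [K pK] : exists K, forall t, b <= t <= B -> `|phi t| <= K.
    have [c _ hc] := @EVT_max R (fun t => `|phi t|) b B bB (continuous_subspaceT (fun x => cvg_norm (phiB x))).
    by exists (`|phi c|) => t tI; apply: hc; rewrite in_itv.
  apply: (le_integrable measurableT _ _ (integrableZl measurableT K integ_win)).
    apply/measurable_EFinP; apply: measurable_funM; last exact: measurable_indic.
    exact: continuous_measurable_fun.
  move=> x _; rewrite /= lee_fin /win indicE; case: (boolP (_ \in _)) => [|_]; last by rewrite !mulr0.
  rewrite inE/= in_itv/= !mulr1 => /andP[? ?]; rewrite (le_trans (pK x _)) ?ler_norm//.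
  by apply/andP; split => //; exact: ltW.
have e2 : \int[m]_x (\int[leb]_t (dphi t * k (x, t)) * win x) =
    phi B * (p B - p b) - \int[m]_x (phi x * win x).
  rewrite -window_measure_total -RintegralZl//; last exact: integ_win.
  have i3 : m.-integrable setT (EFin \o (fun x : T_R => phi B * win x)).
    by apply: eq_integrable (integrableZl measurableT (phi B) integ_win).
  rewrite -RintegralB//.
  apply: eq_Rintegral => x _; rewrite -mulrBl /win indicE; case: (boolP (_ \in _)) => [|_]; last by rewrite !mulr0.
  rewrite inE/= in_itv/= !mulr1 => /andP[bx xB]; rewrite -(FTC x)//; last exact: ltW.
  apply: eq_Rintegral => t _; congr (_ * _); rewrite /k/= !indicE -natrM mulnb.
  congr (nat_of_bool _)%:R; apply/andP/idP; rewrite !inE/= !in_itv/= ?andbT; first by move=> [? ?]; lra.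
  by move=> ?; split; lra.
move: e; rewrite e2; lra.
Qed.

End fixed_window.
End window_measure.

Section test_functions.
Context {R : realType}.
Variable phi : R -> R.
Hypothesis hphi : test_function01 phi.

Lemma test_is_derive (x : R) : is_derive x 1 phi (derive1 phi x).
Proof. by have := hphi.1 0%N x => /= h; rewrite derive1E; exact: DeriveDef. Qed.

Lemma test_continuous : continuous phi.
Proof.
by move=> x; apply: differentiable_continuous; apply/derivable1_diffP; exact: (hphi.1 0%N x).
Qed.

Lemma test_derive_continuous : continuous (derive1 phi).
Proof.
by move=> x; apply: differentiable_continuous; apply/derivable1_diffP; exact: (hphi.1 1%N x).
Qed.

Lemma bounded_outside (f : R -> R) (u v : R) : continuous f ->
  (forall x, ~~ (u <= x <= v) -> f x = 0) -> exists M, forall x, `|f x| <= M.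
Proof.
move=> cf f0; have [uv|vu] := leP u v; last first.
  by exists 0 => x; rewrite f0 ?normr0//; apply/negP => /andP[? ?]; lra.
have [c _ hc] := @EVT_max R (fun t => `|f t|) u v uv (continuous_subspaceT (fun x => cvg_norm (cf x))).
exists `|f c| => x; have [xI|/f0 ->] := boolP (u <= x <= v); last by rewrite normr0.
by apply: hc; rewrite in_itv.
Qed.

Lemma test_bounded : exists M, forall x, `|phi x| <= M.
Proof.
have [_ [u [v [_ _ p0]]]] := hphi.
exact: bounded_outside test_continuous p0.
Qed.

Lemma test_derive_bounded : exists M, forall x, `|derive1 phi x| <= M.
Proof.
have [_ [u [v [_ _ p0]]]] := hphi.
apply: (bounded_outside _ u v test_derive_continuous) => x xI.
suff h : \near x, phi x = cst 0 x by rewrite derive1E (near_eq_derive _ h) derive_cst.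
have [xu|ux] := ltP x u.
  near=> y; rewrite /= p0//; apply/negP => /andP[h _].
  have : y <= (x + u) / 2 by near: y; apply: near_le_cst; lra.
  by lra.
have vx : v < x by rewrite ltNge; apply: contra xI => ->; rewrite ux.
near=> y; rewrite /= p0//; apply/negP => /andP[_ h].
have : (x + v) / 2 <= y by near: y; apply: near_ge_cst; lra.
by lra.
Unshelve. all: by end_near.
Qed.

End test_functions.

(** * The derivative measure of a difference of monotone functions *)

Section mono_diff_charge.
Context {R : realType}.
Notation leb := (@lebesgue_measure R).
Notation T_R := (measurableTypeR R).
Variables (xi : R) (F : R -> R) (b B : R).
Hypotheses (xi_gt0 : 0 < xi) (b_ge : xi / 2 <= b) (bB : b <= B) (B_le : B <= 1 - xi / 2).
Hypotheses (hF : mono_diff F) (Fb : F b = 0) (FB : F B = 0).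

Definition shift_density y := xi^-1 * (F (clamp b B (y + xi / 2)) - F (clamp b B (y - xi / 2))).

Let b_gt0 : 0 < b. Proof. by apply: lt_le_trans b_ge; rewrite divr_gt0. Qed.
Let B_lt1 : B < 1. Proof. by apply: (le_lt_trans B_le); rewrite gtrBl divr_gt0. Qed.

Let cl01 x : xi / 2 <= clamp b B x <= 1 - xi / 2.
Proof. by have /andP[? ?] := clampP b B x bB; have h1 := b_ge; have h2 := B_le; apply/andP; split; lra. Qed.

Let mcl : measurable_fun setT (clamp b B : T_R -> T_R).
Proof. by apply: continuous_measurable_fun; exact: continuous_clamp. Qed.

Let win_out x : ~ I01 x -> win b B x = 0.
Proof.
move=> Ix; rewrite /win indicE memNset//= in_itv/= => xI; apply: Ix.
by rewrite /I01/= in_itv/=; have h1 := b_gt0; have h2 := B_lt1; lra.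
Qed.

Section one_window.
Variables (p : R -> R) (m : {finite_measure set T_R -> \bar R}).
Hypotheses (cp : continuous p) (mp : forall x y, x <= y -> p x <= p y).
Hypothesis hm : window_measure p b B m.

(** The clamp fixes the window, so m is its own transfer by the clamp. As the clamp takes values at
    distance xi / 2 from the boundary, convolution with m becomes an instance of the noise operator
    without reflection. *)
Lemma window_ext0 (X : set T_R) : measurable X ->
  ext0 m X = ext0 (transfer (clamp b B) m) X.
Proof.
move=> mX; have mX' : measurable (X `&` I01 : set T_R).
  by apply: measurableI => //; exact: measurable_I01.
rewrite /ext0 /transfer (hm.1 _ mX') [RHS]hm.1; last first.
  apply: measurableI; first exact: measurable_I01.
  by rewrite -[X in measurable X]setTI; exact: mcl.
congr (m _); apply/seteqP; split => x [] /=.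
  move=> [Xx Ix] /[dup] xw; rewrite in_itv/= => xI; split => //; split => //.
  by rewrite clamp_id//; move: xI => /andP[? ?]; apply/andP; split; lra.
move=> [Ix]; move=> + /[dup] xw; rewrite in_itv/= => + xI.
by rewrite clamp_id; [|move: xI => /andP[? ?]; apply/andP; split; lra].
Qed.

Lemma window_section (A : set T_R) t : measurable A ->
  ((rho_unif xi t)%:E * ext0 m ((fun x => x + t)%R @^-1` (fold01 @^-1` A)))%E =
  (Kop m (fold_kernel xi (clamp b B) A) (win b B) t)%:E.
Proof.
move=> mA; rewrite window_ext0; last first.
  have h : measurable_fun setT (fun x : T_R => fold01 (x + t) : T_R).
    by apply: (measurableT_comp measurable_fold01); exact: measurable_funD.
  by rewrite -[X in measurable X]setTI; exact: h.
apply: noise_sectionE => //.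
- by move=> x _; have /andP[? ?] := cl01 x; have := xi_gt0; move=> ?; apply/andP; split; lra.
- exact: integ_win.
- by move=> C mC; exact: (window_measureE p b B m hm C mC).
Qed.

Lemma window_section_integrable (A : set T_R) : measurable A ->
  leb.-integrable setT (EFin \o Kop m (fold_kernel xi (clamp b B) A) (win b B)).
Proof.
move=> mA.
have mk : measurable_fun setT (fold_kernel xi (clamp b B) A) by apply: measurable_fold_kernel.
have kC x : (\int[leb]_t (`|fold_kernel xi (clamp b B) A (x, t)|)%:E <= 1%:E)%E.
  by apply: fold_kernel_mass.
exact: (Kop_integrable m _ xi^-1 1 _ mk (fold_kernel_le xi xi_gt0 _ A) kC (integ_win _ _ m)).
Qed.

Lemma window_density : is_density (reflconv (rho_unif xi) m)
  (fun y => xi^-1 * (p (clamp b B (y + xi / 2)) - p (clamp b B (y - xi / 2)))).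
Proof.
have [h1 h2] : is_density (Lnoise xi (clamp b B) m) (Kop m (nbump xi (clamp b B)) (win b B)).
  apply: Lnoise_density => //.
  - by move=> x _; have /andP[? ?] := cl01 x; have := xi_gt0; move=> ?; apply/andP; split; lra.
  - exact: integ_win.
  - by move=> C mC; exact: (window_measureE p b B m hm C mC).
rewrite (_ : (fun y => _) = Kop m (nbump xi (clamp b B)) (win b B)); last first.
  by apply/funext => y; rewrite (Kop_window p).
split => // A mA; rewrite -h2//; apply: eq_integral => t _; congr (_ * _)%E.
apply: window_ext0.
have h : measurable_fun setT (fun x : T_R => fold01 (x + t) : T_R).
  by apply: (measurableT_comp measurable_fold01); exact: measurable_funD.
by rewrite -[X in measurable X]setTI; exact: h.
Qed.

Lemma window_density_integral :
  integ (fun y => xi^-1 * (p (clamp b B (y + xi / 2)) - p (clamp b B (y - xi / 2)))) /\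
  \int[leb]_y (xi^-1 * (p (clamp b B (y + xi / 2)) - p (clamp b B (y - xi / 2)))) = p B - p b.
Proof.
have KE : (fun y => xi^-1 * (p (clamp b B (y + xi / 2)) - p (clamp b B (y - xi / 2)))) =
    Kop m (nbump xi (clamp b B)) (win b B).
  by apply/funext => y; rewrite (Kop_window p).
have mk : measurable_fun setT (nbump xi (clamp b B)) by apply: measurable_nbump.
have kM := nbump_le xi xi_gt0 (clamp b B).
have kC x : (\int[leb]_y (`|nbump xi (clamp b B) (x, y)|)%:E <= 1%:E)%E by rewrite nbump_mass.
have iw := integ_win b B m.
rewrite KE; split; first exact: (Kop_integrable m _ xi^-1 1 _ mk kM kC iw).
have := Kop_dual m _ xi^-1 1 _ mk kM kC iw (cst 1) 1 (measurable_cst _)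
  (fun _ => eq_ler _ _ (normr1 _)).
rewrite -(window_measure_total p b B bB m hm).
under eq_Rintegral do rewrite mul1r.
move=> ->; apply: eq_Rintegral => x _.
under eq_Rintegral do rewrite mul1r.
by rewrite Rint_bump// mul1r.
Qed.

Lemma window_integral (phi : R -> R) : test_function01 phi ->
  m.-integrable setT (EFin \o phi) /\
  (\int[m]_x (phi x)%:E = (phi B * p B - phi b * p b -
    \int[leb]_t (derive1 phi t * (\1_(`[b, B]) t * p t)))%:E)%E.
Proof.
move=> hphi; have [M pM] := test_bounded phi hphi.
have [M' dM] := test_derive_bounded phi hphi.
have iphi : m.-integrable setT (EFin \o phi).
  apply: measurable_bounded_integrable => //.
  - by rewrite ltey_eq fin_num_measure.
  - by apply: continuous_measurable_fun; exact: test_continuous.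
  - by exists M; split; [exact: num_real|move=> x Mx y _; exact: le_trans (pM y) (ltW Mx)].
split=> //.
rewrite -(window_parts p b B bB cp mp m hm phi (derive1 phi) M' (test_is_derive phi hphi)
  (test_derive_continuous phi hphi) dM).
have mN : measurable (~` `]b, B]%classic : set T_R) by apply: measurableC; exact: measurable_itv.
have N0 : m (~` `]b, B]%classic) = 0%E by rewrite hm.1// setICl measure0.
rewrite (negligible_integral mN measurableT iphi N0) setTD setCK.
rewrite integral_mkcond /Rintegral fineK; last first.
  apply: integrable_fin_num => //; under eq_fun do rewrite mulrC.
  apply: (integrable_bounded_mul m (win b B) phi 1) => //; first exact: measurable_indic.
  by move=> x; rewrite /win indicE; case: (_ \in _); rewrite ?normr0 ?normr1.
by apply: eq_integral => x _; rewrite patchE /win indicE; case: ifP; rewrite ?mulr1 ?mulr0.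
Qed.

End one_window.

(** The charge is the difference of the window measures of the two monotone parts. As F vanishes at
    both ends of the window, the boundary terms cancel and the smoothed density has integral 0. *)
Lemma mono_diff_charge_exists : exists nu : {charge set T_R -> \bar R},
  [/\ (forall A : set T_R, measurable A -> nu (A `&` `]0, 1[) = nu A),
      (forall (P N : set T_R) (nuPN : hahn_decomposition nu P N) (phi : R -> R),
        test_function01 phi ->
        (\int[jordan_pos nuPN]_x (phi x)%:E - \int[jordan_neg nuPN]_x (phi x)%:E
         = (- \int[leb]_t (derive1 phi t * (\1_(`[b, B]) t * F t)))%:E)%E),
      is_density (reflconv (rho_unif xi) nu) shift_density &
      integ shift_density /\ \int[leb]_y shift_density y = 0].
Proof.
have [p [q [[cp mp _ _] [cq mq _ _] FE]]] := hF.
have [m1 h1] := window_measure_exists p b B bB cp mp.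
have [m2 h2] := window_measure_exists q b B bB cq mq.
pose nu : {charge set T_R -> \bar R} :=
  cadd (charge_of_finite_measure m1) (cscale (-1) (charge_of_finite_measure m2)).
have nuE A : nu A = (m1 A - m2 A)%E.
  by rewrite /nu/= /cadd/= /cscale/= /charge_of_finite_measure EFinN mulN1e.
exists nu; split.
- move=> A mA; rewrite !nuE; congr (_ - _)%E.
    rewrite (h1.1 A)// h1.1; last by apply: measurableI => //; exact: measurable_itv.
    congr (m1 _); rewrite -setIA; congr (_ `&` _); rewrite setIidr// => x /=.
    by rewrite !in_itv/=; have := b_gt0; have := B_lt1; lra.
  rewrite (h2.1 A)// h2.1; last by apply: measurableI => //; exact: measurable_itv.
  congr (m2 _); rewrite -setIA; congr (_ `&` _); rewrite setIidr// => x /=.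
  by rewrite !in_itv/=; have := b_gt0; have := B_lt1; lra.
- move=> P N nuPN phi hphi; have [M pM] := test_bounded phi hphi.
  have [M' dM] := test_derive_bounded phi hphi.
  have mphi : measurable_fun setT (phi : T_R -> R).
    by apply: continuous_measurable_fun; exact: test_continuous.
  have bphi (m : {finite_measure set T_R -> \bar R}) : m.-integrable setT (EFin \o phi).
    apply: measurable_bounded_integrable => //.
    + by rewrite ltey_eq fin_num_measure.
    + by exists M; split; [exact: num_real|move=> x Mx y _; exact: le_trans (pM y) (ltW Mx)].
  have [i1 e1] := window_integral p m1 cp mp h1 phi hphi.
  have [i2 e2] := window_integral q m2 cq mq h2 phi hphi.
  have ijp := bphi (jordan_pos nuPN); have ijn := bphi (jordan_neg nuPN).
  (* The Jordan parts of nu need not be m1 and m2; adding crosswise gives an equality between sums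
     of positive measures, against which phi is integrated. *)
  have key : (\int[jordan_pos nuPN]_x (phi x)%:E + \int[m2]_x (phi x)%:E =
      \int[jordan_neg nuPN]_x (phi x)%:E + \int[m1]_x (phi x)%:E)%E.
    rewrite -!integral_measure_add//.
    apply: eq_measure_integral => A mA _.
    transitivity (jordan_pos nuPN A + m2 A)%E; first exact: measure_addE.
    transitivity (jordan_neg nuPN A + m1 A)%E; last exact/esym/measure_addE.
    have e0 : (m1 A - m2 A = jordan_pos nuPN A - jordan_neg nuPN A)%E.
      by rewrite -nuE (jordan_decomp nuPN mA)/= /cadd/= /cscale/= EFinN mulN1e.
    have k1 : m1 A \is a fin_num by exact: fin_num_measure.
    have k2 : m2 A \is a fin_num by exact: fin_num_measure.
    have k3 : jordan_pos nuPN A \is a fin_num by exact: fin_num_measure.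
    have k4 : jordan_neg nuPN A \is a fin_num by exact: fin_num_measure.
    move: e0; rewrite -(fineK k1) -(fineK k2) -(fineK k3) -(fineK k4) -!EFinB -!EFinD => -[e0].
    by congr EFin; lra.
  have f1 := integrable_fin_num measurableT ijp; have f2 := integrable_fin_num measurableT ijn.
  move: key f1 f2; rewrite /= e1 e2.
  case: (\int[jordan_pos nuPN]_x (phi x)%:E)%E => // r1.
  case: (\int[jordan_neg nuPN]_x (phi x)%:E)%E => // r2 [key] _ _; congr EFin.
  have ii (p' : R -> R) : continuous p' -> integ (fun t => derive1 phi t * (\1_(`[b, B]) t * p' t)).
    move=> cp'; have [c _ hc] := @EVT_max R (fun t => `|p' t|) b B bB
      (continuous_subspaceT (fun x => cvg_norm (cp' x))).
    apply: (@integ_le _ _ (fun t => M' * (`|p' c| * \1_(`[b, B]) t))).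
    + apply: measurable_funM; first by apply: continuous_measurable_fun; exact: test_derive_continuous.
      apply: measurable_funM; first exact: measurable_indic.
      exact: continuous_measurable_fun.
    + by apply: integZ; apply: integZ; exact: integ_indic.
    move=> t; rewrite normrM ler_pM//.
    have [tI|tI] := boolP (t \in `[b, B]%classic); rewrite !indicE.
      by rewrite tI mul1r mulr1; apply: hc; move: tI; rewrite inE.
    by rewrite (negbTE tI) mul0r mulr0 normr0.
  have -> : \int[leb]_t (derive1 phi t * (\1_(`[b, B]) t * F t)) =
      \int[leb]_t (derive1 phi t * (\1_(`[b, B]) t * p t)) -
      \int[leb]_t (derive1 phi t * (\1_(`[b, B]) t * q t)).
    by rewrite -RintB//; [apply: eq_Rintegral => t _; rewrite FE; ring|exact: ii|exact: ii].
  have pqb : p b = q b by have := FE b; rewrite Fb; lra.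
  have pqB : p B = q B by have := FE B; rewrite FB; lra.
  move: key; rewrite pqb pqB; lra.
- have [d1 g1] := window_density p m1 cp mp h1.
  have [d2 g2] := window_density q m2 cq mq h2.
  have sE : shift_density = (fun y =>
      xi^-1 * (p (clamp b B (y + xi / 2)) - p (clamp b B (y - xi / 2))) -
      xi^-1 * (q (clamp b B (y + xi / 2)) - q (clamp b B (y - xi / 2)))).
    by apply/funext => y; rewrite /shift_density !FE; ring.
  have dd : L1 shift_density.
    by rewrite sE; apply: eq_integrable (integrableB measurable_I01 d1 d2); [exact: measurable_I01|].
  split => // A mA.
  have -> : meas shift_density A =
      (reflconv (rho_unif xi) m1 A - reflconv (rho_unif xi) m2 A)%E.
    have mAI : measurable (A `&` I01 : set T_R) by apply: measurableI => //; exact: measurable_I01.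
    rewrite g1// g2// /meas -integralB//.
    + by rewrite sE; apply: eq_integral => x _.
    + by apply: integrableS d1 => //; exact: measurable_I01.
    + by apply: integrableS d2 => //; exact: measurable_I01.
  rewrite /reflconv /convolution -integralB//; last 2 first.
  + apply: eq_integrable (window_section_integrable m1 A mA) => // t _.
    by rewrite (window_section p m1 h1).
  + apply: eq_integrable (window_section_integrable m2 A mA) => // t _.
    by rewrite (window_section q m2 h2).
  apply: eq_integral => t _; rewrite /ext0 nuE muleBr//.
  have mX : measurable ((fun x => x + t) @^-1` (fold01 @^-1` A) `&` I01 : set T_R).
    apply: measurableI; last exact: measurable_I01.
    have h : measurable_fun setT (fun x : T_R => fold01 (x + t) : T_R).
      by apply: (measurableT_comp measurable_fold01); exact: measurable_funD.
    by rewrite -[X in measurable X]setTI; exact: h.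
  by apply: fin_num_adde_defr; exact: fin_num_measure.
- have [d1 g1] := window_density_integral p m1 cp mp h1.
  have [d2 g2] := window_density_integral q m2 cq mq h2.
  have sE : shift_density = (fun y =>
      xi^-1 * (p (clamp b B (y + xi / 2)) - p (clamp b B (y - xi / 2))) -
      xi^-1 * (q (clamp b B (y + xi / 2)) - q (clamp b B (y - xi / 2)))).
    by apply/funext => y; rewrite /shift_density !FE; ring.
  rewrite sE; split; first exact: integB.
  rewrite RintB// g1 g2.
  have := FE b; have := FE B; rewrite Fb FB; lra.
Qed.

End mono_diff_charge.

(** * The density of the transferred measure *)

Section branch_inverses.
Context {R : realType}.
Implicit Types v w x : R.
Notation m := (Tmax : R).

Lemma vmax_gt : -1 < vmax :> R.
Proof.
have [h _] := @vmaxE R; have := @cbrt75_bounds R; rewrite -h; lra.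
Qed.

Lemma qleft_vmax : qleft vmax = m.
Proof. by rewrite /Tmax TmapE_left// TleftE. Qed.

(** This places every level in [0, Tmax[ strictly between the values at the ends of [-1, vmax], so
    the left inverse is differentiable there. *)
Lemma qleftN1_lt0 : qleft (-1) < 0 :> R.
Proof.
rewrite /qleft; have := @Ta_bounds R; have := @Tb_bounds R.
have h : 1 + 7 / 8 <= expR (- (8^-1 + (-1) ^+ 3)) :> R.
  apply: le_trans (expR_ge1Dx _); rewrite exprS expr2; lra.
move: (expR _) h => e h hb ha.
have : (Ta - 1) * e <= (Ta - 1) * (1 + 7 / 8) by rewrite ler_wnM2l//; lra.
lra.
Qed.

Lemma branch_inverse_left : exists V : R -> R,
  [/\ continuous V, (forall w w', w <= w' -> V w <= V w'),
    (forall w, -1 <= V w <= vmax), (forall w, qleft (V w) = clamp (qleft (-1)) m w) &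
    (forall v, -1 <= v <= vmax -> V (qleft v) = v)].
Proof.
have [V hV] := clamped_inverse qleft (-1) vmax vmax_gt (continuous_subspaceT continuous_qleft) qleft_lt.
by exists V; rewrite -qleft_vmax.
Qed.

(** The sign turns the branch into an increasing function. The end point 3 lies well beyond 1, so
    levels below Tright 3 are met by the right branch only outside [0, 1]. *)
Lemma branch_inverse_right : exists H : R -> R,
  [/\ continuous H, (forall w w', w <= w' -> H w <= H w'),
    (forall w, 3 / 10 <= H w <= 3), (forall w, - Tright (H w) = clamp (- m) (- Tright 3) w) &
    (forall x, 3 / 10 <= x <= 3 -> H (- Tright x) = x)].
Proof.
have cN : continuous (fun x : R => - Tright x).
  by move=> x; apply: cvgN; exact: continuous_Tright.
have h33 : 3 / 10 < 3 :> R by lra.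
have inc (x y : R) : 3 / 10 <= x -> x < y -> y <= 3 -> - Tright x < - Tright y.
  by move=> x3 xy _; rewrite ltrN2 Tright_lt.
have [H hH] := clamped_inverse (fun x => - Tright x) (3 / 10 : R) 3 h33 (continuous_subspaceT cN) inc.
by exists H; rewrite /Tmax TmapE_right.
Qed.

Variables V H : R -> R.
Hypotheses (cV : continuous V) (leV : forall w w', w <= w' -> V w <= V w')
  (V_in : forall w, -1 <= V w <= vmax) (qV : forall w, qleft (V w) = clamp (qleft (-1)) m w)
  (Vq : forall v, -1 <= v <= vmax -> V (qleft v) = v).
Hypotheses (cH : continuous H) (leH : forall w w', w <= w' -> H w <= H w')
  (H_in : forall w, 3 / 10 <= H w <= 3)
  (TH : forall w, - Tright (H w) = clamp (- m) (- Tright 3) w)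
  (HT : forall x, 3 / 10 <= x <= 3 -> H (- Tright x) = x).

(** Return to x = 1/8 + v^3. The inverse is differentiable also at the level of 1/8, where its
    derivative is 0. *)
Definition inv_left w := 8^-1 + V w ^+ 3.
Definition inv_right w := H (- w).

Lemma inv_left_le w w' : w <= w' -> inv_left w <= inv_left w'.
Proof. by move=> ww'; rewrite /inv_left lerD2l ler_cube leV. Qed.

Lemma inv_right_le w w' : w <= w' -> inv_right w' <= inv_right w.
Proof. by move=> ww'; rewrite /inv_right leH// lerN2. Qed.

Lemma inv_left_le3 w : inv_left w <= 3 / 10.
Proof.
have /andP[_ h] := V_in w; rewrite /inv_left.
have : V w ^+ 3 <= vmax ^+ 3 by rewrite ler_cube.
rewrite [vmax ^+ 3]cbrtK; lra.
Qed.

Lemma inv_right_ge3 w : 3 / 10 <= inv_right w.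
Proof. by have /andP[] := H_in (- w). Qed.

Lemma continuous_inv_left : continuous inv_left.
Proof.
move=> x; apply: cvgD; first exact: cvg_cst.
by rewrite exprS expr2; apply: cvgM; [exact: cV|apply: cvgM; exact: cV].
Qed.

Lemma continuous_inv_right : continuous inv_right.
Proof.
move=> x; apply: (continuous_comp (f := fun x : R => - x) (g := H)); last exact: cH.
exact: opp_continuous.
Qed.

Lemma Tright3_lt_m : Tright 3 < m.
Proof. by rewrite /Tmax TmapE_right// Tright_lt//; lra. Qed.

Lemma left_mem x : 0 <= x -> x <= 3 / 10 -> -1 <= cbrt (x - 8^-1) <= vmax.
Proof.
move=> x0 x3; apply/andP; split; last by rewrite /vmax ler_cbrt; lra.
by rewrite -ler_cube cbrtK !exprS expr0; lra.
Qed.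

Lemma inv_left_T x : 0 <= x -> x <= 3 / 10 -> inv_left (Tmap x) = x.
Proof.
move=> x0 x3; rewrite /inv_left TmapE_left// TleftE Vq; last exact: left_mem.
by rewrite cbrtK; lra.
Qed.

Lemma inv_right_T x : 3 / 10 <= x -> x <= 3 -> inv_right (Tmap x) = x.
Proof. by move=> x0 x3; rewrite /inv_right TmapE_right// HT// x0 x3. Qed.

Lemma T_level x : 0 <= x <= 1 -> x = inv_left (Tmap x) \/ x = inv_right (Tmap x).
Proof.
move=> /andP[x0 x1]; have [x3|/ltW x3] := leP x (3 / 10).
  by left; rewrite inv_left_T.
by right; rewrite inv_right_T//; lra.
Qed.

Lemma inv_left_hi w : m <= w -> inv_left w = 3 / 10.
Proof.
move=> mw; apply/le_anti; rewrite inv_left_le3/=.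
have <- : inv_left m = 3 / 10 by rewrite -[RHS]inv_left_T//; lra.
exact: inv_left_le.
Qed.

Lemma inv_right_hi w : m <= w -> inv_right w = 3 / 10.
Proof.
move=> mw; apply/le_anti; rewrite inv_right_ge3 andbT.
have <- : inv_right m = 3 / 10 by rewrite -[RHS]inv_right_T//; lra.
exact: inv_right_le.
Qed.

Lemma T_sublevel x w : 0 <= x <= 1 ->
  (Tmap x <= w) = (x <= inv_left w) || (inv_right w <= x).
Proof.
move=> x01; have /andP[x0 x1] := x01; apply/idP/idP.
  move=> Tw; case: (T_level x x01) => [{1}->|{2}->].
    by rewrite inv_left_le.
  by rewrite inv_right_le ?orbT.
have Tm : Tmap x <= m by exact: T_le_Tmax.
have [mw _|wm] := leP m w; first exact: le_trans Tm mw.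
case/orP => h.
  have x3 : x <= 3 / 10 by exact: le_trans h (inv_left_le3 w).
  have := left_mem x x0 x3; set v := cbrt _ => vI.
  have vV : v <= V w.
    rewrite -ler_cube cbrtK; move: h; rewrite /inv_left; lra.
  rewrite TmapE_left// TleftE -/v.
  have v1 : -1 < v by rewrite -ltr_cube cbrtK !exprS expr0; lra.
  have qv : qleft v <= qleft (V w).
    move: vV; rewrite le_eqVlt => /orP[/eqP->//|vV]; apply/ltW/qleft_lt => //; first exact: ltW.
    by have /andP[] := V_in w.
  apply: le_trans qv _; rewrite qV.
  have [qw|wq] := leP (qleft (-1)) w; first by rewrite clamp_id// qw ltW.
  have /andP[_ Vm] := V_in w.
  have : qleft (-1) < qleft (V w) by apply: qleft_lt => //; exact: lt_le_trans vV.
  by rewrite qV clamp_lo ?ltxx ?(ltW wq)// -qleft_vmax ltW// qleft_lt// vmax_gt.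
have x3 : 3 / 10 <= x by exact: le_trans (inv_right_ge3 w) h.
rewrite TmapE_right//; apply: (le_trans (Tright_le _ _ (inv_right_ge3 w) h)).
rewrite -lerN2 TH; have T3m := Tright3_lt_m.
have [Tw|wT] := leP (Tright 3) w; first by rewrite clamp_id// !lerN2 Tw ltW.
have : inv_right w < 3 by apply: le_lt_trans h _; lra.
move=> /(Tright_lt _ _ (inv_right_ge3 w)); rewrite -ltrN2 TH clamp_hi ?ltxx//.
  by rewrite lerN2 ltW.
by rewrite lerN2 ltW.
Qed.

Lemma V_inner w : qleft (-1) < w -> w < m -> -1 < V w /\ V w < vmax.
Proof.
move=> qw wm; have /andP[V1 Vm] := V_in w.
have e : qleft (V w) = w by rewrite qV clamp_id// !ltW.
rewrite !lt_neqAle V1 Vm !andbT; split; apply/eqP => h.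
  by move: qw; rewrite h e ltxx.
by move: wm; rewrite -qleft_vmax -h e ltxx.
Qed.

Lemma is_derive_V w : qleft (-1) < w -> w < m -> is_derive w 1 V (dqleft (V w))^-1.
Proof.
move=> qw wm; have [V1 Vm] := V_inner w qw wm.
have e : qleft (V w) = w by rewrite qV clamp_id// !ltW.
suff h : is_derive (qleft (V w)) 1 V (dqleft (V w))^-1 by rewrite e in h.
apply: (@is_derive_inverse R qleft V (dqleft (V w)) (V w)).
- near=> z; apply: Vq.
  have : -1 <= z by near: z; exact: near_ge_cst.
  by move=> ->/=; near: z; exact: near_le_cst.
- near=> z; exact: continuous_qleft.
- exact: is_derive_qleft.
- by rewrite gt_eqF// dqleft_gt0// ltW.
Unshelve. all: by end_near.
Qed.

Lemma is_derive_inv_left w : qleft (-1) < w -> w < m ->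
  is_derive w 1 inv_left (3 * V w ^+ 2 / dqleft (V w)).
Proof.
move=> qw wm; have h := is_derive_V w qw wm.
rewrite /inv_left; move: (8^-1 : R) => k.
by apply: is_derive_eq; rewrite /GRing.scale/=; ring.
Qed.

Lemma H_inner w : Tright 3 < w -> w < m -> 3 / 10 < inv_right w /\ inv_right w < 3.
Proof.
move=> Tw wm; have /andP[H1 H3] := H_in (- w).
have e : Tright (H (- w)) = w by apply: oppr_inj; rewrite TH clamp_id// !lerN2 !ltW.
rewrite !lt_neqAle H1 H3 !andbT; split; apply/eqP => h.
  by move: wm; rewrite /Tmax TmapE_right// h e ltxx.
by move: Tw; rewrite -[in Tright _]h e ltxx.
Qed.

Lemma Tright_inv w : Tright 3 <= w -> w <= m -> Tright (inv_right w) = w.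
Proof. by move=> Tw wm; apply: oppr_inj; rewrite TH clamp_id// !lerN2 Tw wm. Qed.

Lemma is_derive_inv_right w : Tright 3 < w -> w < m ->
  is_derive w 1 inv_right (dTright (inv_right w))^-1.
Proof.
move=> Tw wm; have [H1 H3] := H_inner w Tw wm.
have e : Tright (H (- w)) = w by apply: Tright_inv; exact: ltW.
suff h : is_derive (Tright (inv_right w)) 1 inv_right (dTright (inv_right w))^-1.
  by rewrite /inv_right e in h.
apply: (@is_derive_inverse R Tright inv_right (dTright (inv_right w)) (inv_right w)).
- near=> z; rewrite /inv_right; apply: HT.
  have : 3 / 10 <= z by near: z; exact: near_ge_cst.
  by move=> ->/=; near: z; exact: near_le_cst.
- near=> z; exact: continuous_Tright.
- by apply: is_derive_Tright; rewrite gt_eqF//; lra.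
- by rewrite lt_eqF// dTright_lt0.
Unshelve. all: by end_near.
Qed.

End branch_inverses.

(** The interface used for the distribution function: V inverts the left branch in the cube root
    coordinate, h1 and h2 invert the left and the right branch. *)
Record inverse_branches {R : realType} (V h1 h2 : R -> R) : Prop := InverseBranches {
  ib_cV : continuous V;
  ib_ch1 : continuous h1;
  ib_ch2 : continuous h2;
  ib_V_le : forall w w', w <= w' -> V w <= V w';
  ib_h1_le : forall w w', w <= w' -> h1 w <= h1 w';
  ib_h2_le : forall w w', w <= w' -> h2 w' <= h2 w;
  ib_V_ge : forall w, -1 <= V w;
  ib_h13 : forall w, h1 w <= 3 / 10;
  ib_h23 : forall w, 3 / 10 <= h2 w <= 3;
  ib_h1_hi : forall w, Tmax <= w -> h1 w = 3 / 10;
  ib_h2_hi : forall w, Tmax <= w -> h2 w = 3 / 10;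
  ib_h2_T : forall x, 3 / 10 <= x <= 3 -> h2 (Tright x) = x;
  ib_sublevel : forall x w, 0 <= x <= 1 -> (Tmap x <= w) = (x <= h1 w) || (h2 w <= x);
  ib_level : forall x, 0 <= x <= 1 -> x = h1 (Tmap x) \/ x = h2 (Tmap x);
  ib_V_lt : forall w, 0 <= w -> w < Tmax -> V w < vmax;
  ib_h2_gt : forall w, Tright 3 < w -> w < Tmax -> 3 / 10 < h2 w;
  ib_T_h2 : forall w, Tright 3 <= w -> w <= Tmax -> Tright (h2 w) = w;
  ib_dh1 : forall w : R, 0 <= w -> w < Tmax -> is_derive w 1 h1 (3 * V w ^+ 2 / dqleft (V w));
  ib_dh2 : forall w : R, Tright 3 < w -> w < Tmax -> is_derive w 1 h2 (dTright (h2 w))^-1 }.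

Lemma inverse_branches_exist {R : realType} :
  exists V h1 h2 : R -> R, inverse_branches V h1 h2.
Proof.
have [V [cV leV VI qV Vq]] := @branch_inverse_left R.
have [H [cH leH HI TH HT]] := @branch_inverse_right R.
exists V, (inv_left V), (inv_right H); have q0 := @qleftN1_lt0 R; split.
- exact: cV.
- exact: continuous_inv_left.
- exact: continuous_inv_right.
- exact: leV.
- by move=> w w' ww'; exact: inv_left_le.
- by move=> w w' ww'; exact: inv_right_le.
- by move=> w; have /andP[] := VI w.
- by move=> w; exact: inv_left_le3.
- by move=> w; exact: HI.
- by move=> w wm; exact: inv_left_hi.
- by move=> w wm; exact: inv_right_hi.
- by move=> x x3; rewrite /inv_right HT.
- by move=> x w x01; exact: T_sublevel.
- by move=> x x01; exact: T_level.
- by move=> w w0 wm; have [] := V_inner V VI qV w (lt_le_trans q0 w0) wm.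
- by move=> w Tw wm; have [] := H_inner H HI TH w Tw wm.
- by move=> w Tw wm; exact: Tright_inv.
- by move=> w w0 wm; apply: is_derive_inv_left => //; exact: lt_le_trans w0.
- by move=> w Tw wm; exact: is_derive_inv_right.
Qed.

Section probability_on_I01.
Context {R : realType}.
Notation leb := (@lebesgue_measure R).
Notation T_R := (measurableTypeR R).
Variable mu : probability T_R R.
Hypothesis muI : mu I01 = 1%E.

Definition mass (A : set T_R) : R := fine (mu A).

Lemma mu_fin (A : set T_R) : measurable A -> mu A \is a fin_num.
Proof. by move=> mA; exact: fin_num_measure. Qed.

Lemma massE (A : set T_R) : measurable A -> mu A = (mass A)%:E.
Proof. by move=> mA; rewrite /mass fineK// mu_fin. Qed.

Lemma mu_outside : mu (~` I01) = 0%E.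
Proof. by rewrite probability_setC ?muI ?subee//; exact: measurable_I01. Qed.

Lemma mu_I01 (A : set T_R) : measurable A -> mu A = mu (A `&` I01).
Proof.
move=> mA; have mI : measurable (I01 : set T_R) := measurable_I01.
have mC : measurable (~` I01 : set T_R) by exact: measurableC.
rewrite -[in LHS](setIT A) -(setUv I01) setIUr measureU//; last 3 first.
- exact: measurableI.
- exact: measurableI.
- by rewrite setIACA setICr setI0.
rewrite [X in (_ + X)%E](_ : _ = 0%E) ?adde0//.
apply/eqP; rewrite -measure_le0 -mu_outside; apply: le_measure; rewrite ?inE//.
exact: measurableI.
Qed.

Lemma mu_windowE (A : set T_R) : measurable A ->
  mu A = (\int[mu]_(x in A) (\1_I01 x)%:E)%E.
Proof.
move=> mA; rewrite integral_indic//; last exact: measurable_I01.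
by rewrite setIC; exact: mu_I01.
Qed.

Lemma mu_window_integrable : mu.-integrable setT (EFin \o (\1_I01 : T_R -> R)).
Proof. by apply: integrable_indic; exact: measurable_I01. Qed.

Lemma mass_le (A B : set T_R) : measurable A -> measurable B -> A `<=` B -> mass A <= mass B.
Proof.
by move=> mA mB AB; rewrite /mass fine_le ?mu_fin// le_measure// inE.
Qed.

Lemma massU (A B : set T_R) : measurable A -> measurable B -> A `&` B = set0 ->
  mass (A `|` B) = mass A + mass B.
Proof. by move=> mA mB AB; rewrite /mass measureU// fineD// mu_fin. Qed.

Lemma mass_ge0 A : 0 <= mass A.
Proof. by rewrite /mass fine_ge0. Qed.

Lemma mass_I01 : mass I01 = 1.
Proof. by rewrite /mass muI. Qed.

(** By [Lnoise_null] the noise sends mu to a measure vanishing on null sets, and mu is its own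
    image; then Radon-Nikodym. *)
Lemma stationary_has_density (xi : R) (tau : T_R -> T_R) : 0 < xi -> xi <= 2 ->
  measurable_fun setT tau -> (forall x, I01 x -> 0 <= (tau x : R) <= 1) ->
  (forall A : set T_R, measurable A -> Lnoise xi tau mu A = mu A) -> has_density mu.
Proof.
move=> xi0 xi2 mtau tau01 st.
have dom : mu `<< leb.
  apply/null_content_dominatesP => A mA A0; rewrite -st//.
  apply: (Lnoise_null xi xi0 tau mtau tau01 mu (\1_I01) mu_window_integrable) => //.
  - by move=> x Ix; rewrite indicE memNset.
  - by move=> B mB; exact: mu_windowE.
have [f [_ ffin fi fE]] := radon_nikodym_sigma_finite dom.
have fEfin : EFin \o (fine \o f) = f by apply/funext => x; rewrite /= fineK.
exists (fine \o f); split.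
  by rewrite /L1 fEfin; apply: integrableS fi => //; exact: measurable_I01.
move=> A mA; rewrite mu_I01// fE; last by apply: measurableI => //; exact: measurable_I01.
by rewrite /meas; apply: eq_integral => x _; rewrite fineK.
Qed.

End probability_on_I01.

(** * Distribution function of the transferred stationary measure *)

Section cdf.
Context {R : realType}.
Notation leb := (@lebesgue_measure R).
Notation T_R := (measurableTypeR R).
Variables (xi : R) (mu : probability T_R R).
Hypotheses (xi_gt0 : 0 < xi) (xi_b : xi / 2 < Tb) (xi_m : (Tmax : R) <= 1 - xi / 2).
Hypothesis muI : mu I01 = 1%E.
Hypothesis st : forall A : set T_R, measurable A -> Lnoise xi Tmap mu A = mu A.
Variables V h1 h2 : R -> R.
Hypothesis hI : inverse_branches V h1 h2.
Implicit Types x y w : R.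

(** The noise applied to the measure mu itself: a version of the stationary density defined at every
    point, shown below to be continuous. *)
Definition f0 y : R := Kop mu (nbump xi Tmap) (\1_I01) y.

Lemma Tmap_noise x : I01 x -> xi / 2 <= (Tmap x : R) <= 1 - xi / 2.
Proof.
rewrite /I01/= in_itv/= => x01; have /andP[x0 _] := x01.
by rewrite (le_trans (ltW xi_b) (Tb_le_T x x01)) (le_trans (T_le_Tmax x x0) xi_m).
Qed.

Lemma measurable_Tmap : measurable_fun setT (Tmap : T_R -> T_R).
Proof. by apply: continuous_measurable_fun; exact: continuous_Tmap. Qed.

Lemma f0_density : is_density mu f0.
Proof.
have [d1 d2] : is_density (Lnoise xi Tmap mu) f0.
  apply: Lnoise_density => //.
  - exact: measurable_Tmap.
  - by move=> x Ix; have /andP[] := Tmap_noise x Ix; have := xi_gt0; move=> ? ? ?; apply/andP; split; lra.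
  - exact: mu_window_integrable.
  - by move=> x Ix; rewrite indicE memNset.
  - by move=> B mB; exact: mu_windowE.
  - exact: Tmap_noise.
by split => // A mA; rewrite -st// d2.
Qed.

Lemma f0_out y : ~ I01 y -> f0 y = 0.
Proof.
apply: Pop_out; last exact: Tmap_noise.
by move=> x Ix; rewrite indicE memNset.
Qed.

Lemma f0_integ : integ f0.
Proof. by case: f0_density => /L1_integ; rewrite ext01_fixed//; exact: f0_out. Qed.

Lemma mu_f0 (A : set T_R) : measurable A -> mu A = (\int[leb]_(x in A) (f0 x)%:E)%E.
Proof.
by case: f0_density => _ h mA; rewrite h// meas_ext01 ext01_fixed//; exact: f0_out.
Qed.

Lemma mu_point (c : R) : mu [set c] = 0%E.
Proof. by rewrite mu_f0; [exact: integral_set1|exact: measurable_set1]. Qed.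

Lemma f0_ge0 y : 0 <= f0 y.
Proof.
apply: Rintegral_ge0 => x _; rewrite mulr_ge0 ?indicE//; exact: nbump_ge0.
Qed.

Lemma f0_le y : f0 y <= xi^-1.
Proof.
have mb : measurable_fun setT (nbump xi Tmap) by apply: measurable_nbump; exact: measurable_Tmap.
have := Kop_bound mu _ xi^-1 _ mb (nbump_le xi xi_gt0 Tmap) (mu_window_integrable mu) y.
rewrite -/(f0 y) (_ : \int[mu]_x _ = 1).
  by rewrite mulr1; apply: le_trans; exact: ler_norm.
transitivity (\int[mu]_x (\1_I01 x : R)).
  by apply: eq_Rintegral => x _; rewrite ger0_norm// indicE.
by rewrite /Rintegral -mu_windowE// probability_setT.
Qed.

Definition Phi x : R := mass mu `]-oo, x].

Lemma Phi_int x : Phi x = \int[leb]_(t in `]-oo, x]) f0 t.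
Proof. by rewrite /Phi /mass mu_f0//; exact: measurable_itv. Qed.

Lemma PhiE x y : x <= y -> Phi y = Phi x + mass mu `]x, y].
Proof.
move=> xy; rewrite -massU; [|exact: measurable_itv|exact: measurable_itv|].
  congr (mass mu _); apply/seteqP; split => z /=; rewrite !in_itv/=.
    by move=> zy; have [zx|xz] := leP z x; [left|right].
  by move=> [zx|/andP[]//]; exact: le_trans zx xy.
apply/seteqP; split => z //= []; rewrite !in_itv/= => zx /andP[xz _]; lra.
Qed.

Lemma Phi_le x y : x <= y -> Phi x <= Phi y.
Proof. by move=> xy; rewrite (PhiE x y xy) lerDl mass_ge0. Qed.

Lemma Phi_lip x y : x <= y -> Phi y - Phi x <= xi^-1 * (y - x).
Proof.
move=> xy; rewrite (PhiE x y xy) addrAC subrr add0r /mass mu_f0; last exact: measurable_itv.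
rewrite -[X in _ <= X]/(fine (xi^-1 * (y - x))%:E).
have fi : leb.-integrable `]x, y]%classic (EFin \o f0).
  by apply: integrableS f0_integ => //; exact: measurable_itv.
apply: fine_le => //; first by apply: integrable_fin_num => //; exact: measurable_itv.
have -> : (xi^-1 * (y - x))%:E = (\int[leb]_(t in `]x, y]) (cst (xi^-1)%:E t))%E.
  rewrite integral_cst; last exact: measurable_itv.
  rewrite EFinM; congr (_ * _)%E; have := lebesgue_measure_itv `]x, y].
  rewrite /= lte_fin; case: ifPn => [_ ->//|]; rewrite -leNgt => yx ->.
  by rewrite (_ : y = x) ?subrr//; apply/le_anti; rewrite xy yx.
apply: ge0_le_integral.
- exact: measurable_itv.
- by move=> t _; rewrite lee_fin f0_ge0.
- exact: measurable_int fi.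
- exact: measurable_cst.
- by move=> t _; rewrite lee_fin f0_le.
Qed.

Lemma continuous_Phi : continuous Phi.
Proof.
move=> x; apply/cvgrPdist_le => e e0; apply/nbhs_ballP.
exists (e * xi) => [|y]; first exact: mulr_gt0.
rewrite /ball/= => /ltW; have xiV : 0 < xi^-1 by rewrite invr_gt0.
wlog xy : x y / x <= y.
  by move=> h; have [/h//|/ltW/h{}h] := leP x y; rewrite distrC => /h; rewrite distrC.
rewrite ler0_norm ?subr_le0// opprB => h; rewrite ler0_norm ?subr_le0 ?Phi_le// opprB.
apply: le_trans (Phi_lip _ _ xy) _.
by rewrite mulrC ler_pdivrMr.
Qed.

Lemma Phi_hi x : 1 <= x -> Phi x = 1.
Proof.
move=> x1; rewrite /Phi /mass mu_I01//.
rewrite (_ : _ `&` _ = I01) ?muI//; apply/setIidr => z.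
by rewrite /I01/= !in_itv/=; lra.
Qed.

Definition level w : set T_R := I01 `&` [set x | Tmap x <= w].

Lemma measurable_level w : measurable (level w).
Proof.
apply: measurableI; first exact: measurable_I01.
rewrite (_ : [set _ | _] = Tmap @^-1` `]-oo, w]); last by apply/seteqP; split => x /=; rewrite in_itv.
by rewrite -[X in measurable X]setTI; apply: measurable_Tmap => //; exact: measurable_itv.
Qed.

(** Distribution function of the transfer of mu by T. *)
Definition G w : R := mass mu (level w).

Lemma h12 w : h1 w <= h2 w.
Proof. by have := ib_h13 _ _ _ hI w; have /andP[] := ib_h23 _ _ _ hI w; lra. Qed.

(** The complement of a sublevel is the interval between the two inverse branches; mu has no atoms,
    so its ends carry no mass, and mu lives on [0, 1]. *)
Lemma GE w : G w = 1 - (Phi (h2 w) - Phi (h1 w)).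
Proof.
have hw := h12 w; rewrite (PhiE _ _ hw) addrAC subrr add0r.
have mO : measurable (`]h1 w, h2 w]%classic : set T_R) by exact: measurable_itv.
have mO' : measurable (`]h1 w, h2 w[%classic : set T_R) by exact: measurable_itv.
have mOI : measurable (I01 `&` `]h1 w, h2 w[ : set T_R).
  by apply: measurableI; [exact: measurable_I01|].
have e1 : mass mu `]h1 w, h2 w] = mass mu (I01 `&` `]h1 w, h2 w[).
  have [e|ne] := eqVneq (h1 w) (h2 w).
    rewrite e (_ : `]h2 w, h2 w]%classic = set0) ?set_itvoc0// set_itvoo0 setI0//.
  have lt12 : h1 w < h2 w by rewrite lt_neqAle ne.
  rewrite setIC /mass -mu_I01//.
  have -> : `]h1 w, h2 w]%classic = `]h1 w, h2 w[%classic `|` [set h2 w].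
    apply/seteqP; split => z /=; rewrite !in_itv/=.
      move=> /andP[hz]; rewrite le_eqVlt => /orP[/eqP->|zh]; first by right.
      by left; rewrite hz.
    by move=> [/andP[-> /ltW->]|->]//; rewrite lt12 lexx.
  rewrite -/(mass mu _) massU//; first by rewrite /mass mu_point addr0.
  apply/seteqP; split => z //= []; rewrite in_itv/= => /andP[_ h] e; move: h; rewrite e ltxx//.
rewrite e1; apply/eqP; rewrite eq_sym subr_eq eq_sym; apply/eqP.
rewrite /G -massU//; [|exact: measurable_level|].
  rewrite -(mass_I01 mu muI); congr (mass mu _); apply/seteqP; split => x.
    by move=> [[]|[]].
  move=> Ix; have x01 : 0 <= x <= 1 by move: Ix; rewrite /I01/= in_itv.
  have [xl|xl] := boolP ((x <= h1 w) || (h2 w <= x)).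
    by left; split => //=; rewrite (ib_sublevel _ _ _ hI).
  right; split => //=; rewrite in_itv/=.
  by move: xl; rewrite negb_or -!ltNge.
apply/seteqP; split => x //= [[Ix Tw] [_]]; rewrite in_itv/= => /andP[? ?].
have x01 : 0 <= x <= 1 by move: Ix; rewrite /I01/= in_itv.
by move: Tw => /=; rewrite (ib_sublevel _ _ _ hI)// => /orP[|] ?; lra.
Qed.

Lemma continuous_G : continuous G.
Proof.
rewrite (_ : G = fun w => 1 - (Phi (h2 w) - Phi (h1 w))); last by apply/funext => w; exact: GE.
move=> w; apply: cvgB; first exact: cvg_cst.
apply: cvgB.
  by apply: (continuous_comp (f := h2) (g := Phi)); [exact: (ib_ch2 _ _ _ hI)|exact: continuous_Phi].
by apply: (continuous_comp (f := h1) (g := Phi)); [exact: (ib_ch1 _ _ _ hI)|exact: continuous_Phi].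
Qed.

Lemma G_le w w' : w <= w' -> G w <= G w'.
Proof.
move=> ww'; apply: mass_le; [exact: measurable_level|exact: measurable_level|].
by move=> x [Ix Tw]; split => //=; exact: le_trans ww'.
Qed.

Lemma G_ge0 w : 0 <= G w. Proof. exact: mass_ge0. Qed.

Lemma G_hi w : Tmax <= w -> G w = 1.
Proof.
by move=> mw; rewrite GE (ib_h1_hi _ _ _ hI _ mw) (ib_h2_hi _ _ _ hI _ mw) subrr subr0.
Qed.

Lemma G_le1 w : G w <= 1.
Proof.
have [/G_hi->//|/ltW wm] := leP Tmax w.
by rewrite -(G_hi Tmax) ?G_le.
Qed.

Lemma T_level_null w : mu (I01 `&` [set x | Tmap x = w] : set T_R) = 0%E.
Proof.
have m1 := measurable_set1 (h1 w); have m2 := measurable_set1 (h2 w).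
have mT : measurable (I01 `&` [set x | Tmap x = w] : set T_R).
  apply: measurableI; first exact: measurable_I01.
  rewrite (_ : [set _ | _] = Tmap @^-1` [set w])//.
  by rewrite -[X in measurable X]setTI; apply: measurable_Tmap => //; exact: measurable_set1.
apply/eqP; rewrite -measure_le0.
apply: (@le_trans _ _ (mu ([set h1 w] `|` [set h2 w]))).
  apply: le_measure; rewrite ?inE//; first exact: measurableU.
  move=> x [Ix /= <-].
  have x01 : 0 <= x <= 1 by move: Ix; rewrite /I01/= in_itv.
  by case: (ib_level _ _ _ hI x x01) => e; [left|right].
apply: le_trans (measureU2 _ _ _) _; [exact: m1|exact: m2|].
by rewrite [X in (X + _)%E]mu_point [X in (_ + X)%E]mu_point adde0.
Qed.

Lemma G_lo w : w <= Tb -> G w = 0.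
Proof.
move=> wb; apply/le_anti; rewrite G_ge0 andbT -[leRHS]/(fine 0%E) -(T_level_null Tb).
have mT : measurable (I01 `&` [set x | Tmap x = Tb] : set T_R).
  apply: measurableI; first exact: measurable_I01.
  rewrite (_ : [set _ | _] = Tmap @^-1` [set (Tb : R)])//.
  by rewrite -[X in measurable X]setTI; apply: measurable_Tmap => //; exact: measurable_set1.
apply: mass_le => //; first exact: measurable_level.
move=> x [Ix /= Tw]; split => //=; apply/le_anti.
have x01 : 0 <= x <= 1 by move: Ix; rewrite /I01/= in_itv.
by rewrite (le_trans Tw wb) Tb_le_T.
Qed.

(** The noise window is closed while G counts half-open intervals; they differ by the null level set
    N. *)
Lemma f0_G y : f0 y = xi^-1 * (G (y + xi / 2) - G (y - xi / 2)).
Proof.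
have yy : y - xi / 2 <= y + xi / 2 by have := xi_gt0; lra.
pose N : set T_R := I01 `&` [set x | Tmap x = y - xi / 2].
have mN : measurable N.
  apply: measurableI; first exact: measurable_I01.
  rewrite (_ : [set _ | _] = Tmap @^-1` [set (y - xi / 2 : R)])//.
  by rewrite -[X in measurable X]setTI; apply: measurable_Tmap => //; exact: measurable_set1.
have mD : measurable (level (y + xi / 2) `\` level (y - xi / 2)).
  by apply: measurableD; exact: measurable_level.
have e : mass mu ((level (y + xi / 2) `\` level (y - xi / 2)) `|` N) =
    G (y + xi / 2) - G (y - xi / 2).
  rewrite massU//; last first.
    by apply/seteqP; split => x // [[[Ix _] h] [_ /= e]]; apply: h; split => //=; rewrite e.
  rewrite {2}/mass T_level_null addr0.
  apply/eqP; rewrite eq_sym subr_eq -massU//; [|exact: measurable_level|].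
    apply/eqP; congr (mass mu _); apply/seteqP; split => x.
      move=> xl; have [h|h] := pselect (level (y - xi / 2) x); [by right|by left].
    by move=> [[]//|[Ix /= h]]; split => //=; exact: le_trans h yy.
  by apply/seteqP; split => x // [[]].
rewrite -e /f0 /Kop /Rintegral.
under eq_integral => x _.
  rewrite (_ : _ * _ = xi^-1 * \1_((level (y + xi / 2) `\` level (y - xi / 2)) `|` N) x); last first.
    rewrite nbumpE -mulrA; congr (_ * _); rewrite !indicE -natrM mulnb /=.
    congr ((nat_of_bool _)%:R); apply/andP/idP; rewrite !inE/= !in_itv/=.
      move=> [/andP[h3 h4] Ix]; have [h5|h5] := eqVneq (Tmap x : R) (y - xi / 2); first by right.
      left; split; first by split => //=; lra.
      move=> [_ /= h6]; move/eqP: h5; apply; apply/le_anti; rewrite h6/=; lra.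
    move=> [[[Ix /= h3] h4]|[Ix /= h3]].
      split => //; apply/andP; split; first by lra.
      have : ~~ (Tmap x <= y - xi / 2) by apply/negP => h5; apply: h4.
      by rewrite -ltNge; lra.
    by split => //; rewrite h3; have := xi_gt0; lra.
  rewrite EFinM; over.
have mU : measurable ((level (y + xi / 2) `\` level (y - xi / 2)) `|` N) by exact: measurableU.
rewrite ge0_integralZl//; last 2 first.
- by apply/measurable_EFinP; exact: measurable_indic.
- by rewrite lee_fin invr_ge0 ltW.
by rewrite integral_indic// setIT [X in (_ * X)%E](massE mu _ mU).
Qed.

Lemma bmono_G (c : R) : bmono (fun w => G (w + c)).
Proof.
split.
- move=> w; apply: (continuous_comp (f := fun x => x + c) (g := G)); last exact: continuous_G.
  by apply: cvgD; [exact: cvg_id|exact: cvg_cst].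
- by move=> x y xy; apply: G_le; rewrite lerD2r.
- by move=> x; exact: G_ge0.
- by exists 1 => x; exact: G_le1.
Qed.

Lemma mono_diff_f0 : mono_diff f0.
Proof.
have e y : f0 y = xi^-1 * (G (y + xi / 2) - G (y + - (xi / 2))) by exact: f0_G.
rewrite (funext e); apply: mono_diffM; first exact: mono_diff_cst.
by exists (fun y => G (y + xi / 2)), (fun y => G (y + - (xi / 2))); split => //; exact: bmono_G.
Qed.

Lemma continuous_f0 : continuous f0.
Proof.
have [p [q [[cp _ _ _] [cq _ _ _] e]]] := mono_diff_f0.
by rewrite (funext e) => x; apply: cvgB; [exact: cp|exact: cq].
Qed.

Lemma f0_hi y : 1 <= y -> f0 y = 0.
Proof.
by move=> y1; rewrite f0_G !G_hi ?subrr ?mulr0//; have := xi_m; have := xi_gt0; lra.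
Qed.

Lemma is_derive_Phi (x : R) : is_derive x 1 Phi (f0 x).
Proof.
rewrite (funext Phi_int).
have xx : x < x + 1 by lra.
have fi : leb.-integrable [set` Interval -oo%O (BRight (x + 1))] (EFin \o f0).
  by apply: integrableS f0_integ => //; exact: measurable_itv.
have [|d1 d2] := continuous_FTC1 xx fi _ (continuous_f0 x).
  by rewrite ltNye.
by rewrite -[X in is_derive _ _ _ X]d2 derive1E; exact: DeriveDef.
Qed.

(** Perron-Frobenius formula: the sum over both preimages of f0 over the absolute slope. The minus
    sign makes up for [dTright] being negative. *)
Definition g w : R := f0 (h1 w) * (3 * V w ^+ 2 / dqleft (V w)) - f0 (h2 w) * (dTright (h2 w))^-1.

Lemma is_derive_G (w : R) : 0 <= w -> w < Tmax -> is_derive w 1 G (g w).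
Proof.
move=> w0 wm; rewrite (funext GE).
have d1 := ib_dh1 _ _ _ hI w w0 wm.
have dP1 : is_derive w 1 (fun w => Phi (h1 w)) (f0 (h1 w) * (3 * V w ^+ 2 / dqleft (V w))).
  have dp := is_derive_Phi (h1 w).
  by have := @is_derive1_comp R Phi h1 w _ _ dp d1; rewrite /GRing.scale/=.
have dP2 : is_derive w 1 (fun w => Phi (h2 w)) (f0 (h2 w) * (dTright (h2 w))^-1).
  have [Tw|wT] := ltP (Tright 3) w.
    have dp := is_derive_Phi (h2 w); have d2 := ib_dh2 _ _ _ hI w Tw wm.
    by have := @is_derive1_comp R Phi h2 w _ _ dp d2; rewrite /GRing.scale/=.
  (* Near a level at most Tright 3 the right inverse stays beyond 2, where Phi is constantly 1 and
     f0 vanishes. *)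
  have T32 : Tright 3 < Tright 2 :> R by apply: Tright_lt; lra.
  have h22 z : z <= Tright 2 -> 2 <= h2 z.
    move=> zT; have h22 : h2 (Tright 2) = 2 by apply: (ib_h2_T _ _ _ hI); lra.
    by rewrite -[leLHS]h22; exact: (ib_h2_le _ _ _ hI).
  rewrite f0_hi ?mul0r; last by apply: le_trans (h22 w _); lra.
  have d0 : is_derive w 1 (fun=> 1 : R) 0 by exact: is_derive_cst.
  apply: (near_eq_is_derive _ d0).
  near=> z; rewrite /= Phi_hi//; apply: le_trans (h22 z _); first by lra.
  by near: z; apply: near_le_cst; exact: le_lt_trans T32.
by apply: is_derive_eq; rewrite /g; ring.
Unshelve. all: by end_near.
Qed.

Lemma g_lo w : 0 <= w -> w < Tb -> g w = 0.
Proof.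
move=> w0 wb; have bm : Tb < Tmax :> R by have := @Tb_bounds R; have := @Tmax_bounds R; lra.
have d1 := is_derive_G w w0 (lt_trans wb bm).
have d2 : is_derive w 1 G 0.
  have d0 : is_derive w 1 (fun=> 0 : R) 0 by exact: is_derive_cst.
  apply: (near_eq_is_derive _ d0).
  by near=> z; rewrite /= G_lo//; near: z; exact: near_le_cst.
by case: d1 => _ <-; case: d2 => _ <-.
Unshelve. all: by end_near.
Qed.

Lemma vmax_lt1 : vmax < 1 :> R.
Proof. by have [h _] := @vmaxE R; have := @cbrt75_bounds R; rewrite -h; lra. Qed.

Section clamped_density.
Variables B : R.
Hypotheses (B0 : 0 <= B) (Bm : B < Tmax).
Let cl := clamp 0 B.
Let clP w : 0 <= cl w <= B. Proof. exact: clampP. Qed.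
Let ccl : continuous cl. Proof. exact: continuous_clamp. Qed.
Let lecl x y : x <= y -> cl x <= cl y. Proof. exact: clamp_le. Qed.

Let v1 := V B.
Let v1P : -1 <= v1 /\ v1 < vmax.
Proof. by split; [exact: (ib_V_ge _ _ _ hI)|exact: (ib_V_lt _ _ _ hI)]. Qed.

Let Vcl w : clamp (-1) v1 (V (cl w)) = V (cl w).
Proof.
rewrite clamp_id// (ib_V_ge _ _ _ hI)/=; apply: (ib_V_le _ _ _ hI).
by have /andP[] := clP w.
Qed.

Let cVcl : continuous (fun w => V (cl w)).
Proof.
move=> w; apply: (continuous_comp (f := cl) (g := V)); first exact: ccl.
exact: (ib_cV _ _ _ hI).
Qed.

Let leVcl x y : x <= y -> V (cl x) <= V (cl y).
Proof. by move=> xy; apply: (ib_V_le _ _ _ hI); exact: lecl. Qed.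

Let md_V (k : R -> R) K : 0 <= K ->
  (forall x y, -1 <= x <= v1 -> -1 <= y <= v1 -> `|k x - k y| <= K * `|x - y|) ->
  mono_diff (fun w => k (V (cl w))).
Proof.
move=> K0 hk; have h := mono_diff_comp _ _ (mono_diff_lipschitz k (-1) v1 K v1P.1 K0 hk) cVcl leVcl.
by under eq_fun do rewrite -Vcl.
Qed.

(** The factor of [dqleft] that vanishes at [vmax]; on [-1, v1] it is bounded below by
    compactness. *)
Let D v : R := 1 - 3 * v ^+ 2 * (Ta + v).

Let D_lip x y : -1 <= x <= v1 -> -1 <= y <= v1 -> `|D x - D y| <= 15 * `|x - y|.
Proof.
move=> /andP[x1 x2] /andP[y1 y2]; have [_ v1m] := v1P; have vm1 := vmax_lt1.
have Ta1 := @Ta_bounds R.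
have -> : D x - D y = (x - y) * (- 3 * (Ta * (x + y) + (x ^+ 2 + x * y + y ^+ 2))).
  by rewrite /D; ring.
rewrite normrM mulrC ler_wpM2r// normrM normrN (ger0_norm (_ : 0 <= 3 :> R))//.
have h1' : `|Ta * (x + y)| <= 1 * 2.
  rewrite normrM ler_pM//; first by rewrite ger0_norm; lra.
  by rewrite ler_norml; lra.
have h2' : `|x ^+ 2 + x * y + y ^+ 2| <= 3 by rewrite ler_norml; nra.
have := ler_normD (Ta * (x + y)) (x ^+ 2 + x * y + y ^+ 2); lra.
Qed.

Let D_pos : exists2 e, 0 < e & forall x, -1 <= x <= v1 -> e <= D x.
Proof.
have cD : continuous D.
  move=> x; apply: differentiable_continuous; apply/derivable1_diffP.
  by rewrite /D; exact: ex_derive.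
have [c cI hc] := @EVT_min R D (-1) v1 v1P.1 (continuous_subspaceT cD).
exists (D c); last by move=> x xI; apply: hc; rewrite in_itv.
move: cI; rewrite in_itv/= => /andP[c1 c2].
have := dqleft_gt0 c c1 (le_lt_trans c2 v1P.2).
by rewrite /dqleft pmulr_rgt0// expR_gt0.
Qed.

Let md_Dinv : mono_diff (fun w => (D (V (cl w)))^-1).
Proof.
have [e e0 De] := D_pos.
apply: (md_V (fun v => (D v)^-1) (15 / e ^+ 2)); first by rewrite divr_ge0// exprn_ge0// ltW.
move=> x y xI yI; have Dx := De x xI; have Dy := De y yI.
have Dx0 : 0 < D x by exact: lt_le_trans Dx.
have Dy0 : 0 < D y by exact: lt_le_trans Dy.
have -> : (D x)^-1 - (D y)^-1 = (D y - D x) / (D x * D y).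
  by field; rewrite !gt_eqF.
rewrite normrM distrC [`|(D x * D y)^-1|]gtr0_norm ?invr_gt0 ?mulr_gt0//.
rewrite mulrAC; apply: ler_pM => //; first by rewrite invr_ge0 mulr_ge0 ?ltW.
  exact: D_lip.
by rewrite lef_pV2 ?posrE ?exprn_gt0 ?mulr_gt0// expr2 ler_pM// ltW.
Qed.

Let md_exp : mono_diff (fun w => expR (8^-1 + V (cl w) ^+ 3)).
Proof.
exists (fun w => expR (8^-1 + V (cl w) ^+ 3)), (fun=> 0); split; last by move=> x; rewrite subr0.
- split.
  + move=> w; apply: (continuous_comp (f := fun w => 8^-1 + V (cl w) ^+ 3) (g := expR)); last exact: continuous_expR.
    apply: cvgD; first exact: cvg_cst.
    by rewrite exprS expr2; apply: cvgM; [exact: cVcl|apply: cvgM; exact: cVcl].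
  + by move=> x y xy; rewrite ler_expR lerD2l ler_cube leVcl.
  + by move=> x; exact: expR_ge0.
  + exists (expR (8^-1 + v1 ^+ 3)) => x; rewrite ler_expR lerD2l ler_cube.
    by apply: (ib_V_le _ _ _ hI); have /andP[] := clP x.
- by split => //; [move=> x; exact: cvg_cst|exists 0].
Qed.

Let md_left : mono_diff (fun w => f0 (h1 (cl w)) * (3 * V (cl w) ^+ 2 / dqleft (V (cl w)))).
Proof.
apply: mono_diffM.
  apply: (mono_diff_comp f0 (fun w => h1 (cl w)) mono_diff_f0).
    move=> w; apply: (continuous_comp (f := cl) (g := h1)); first exact: ccl.
    exact: (ib_ch1 _ _ _ hI).
  by move=> x y xy; apply: (ib_h1_le _ _ _ hI); exact: lecl.
have e w : 3 * V (cl w) ^+ 2 / dqleft (V (cl w)) =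
    3 * V (cl w) ^+ 2 * (expR (8^-1 + V (cl w) ^+ 3) * (D (V (cl w)))^-1).
  by rewrite /dqleft invfM -expRN opprK.
rewrite (funext e); apply: mono_diffM; last exact: mono_diffM md_exp md_Dinv.
apply: (md_V (fun v => 3 * v ^+ 2) 6) => // x y /andP[x1 x2] /andP[y1 y2].
have [_ v1m] := v1P; have vm1 := vmax_lt1.
have -> : 3 * x ^+ 2 - 3 * y ^+ 2 = (x - y) * (3 * (x + y)) by ring.
by rewrite normrM mulrC ler_wpM2r// ler_norml; lra.
Qed.

Let x0 := h2 B.
Let x0P : 3 / 10 < x0 /\ x0 <= 3.
Proof.
have /andP[x03 x033] := ib_h23 _ _ _ hI B; split; last exact: x033.
have [TB|BT] := ltP (Tright 3) B; first exact: (ib_h2_gt _ _ _ hI).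
have h33 : h2 (Tright 3) = 3 by apply: (ib_h2_T _ _ _ hI); lra.
by have := ib_h2_le _ _ _ hI _ _ BT; rewrite h33 /x0; lra.
Qed.

Let md_h2 (k : R -> R) : mono_diff k -> mono_diff (fun w => k (h2 (cl w))).
Proof.
move=> hk.
have h : mono_diff (fun w => k (h2 (cl (- w)))).
  apply: (mono_diff_comp k (fun w => h2 (cl (- w))) hk).
    move=> w; apply: (continuous_comp (f := fun w => cl (- w)) (g := h2)); last exact: (ib_ch2 _ _ _ hI).
    by apply: (continuous_comp (f := fun w : R => - w) (g := cl)); [exact: opp_continuous|exact: ccl].
  by move=> x y xy; apply: (ib_h2_le _ _ _ hI); apply: lecl; rewrite lerN2.
have := mono_diff_opp _ h; under eq_fun do rewrite opprK.
by [].
Qed.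

Let T3_lt : Tb < Tright 3 :> R. Proof. by apply: Tright_gtb; lra. Qed.
Let T3m : Tright 3 < Tmax :> R.
Proof. exact: Tright3_lt_m. Qed.

Let Th2 w : Tright (h2 (cl w)) = clamp (Tright 3) Tmax (cl w).
Proof.
have /andP[c0 cB] := clP w; have cm : cl w <= Tmax by rewrite (le_trans cB)// ltW.
have [Tw|/ltW wT] := leP (Tright 3) (cl w).
  by rewrite clamp_id ?Tw// (ib_T_h2 _ _ _ hI).
rewrite clamp_lo ?(ltW T3m)//; congr Tright.
have h33 : h2 (Tright 3) = 3 by apply: (ib_h2_T _ _ _ hI); lra.
by apply/le_anti; rewrite -[X in _ && (X <= _)]h33 (ib_h2_le _ _ _ hI) ?andbT//; have /andP[] := ib_h23 _ _ _ hI (cl w).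
Qed.

(** The right inverse is at most 3, so the height above [Tb] is at least Tright 3 - Tb > 0 and its
    inverse is Lipschitz. *)
Let md_Tb : mono_diff (fun w => (Tright (h2 (cl w)) - Tb)^-1).
Proof.
pose d := Tright 3 - Tb : R; have d0 : 0 < d by rewrite subr_gt0.
pose k (t : R) := (t - Tb)^-1.
have hk : mono_diff (fun t => k (clamp (Tright 3) Tmax t)).
  apply: (mono_diff_lipschitz k (Tright 3) Tmax (d ^- 2) (ltW T3m)); first by rewrite invr_ge0 exprn_ge0 ?ltW.
  move=> x y /andP[x1 _] /andP[y1 _].
  have dx : d <= x - Tb by rewrite lerD2r.
  have dy : d <= y - Tb by rewrite lerD2r.
  have dx0 := lt_le_trans d0 dx; have dy0 := lt_le_trans d0 dy.
  have -> : k x - k y = (y - x) / ((x - Tb) * (y - Tb)).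
    by rewrite /k; field; rewrite !gt_eqF.
  rewrite normrM distrC mulrC ler_wpM2r// gtr0_norm ?invr_gt0 ?mulr_gt0//.
  by rewrite lef_pV2 ?posrE ?exprn_gt0 ?mulr_gt0// expr2 ler_pM// ltW.
have := mono_diff_comp _ _ hk ccl lecl.
by under [in X in _ -> X]eq_fun do rewrite Th2.
Qed.

Let md_slope : mono_diff (fun w => (19 * ((h2 (cl w))^-1 - 10 / 3))^-1).
Proof.
have [x03 x33] := x0P.
pose k (x : R) := (19 * (x^-1 - 10 / 3))^-1.
pose d := 10 * x0 / 3 - 1; have d0 : 0 < d by rewrite /d; lra.
have hk : mono_diff (fun t => k (clamp x0 3 t)).
  apply: (mono_diff_lipschitz k x0 3 ((19 * d ^+ 2)^-1) x33).
    by rewrite invr_ge0 mulr_ge0// exprn_ge0// ltW.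
  move=> x y /andP[xx0 _] /andP[yx0 _].
  have dx : d <= 10 * x / 3 - 1 by rewrite /d; lra.
  have dy : d <= 10 * y / 3 - 1 by rewrite /d; lra.
  have dx0 := lt_le_trans d0 dx; have dy0 := lt_le_trans d0 dy.
  have xp : 0 < x by lra.
  have yp : 0 < y by lra.
  have kE z : 0 < z -> 0 < 10 * z / 3 - 1 -> k z = - (z / (19 * (10 * z / 3 - 1))).
    by move=> z0 z1; rewrite /k; field; repeat (apply/andP; split); apply/negP => /eqP h; lra.
  rewrite !kE//.
  have -> : - (x / (19 * (10 * x / 3 - 1))) - - (y / (19 * (10 * y / 3 - 1))) =
      (x - y) / (19 * ((10 * x / 3 - 1) * (10 * y / 3 - 1))).
    by field; rewrite !gt_eqF//; lra.
  rewrite normrM mulrC ler_wpM2r// gtr0_norm ?invr_gt0 ?mulr_gt0//.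
  rewrite lef_pV2 ?posrE; last 2 first.
  - by rewrite !mulr_gt0.
  - by rewrite mulr_gt0// exprn_gt0.
  by rewrite ler_pM2l// expr2 ler_pM// ltW.
have := md_h2 _ hk.
have e w : clamp x0 3 (h2 (cl w)) = h2 (cl w).
  have /andP[_ h3] := ib_h23 _ _ _ hI (cl w); rewrite clamp_id// h3 andbT.
  by apply: (ib_h2_le _ _ _ hI); have /andP[] := clP w.
by under eq_fun do rewrite e.
Qed.

(** Up to a level B < [Tmax] the denominators [dqleft] and [dTright] stay away from 0, so every
    factor is a Lipschitz or monotone function of a monotone one, or [f0] composed with an inverse
    branch. The slopes degenerate only at [Tmax]. *)
Lemma mono_diff_g : mono_diff (fun w => g (clamp 0 B w)).
Proof.
apply: mono_diffB; first exact: md_left.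
apply: mono_diffM; first exact: md_h2 mono_diff_f0.
have e w : (dTright (h2 (cl w)))^-1 =
    (Tright (h2 (cl w)) - Tb)^-1 * (19 * ((h2 (cl w))^-1 - 10 / 3))^-1.
  by rewrite /dTright invfM.
by rewrite (funext e); apply: mono_diffM md_Tb md_slope.
Qed.

End clamped_density.

Lemma g_ge0 w : 0 <= w -> w < Tmax -> 0 <= g w.
Proof.
move=> w0 wm; have := ib_V_lt _ _ _ hI w w0 wm => Vm.
have d1 := dqleft_gt0 (V w) (ib_V_ge _ _ _ hI w) Vm.
have h : 0 <= f0 (h1 w) * (3 * V w ^+ 2 / dqleft (V w)).
  by rewrite mulr_ge0 ?f0_ge0// divr_ge0 ?(ltW d1)// mulr_ge0// sqr_ge0.
rewrite /g subr_ge0; apply: (le_trans _ h).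
have /andP[h23 h233] := ib_h23 _ _ _ hI w.
rewrite mulr_ge0_le0 ?f0_ge0// invr_le0.
move: h23; rewrite le_eqVlt => /orP[/eqP<-|]; last by move=> /dTright_lt0/ltW.
rewrite /dTright (_ : (3 / 10)^-1 - 10 / 3 = 0) ?mulr0//.
by rewrite invf_div subrr.
Qed.

Lemma continuous_gclamp B : 0 <= B -> B < Tmax -> continuous (fun w => g (clamp 0 B w)).
Proof.
move=> B0 Bm; have [p [q [[cp _ _ _] [cq _ _ _] e]]] := mono_diff_g B B0 Bm.
by rewrite (funext e) => x; apply: cvgB; [exact: cp|exact: cq].
Qed.

Definition ghat w : R := if (0 <= w) && (w < Tmax) then g w else 0.

Lemma ghat_ge0 w : 0 <= ghat w.
Proof. by rewrite /ghat; case: ifP => // /andP[? ?]; exact: g_ge0. Qed.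

(** Levels increasing to [Tmax]; they exhaust [0, Tmax[, on which g is controlled only away from
    [Tmax]. *)
Let Bn n : R := Tmax - n.+2%:R^-1 * Tmax.

Let Tmax_gt0 : 0 < Tmax :> R.
Proof. by have := @Tmax_bounds R; lra. Qed.

Let BnP n : 0 <= Bn n /\ Bn n < Tmax.
Proof.
have h : 0 < n.+2%:R^-1 * Tmax :> R by rewrite mulr_gt0 ?invr_gt0.
have h' : n.+2%:R^-1 * Tmax <= Tmax :> R by rewrite -[leRHS]mul1r ler_wpM2r ?(ltW Tmax_gt0)// invf_le1 ?ltr0n// ler1n.
by move: h h'; rewrite /Bn; move: (n.+2%:R^-1 * Tmax : R) => z ? ?; split; lra.
Qed.

Let Bn_cvg : Bn @ \oo --> (Tmax : R).
Proof.
rewrite -[X in _ --> X]subr0; apply: cvgB; first exact: cvg_cst.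
rewrite -(mul0r (Tmax : R)); apply: cvgMr_tmp.
have := @cvg_harmonic R; rewrite -cvg_shiftS; exact.
Qed.

Let Bn_reach w : w < Tmax -> exists n, forall k, (n <= k)%N -> w < Bn k.
Proof.
move=> wm; have h : 0 < Tmax - w by rewrite subr_gt0.
have /cvgrPdist_lt /(_ _ h) [n _ hn] := Bn_cvg.
by exists n => k /hn /=; rewrite ltr_norml => /andP[]; lra.
Qed.

Lemma measurable_ghat : measurable_fun setT (ghat : T_R -> T_R).
Proof.
pose u n (w : T_R) : T_R := \1_(`[0, Bn n]) w * g (clamp 0 (Bn n) w).
have mu' n : measurable_fun setT (u n).
  apply: measurable_funM; first exact: measurable_indic.
  by apply: continuous_measurable_fun; apply: continuous_gclamp; case: (BnP n).
apply: (measurable_fun_cvg mu') => w _.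
have [/andP[w0 wm]|wo] := boolP ((0 <= (w : R)) && ((w : R) < Tmax)).
  have [n hn] := Bn_reach w wm; apply: cvg_near_cst; exists n => // k /= /hn wk.
  rewrite /u indicE mem_set/= ?in_itv/= ?w0 ?(ltW wk)// mul1r /ghat w0 wm/= clamp_id//.
  by rewrite w0 ltW.
apply: cvg_near_cst; exists 0%N => // k _; rewrite /u indicE memNset ?mul0r /ghat ?(negbTE wo)//=.
rewrite in_itv/= => /andP[w0 wk]; move/negP: wo; apply; rewrite w0/=.
exact: le_lt_trans wk (BnP k).2.
Qed.

Lemma ghat_FTC c d : 0 <= c -> c <= d -> d < Tmax ->
  (\int[leb]_(t in `]c, d]) (ghat t)%:E = (G d - G c)%:E)%E.
Proof.
move=> c0; rewrite le_eqVlt => /orP[/eqP->|cd] dm.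
  by rewrite set_itvoc0 integral_set0 subrr.
have d0 : 0 <= d by exact: le_trans c0 (ltW cd).
transitivity (\int[leb]_(t in `[c, d]) (g (clamp 0 d t))%:E)%E.
  rewrite -(integral_itv_obnd_cbnd (r := c)); last first.
    by apply/measurable_EFinP/measurable_funTS; apply: continuous_measurable_fun; exact: continuous_gclamp.
  apply: eq_integral => t; rewrite inE/= in_itv/= => /andP[ct td].
  have t0 : 0 <= t by exact: le_trans c0 (ltW ct).
  by rewrite /ghat t0 (le_lt_trans td dm)/= clamp_id// t0 td.
rewrite (continuous_FTC2 cd (F := G)) ?EFinB//.
- by apply: continuous_subspaceT; exact: continuous_gclamp.
- split.
  + move=> x; rewrite in_itv/= => /andP[cx xd].
    by have := is_derive_G x (le_trans c0 (ltW cx)) (lt_trans xd dm); case.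
  + by apply: cvg_at_right_filter; exact: continuous_G.
  + by apply: cvg_at_left_filter; exact: continuous_G.
- move=> x; rewrite in_itv/= => /andP[cx xd].
  have := is_derive_G x (le_trans c0 (ltW cx)) (lt_trans xd dm); case=> _.
  rewrite derive1E => ->; rewrite clamp_id//.
  by rewrite (le_trans c0 (ltW cx)) ltW.
Qed.

(** Monotone convergence along [Bn] and continuity of G at [Tmax]: no mass is lost at the
    singularity of g. *)
Lemma ghat_FTC_top c : 0 <= c -> c < Tmax ->
  (\int[leb]_(t in `]c, Tmax[) (ghat t)%:E = (1 - G c)%:E)%E.
Proof.
move=> c0 cm; pose F n : set T_R := `]c, Num.max c (Bn n)]%classic.
have e : `]c, Tmax[%classic = \bigcup_n F n.
  apply/seteqP; split => w /=; rewrite /F.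
    rewrite in_itv/= => /andP[cw wm]; have [n hn] := Bn_reach w wm.
    by exists n => //=; rewrite in_itv/= cw le_max (ltW (hn n (leqnn n))) orbT.
  move=> [n _] /=; rewrite !in_itv/= => /andP[-> wB] /=.
  by apply: (le_lt_trans wB); rewrite gt_max cm; case: (BnP n).
have ndF : nondecreasing_seq F.
  move=> i j ij; apply/subsetPset => w; rewrite /F /= !in_itv/= => /andP[-> wB]/=.
  apply: (le_trans wB); rewrite ge_max !le_max lexx/=; apply/orP; right.
  rewrite /Bn lerD2l lerN2 ler_wpM2r ?(ltW Tmax_gt0)// lef_pV2 ?posrE//.
  by rewrite ler_nat !ltnS.
rewrite e.
have h : (\int[leb]_(t in F i) (ghat t)%:E)%E @[i --> \oo] -->
    (\int[leb]_(t in \bigcup_i F i) (ghat t)%:E)%E.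
  apply: ge0_nondecreasing_set_cvg_integral => //.
  - by move=> n; exact: measurable_itv.
  - by move=> n; apply/measurable_EFinP/measurable_funTS; exact: measurable_ghat.
  - by move=> n t _; rewrite lee_fin ghat_ge0.
have h1' : (\int[leb]_(t in F i) (ghat t)%:E)%E @[i --> \oo] --> (1 - G c)%:E.
  have -> : (fun i => (\int[leb]_(t in F i) (ghat t)%:E)%E) =
      (fun i => (G (Num.max c (Bn i)) - G c)%:E).
    apply/funext => i; rewrite ghat_FTC ?le_max ?lexx//.
    by rewrite gt_max cm; case: (BnP i).
  apply: cvg_EFin; first by exists 0%N.
  apply: cvgB; last exact: cvg_cst.
  have cmax : (fun i => Num.max c (Bn i)) @ \oo --> (Tmax : R).
    have [n hn] := Bn_reach c cm; apply: cvg_trans Bn_cvg; apply: near_eq_cvg.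
    by exists n => // k /= /hn ck; rewrite max_r// ltW.
  have hG : G x @[x --> (Tmax : R)] --> G Tmax := continuous_G Tmax.
  by rewrite G_hi// in hG; exact: (cvg_comp _ _ cmax hG).
exact: (cvg_unique _ h h1').
Qed.

Lemma ghat_itv c d : c <= d -> (\int[leb]_(t in `]c, d]) (ghat t)%:E = (G d - G c)%:E)%E.
Proof.
move=> cd; pose c' := clamp 0 Tmax c; pose d' := clamp 0 Tmax d.
have m0 := ltW Tmax_gt0; have /andP[c0 cm] := clampP 0 Tmax c m0.
have /andP[d0 dm] := clampP 0 Tmax d m0; have cd' := clamp_le 0 Tmax c d cd.
have Gcl w : G (clamp 0 Tmax w) = G w.
  have Tb0 : 0 <= Tb :> R by have := @Tb_bounds R; lra.
  have [w0|/ltW w0] := leP w 0; first by rewrite clamp_lo// !G_lo//; exact: le_trans Tb0.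
  have [wm|/ltW wm] := leP Tmax w; first by rewrite clamp_hi// !G_hi.
  by rewrite clamp_id// w0.
have g00 : ghat 0 = 0.
  rewrite /ghat lexx Tmax_gt0/= g_lo//; have := @Tb_bounds R; lra.
have e : (\int[leb]_(t in `]c, d]) (ghat t)%:E)%E = (\int[leb]_(t in `]c', d']) (ghat t)%:E)%E.
  rewrite integral_mkcond [RHS]integral_mkcond; apply: eq_integral => t _; rewrite !patchE.
  have [/andP[t0 tm]|to] := boolP ((0 <= (t : R)) && ((t : R) < Tmax)); last first.
    have -> : ghat t = 0 by rewrite /ghat (negbTE to).
    by case: ifP; case: ifP.
  have [tz|tn0] := eqVneq (t : R) 0; first by rewrite tz g00; case: ifP; case: ifP.
  have tp : 0 < (t : R) by rewrite lt_neqAle eq_sym tn0.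
  rewrite (_ : (t \in `]c, d]%classic) = (t \in `]c', d']%classic))//.
  apply/idP/idP; rewrite !inE/= !in_itv/= => /andP[ct td]; apply/andP; split.
  - by rewrite /c' /clamp gt_max tp/= gt_min ct orbT.
  - by rewrite /d' /clamp le_max le_min (ltW tm) td orbT.
  - by move: ct; rewrite /c' /clamp gt_max gt_min => /andP[_ /orP[h|//]]; lra.
  - by move: td; rewrite /d' /clamp le_max le_min => /orP[h|/andP[]//]; lra.
rewrite e -(Gcl c) -(Gcl d) -/c' -/d'.
have [dlt|dge] := ltP d' Tmax; first by rewrite ghat_FTC.
have dE : d' = Tmax by apply/le_anti; rewrite dm.
rewrite dE (G_hi Tmax)//; have [clt|cge] := ltP c' Tmax; last first.
  by rewrite set_itv_ge ?integral_set0 ?G_hi ?subrr// bnd_simp -leNgt.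
rewrite -ghat_FTC_top//; rewrite integral_mkcond [RHS]integral_mkcond.
apply: eq_integral => t _; rewrite !patchE; have [tm|tm] := eqVneq (t : R) Tmax.
  by rewrite tm {1 2}/ghat ltxx andbF; case: ifP; case: ifP.
rewrite (_ : (t \in `]c', Tmax]%classic) = (t \in `]c', Tmax[%classic))//.
have ht : ((t : R) < Tmax) = ((t : R) <= Tmax) by rewrite lt_neqAle tm.
by apply/idP/idP; rewrite !inE/= !in_itv/= ht.
Qed.

(** The transfer of mu and the measure of density [ghat] have the same distribution function G,
    hence coincide by [stieltjes_unique]. *)
Lemma transfer_density : is_density (transfer Tmap mu) ghat.
Proof.
have mg : measurable_fun setT (fun t : T_R => (ghat t)%:E) by apply/measurable_EFinP; exact: measurable_ghat.
have pg (t : T_R) : (0 <= (ghat t)%:E)%E by rewrite lee_fin ghat_ge0.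
pose nu (A : set T_R) : \bar R := (\int[leb]_(t in A) (ghat t)%:E)%E.
have nu0 : nu set0 = 0%E by rewrite /nu integral_set0.
have nu_ge0 A : (0 <= nu A)%E by apply: integral_ge0 => t _.
pose m2 : {measure set T_R -> \bar R} := HB.pack nu
  (isMeasure.Build _ T_R R nu nu0 nu_ge0 (@semi_sigma_additive_nng_induced _ _ R leb _ mg pg)).
pose X : {mfun T_R >-> T_R} := HB.pack (Tmap : T_R -> T_R)
  (isMeasurableFun.Build _ _ T_R T_R Tmap measurable_Tmap).
have sE (A : set T_R) : measurable A -> distribution mu X A = transfer Tmap mu A.
  move=> mA; rewrite /transfer setIC.
  have mT : measurable (Tmap @^-1` A : set T_R).
    by rewrite -[X in measurable X]setTI; exact: measurable_Tmap.
  exact: (mu_I01 mu muI _ mT).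
have key (A : set T_R) : measurable A -> distribution mu X A = m2 A.
  apply: (stieltjes_unique G) => //; [exact: continuous_G|exact: G_le| |].
    move=> c d cd; transitivity (transfer Tmap mu `]c, d]%classic).
      by apply: sE; exact: measurable_itv.
    have -> : transfer Tmap mu `]c, d] = mu (level d `\` level c).
      congr (mu _); apply/seteqP; split => x; rewrite /level /= in_itv/=.
        by move=> [Ix /andP[cx xd]]; split => // -[_ h]; move: cx; rewrite ltNge h.
      by move=> [[Ix xd] h]; split => //; rewrite xd andbT ltNge; apply/negP => h'; apply: h.
    have mL : measurable (level d `\` level c) by apply: measurableD; exact: measurable_level.
    transitivity (mass mu (level d `\` level c))%:E; first exact: massE.
    congr EFin; apply/eqP; rewrite eq_sym subr_eq /G -massU; [|exact: mL|exact: measurable_level|].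
      apply/eqP; congr (mass mu _); apply/seteqP; split => x.
        by move=> xd; have [h|h] := pselect (level c x); [right|left].
      by move=> [[]//|[Ix /= h]]; split => //=; exact: le_trans h cd.
    by apply/seteqP; split => x // [[]].
  by move=> c d cd; exact: ghat_itv.
have out t : ~ I01 t -> ghat t = 0.
  move=> It; rewrite /ghat; case: ifPn => // /andP[t0 tm]; exfalso; apply: It.
  by rewrite /I01/= in_itv/= t0/=; have := xi_m; have := xi_gt0; lra.
have tot : (\int[leb]_t (ghat t)%:E = 1)%E.
  transitivity (distribution mu X setT); first exact/esym/(key setT measurableT).
  transitivity (transfer Tmap mu setT); first exact: sE.
  by rewrite /transfer preimage_setT setIT muI.
split.
  apply: (integrableS measurableT) => //; first exact: measurable_I01.
  apply/integrableP; split => //.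
  have -> : (\int[leb]_t `|(EFin \o ghat) t| = \int[leb]_t (ghat t)%:E)%E.
    by apply: eq_integral => t _; rewrite /= ger0_norm// ghat_ge0.
  by rewrite tot ltry.
move=> A mA; transitivity (distribution mu X A); first exact/esym/sE.
transitivity (m2 A); first exact: key.
by rewrite meas_ext01 ext01_fixed.
Qed.

End cdf.

(** * Linear response *)

(** Compactness of the segment; only x is confined to it, as y may leave it. *)
Lemma segment_uniform_continuous {R : realType} (k : R -> R) (a b e : R) :
  continuous k -> 0 < e -> exists2 d, 0 < d &
    forall x y, a <= x <= b -> `|x - y| <= d -> `|k x - k y| <= e.
Proof.
move=> ck e0; have e20 : 0 < e / 2 by rewrite divr_gt0.
have /compact_near_coveringP cpt := @segment_compact R a b.
have : \forall d \near (0 : R)^'+, `[a, b]%classic `<=`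
    (fun x : R => forall y, `|x - y| <= d -> `|k x - k y| <= e).
  apply: cpt => x _; have /cvgrPdist_lt /(_ _ e20) /nbhs_ballP[r /= r0 hr] := ck x.
  exists ([set x' | `|x - x'| < r / 2], [set d | d < r / 2]).
    split => /=.
      by apply/nbhs_ballP; exists (r / 2) => //=; rewrite divr_gt0.
    by apply: nbhs_right_lt; rewrite divr_gt0.
  move=> [x' d] [/= x'r dr] y x'y.
  have h1 : `|k x - k x'| < e / 2 by apply: hr; rewrite /ball/=; lra.
  have h2 : `|k x - k y| < e / 2.
    apply: hr; rewrite /ball/=; have := ler_distD x' x y; lra.
  have := ler_distD (k x) (k x') (k y); rewrite [`|k x' - k x|]distrC; lra.
move=> [d /= d0 hd]; exists (d / 2); first by rewrite divr_gt0.
move=> x y xab; apply: (hd (d / 2)); rewrite /= ?divr_gt0//.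
by rewrite sub0r normrN gtr0_norm ?divr_gt0//; lra.
Qed.

Section direction.
Context {R : realType}.
Variable S : R -> R.
Hypothesis hS : admissible_direction S.

Lemma S_lip x y : 0 <= x <= 1 -> 0 <= y <= 1 -> `|S x - S y| <= `|x - y|.
Proof.
move=> xI yI; have [lipS _ _ _ _] := hS; rewrite -[leRHS]mul1r.
by apply: (lipS (x, y)); split; rewrite /I01/= in_itv.
Qed.

Lemma S0 : S 0 = 0. Proof. by case: hS. Qed.
Lemma S1 : S 1 = 0. Proof. by case: hS. Qed.

Lemma S_le1 x : 0 <= x <= 1 -> `|S x| <= 1.
Proof.
move=> x01; rewrite -[S x]subr0 -S0; apply: (le_trans (S_lip x 0 x01 _)); first by lra.
by rewrite subr0 ger0_norm; lra.
Qed.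

(** Since S is controlled on [0, 1] only, it is extended by constants to make the perturbed map
    continuous on the line. *)
Definition Sc x := S (clamp 0 1 x).

Lemma continuous_Sc : continuous Sc.
Proof.
apply: (lipschitz_clamp_continuous S 0 1 1) => //.
by move=> x y x01 y01; rewrite mul1r S_lip.
Qed.

Lemma S_near_max : exists2 e, 0 < e & forall x, 0 <= x <= 1 -> `|x - Tmax| <= e -> S x = 0.
Proof.
have [_ _ _ _ [W /nbhs_ballP[r /= r0 rW] WS]] := hS.
exists (r / 2); first by rewrite divr_gt0.
move=> x x01 xm; apply/eqP/negPn/negP => Sx.
have : (W `&` supp01 S) x.
  split; first by apply: rW; rewrite /ball/= distrC; lra.
  by apply: subset_closure; split => //; rewrite /I01/= in_itv.
by rewrite WS.
Qed.

(** S is 1-Lipschitz and d < 1, so Id + d S is strictly increasing on [0, 1]; it fixes 0 and 1, and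
    E comes from the intermediate value theorem. *)
Lemma Dpert_inverse d w : 0 <= d -> d < 1 -> 0 <= w <= 1 ->
  exists E, [/\ 0 <= E <= 1, E + d * S E = w &
    forall x, 0 <= x <= 1 -> (x + d * S x <= w) = (x <= E) /\ (x + d * S x = w -> x = E)].
Proof.
move=> d0 d1 w01; pose D x := x + d * Sc x.
have cD : continuous D.
  by move=> x; apply: cvgD; [exact: cvg_id|apply: cvgM; [exact: cvg_cst|exact: continuous_Sc]].
have DE x : 0 <= x <= 1 -> D x = x + d * S x by move=> x01; rewrite /D /Sc clamp_id.
have wI : Num.min (D 0) (D 1) <= w <= Num.max (D 0) (D 1).
  by rewrite !DE ?ler01 ?lexx// S0 S1 !mulr0 !addr0 min_l ?max_r ?ler01.
have [E EI DEw] := IVT ler01 (continuous_subspaceT cD) wI.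
have E01 : 0 <= E <= 1 by move: EI; rewrite in_itv.
have inc x y : 0 <= x <= 1 -> 0 <= y <= 1 -> x < y -> x + d * S x < y + d * S y.
  move=> x01 y01 xy; have := S_lip x y x01 y01; rewrite [`|x - y|]ltr0_norm ?subr_lt0//.
  rewrite ler_norml => /andP[_ h].
  have : d * (S x - S y) <= d * - (x - y) by rewrite ler_wpM2l.
  have : d * - (x - y) < 1 * - (x - y) by rewrite ltr_pM2r//; lra.
  rewrite mulrBr; lra.
rewrite DE// in DEw; exists E; split => // x x01; split.
  have [xE|Ex|->] := ltgtP x E.
  - by rewrite -DEw ltW// inc.
  - by apply/negbTE; rewrite -ltNge -DEw inc.
  - by rewrite DEw lexx.
move=> h; case: (ltgtP x E) => // hx.
  by have := inc _ _ x01 E01 hx; rewrite h DEw ltxx.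
by have := inc _ _ E01 x01 hx; rewrite h DEw ltxx.
Qed.

End direction.

(** * First variation of the operator at the stationary density *)

Section response.
Context {R : realType}.
Notation leb := (@lebesgue_measure R).
Notation T_R := (measurableTypeR R).
Variables (xi : R) (mu : probability T_R R).
Hypotheses (xi_gt0 : 0 < xi) (xi_b : xi / 2 < Tb) (xi_m : (Tmax : R) < 1 - xi / 2).
Hypothesis muI : mu I01 = 1%E.
Hypothesis st : forall A : set T_R, measurable A -> Lnoise xi Tmap mu A = mu A.
Variables V h1 h2 : R -> R.
Hypothesis hI : inverse_branches V h1 h2.
Variable S : R -> R.
Hypothesis hS : admissible_direction S.
Variable e0 : R.
Hypotheses (e0_gt0 : 0 < e0) (e0_le : e0 <= 1 / 10).
Hypothesis Se0 : forall x : R, 0 <= x <= 1 -> `|x - Tmax| <= e0 -> S x = 0.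

Let f := f0 xi mu.
Let G' := G mu.
Let g' := g xi mu V h1 h2.
(** S vanishes within e0 of [Tmax]; stopping half-way leaves room for displacements of size e0 /
    2. *)
Let B : R := Tmax - e0 / 2.
Let b : R := xi / 2.
Let tm := @Tmax_bounds R.
Let tb := @Tb_bounds R.
Let B0 : 0 <= B. Proof. by rewrite /B; have := tm; have := e0_le; lra. Qed.
Let Bm : B < Tmax. Proof. by rewrite /B; have := e0_gt0; lra. Qed.
Let B1 : B <= 1. Proof. by rewrite /B; have := tm; have := e0_gt0; lra. Qed.
Let bB : b <= B. Proof. by rewrite /b /B; have := tm; have := e0_le; have := xi_b; have := tb; lra. Qed.
Let b0 : 0 < b. Proof. by rewrite divr_gt0. Qed.
Let xi_m' : (Tmax : R) <= 1 - xi / 2. Proof. exact: ltW. Qed.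

(** Agrees on [0, 1] with [- ghat w * S w], since above B either S or the density vanishes; the
    clamp avoids the singularity of g at [Tmax]. *)
Definition flux w := - (g' (clamp 0 B w) * S (clamp 0 B w)).

Let clP w : 0 <= clamp 0 B w <= B. Proof. exact: clampP. Qed.

Let cl01 w : 0 <= clamp 0 B w <= 1.
Proof. by have /andP[-> h] := clP w; exact: le_trans h B1. Qed.

Let SB : S B = 0.
Proof.
apply: Se0; first by rewrite B0 B1.
by rewrite /B ler_norml; have := e0_gt0; lra.
Qed.

Lemma mono_diff_flux : mono_diff flux.
Proof.
have e w : flux w = 0 - g' (clamp 0 B w) * S (clamp 0 B w) by rewrite /flux sub0r.
rewrite (funext e); apply: mono_diffB; first exact: mono_diff_cst.
apply: mono_diffM; first exact: mono_diff_g.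
apply: (mono_diff_lipschitz S 0 B 1) => //.
move=> x y /andP[x0 xB] /andP[y0 yB]; rewrite mul1r; apply: (S_lip S hS).
  by rewrite x0 (le_trans xB).
by rewrite y0 (le_trans yB).
Qed.

Lemma flux_lo w : w <= b -> flux w = 0.
Proof.
move=> wb; rewrite /flux [g' _](_ : _ = 0) ?mul0r ?oppr0//.
apply: (g_lo xi mu xi_gt0 xi_b xi_m' muI st V h1 h2 hI); first by have /andP[] := clP w.
by apply: le_lt_trans xi_b; rewrite /clamp ge_max ge_min (wb : w <= xi / 2) orbT andbT ltW.
Qed.

Lemma flux_hi w : B <= w -> flux w = 0.
Proof. by move=> Bw; rewrite /flux clamp_hi// SB mulr0 oppr0. Qed.

Lemma flux_clamp w : flux (clamp b B w) = flux w.
Proof.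
have [wb|bw] := leP w b; first by rewrite clamp_lo// !flux_lo.
have [Bw|wB] := leP B w; first by rewrite clamp_hi// !flux_hi.
by rewrite clamp_id// !ltW.
Qed.

(** The charge of [mono_diff_charge_exists] for the flux. What remains is to replace the
    representative chosen by [dens] by [ghat], at L^1 distance 0 from it. *)
Lemma nu_exists : exists nu : {charge set T_R -> \bar R},
  [/\ distributional_derivative (fun x => - dens (transfer Tmap mu) x * S x) nu,
      is_density (reflconv (rho_unif xi) nu) (fun y => xi^-1 * (flux (y + xi / 2) - flux (y - xi / 2))),
      integ (fun y => xi^-1 * (flux (y + xi / 2) - flux (y - xi / 2))) &
      \int[leb]_y (xi^-1 * (flux (y + xi / 2) - flux (y - xi / 2))) = 0].
Proof.
have Bx : B <= 1 - xi / 2 by exact: ltW (lt_le_trans Bm xi_m').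
have [nu [n1 n2 n3 [n4 n5]]] := mono_diff_charge_exists xi flux b B xi_gt0 (lexx b) bB Bx
  mono_diff_flux (flux_lo b (lexx b)) (flux_hi B (lexx B)).
have sE : shift_density xi flux b B = (fun y => xi^-1 * (flux (y + xi / 2) - flux (y - xi / 2))).
  by apply/funext => y; rewrite /shift_density !flux_clamp.
rewrite sE in n3 n4 n5; exists nu; split => //.
have hg := transfer_density xi mu xi_gt0 xi_b xi_m' muI st V h1 h2 hI.
have hd : is_density (transfer Tmap mu) (dens (transfer Tmap mu)) by apply: dens_spec; eexists; exact: hg.
set LT := dens _ in hd *.
have LTg := is_density_unique _ _ _ hd hg.
have iLT : integ (ext01 LT) by apply/L1_integ; case: hd.
have ig : integ (ext01 (ghat xi mu V h1 h2)) by apply/L1_integ; case: hg.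
have bSc x : `|Sc S x| <= 1 by apply: (S_le1 S hS); exact: clampP.
have mSc : measurable_fun setT (Sc S : T_R -> T_R).
  by apply: continuous_measurable_fun; exact: continuous_Sc.
have eS k : ext01 (fun x => - k x * S x) = (fun x => Sc S x * (- 1 * ext01 k x)).
  apply/funext => x; have [Ix|Ix] := pselect (I01 x); last by rewrite !ext01_out// !mulr0.
  rewrite !ext01_in// /Sc clamp_id; first by ring.
  by move: Ix; rewrite /I01/= in_itv.
have iS k : integ (ext01 k) -> integ (ext01 (fun x => - k x * S x)).
  move=> ik; rewrite eS; apply: (integ_bounded_mul _ _ 1 mSc bSc); exact: integZ.
split => //; first by apply/L1_integ; exact: iS.
move=> P N nuPN phi hphi; rewrite n2//.
have [M' dM] := test_derive_bounded phi hphi.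
have mdphi : measurable_fun setT (derive1 phi : T_R -> T_R).
  by apply: continuous_measurable_fun; exact: test_derive_continuous.
have ik k : integ (ext01 k) -> integ (ext01 (fun x => derive1 phi x * (- k x * S x))).
  move=> ik; have -> : ext01 (fun x => derive1 phi x * (- k x * S x)) =
      (fun x => derive1 phi x * ext01 (fun x => - k x * S x) x).
    apply/funext => x; have [Ix|Ix] := pselect (I01 x); last by rewrite !ext01_out// !mulr0.
    by rewrite !ext01_in.
  apply: (integ_bounded_mul _ _ M' mdphi dM); exact: iS.
rewrite ext01_integral; last by apply/L1_integ; exact: ik.
rewrite -EFinN; congr (- _)%:E.
have -> : \int[leb]_t (derive1 phi t * (\1_(`[b, B]) t * flux t)) =
    \int[leb]_x ext01 (fun x => derive1 phi x * (- ghat xi mu V h1 h2 x * S x)) x.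
  apply: eq_Rintegral => t _.
  have [It|It] := pselect (I01 t); last first.
    rewrite ext01_out// indicE memNset ?mul0r ?mulr0//= in_itv/= => /andP[bt tB].
    by apply: It; rewrite /I01/= in_itv/= (le_trans (ltW b0) bt) (le_trans tB B1).
  have t01 : 0 <= (t : R) <= 1 by move: It; rewrite /I01/= in_itv.
  have /andP[t0 t1] := t01.
  rewrite ext01_in//; congr (_ * _); rewrite indicE.
  have [tb'|bt] := ltP (t : R) b.
    rewrite flux_lo ?(ltW tb')// mulr0 /ghat t0/=; case: ifP => [tm'|]; last by rewrite oppr0 mul0r.
    rewrite (g_lo xi mu xi_gt0 xi_b xi_m' muI st V h1 h2 hI)// ?oppr0 ?mul0r//.
    exact: lt_trans xi_b.
  have [tB|Bt] := leP (t : R) B.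
    rewrite mem_set/= ?in_itv/= ?bt// mul1r /flux clamp_id ?t0// /ghat t0 (le_lt_trans tB Bm)/=.
    by rewrite mulNr.
  rewrite flux_hi ?(ltW Bt)// mulr0 /ghat t0/=; case: ifP => [tm'|]; last by rewrite oppr0 mul0r.
  rewrite Se0 ?mulr0//; move: Bt tm'; rewrite /B ler_norml; have := e0_gt0; lra.
apply/esym/Rint_eq; [exact: ik|exact: ik|].
apply/eqP; rewrite eq_le Rint_norm_ge0 andbT -(mulr0 M') -LTg -RintZ; last exact/integ_norm/integB.
apply: Rint_le.
- by apply: integ_norm; apply: integB; exact: ik.
- by apply: integZ; apply: integ_norm; exact: integB.
move=> x; have [Ix|Ix] := pselect (I01 x); last by rewrite !ext01_out// subrr normr0 mulr0.
have x01 : 0 <= (x : R) <= 1 by move: Ix; rewrite /I01/= in_itv.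
rewrite !ext01_in// (_ : _ - _ = derive1 phi x * (S x * (ghat xi mu V h1 h2 x - LT x))); last by ring.
rewrite normrM ler_pM// normrM distrC ler_piMl//; exact: (S_le1 S hS).
Qed.

(** Agrees with [Tpert] on [0, 1], the only place where the map is evaluated by the operators. *)
Definition taud (d : R) : T_R -> T_R := fun x => Tmap x + d * Sc S (Tmap x).

Lemma measurable_taud d : measurable_fun setT (taud d).
Proof.
apply: continuous_measurable_fun => x; apply: cvgD; first exact: continuous_Tmap.
apply: cvgM; first exact: cvg_cst.
apply: (continuous_comp (f := Tmap) (g := Sc S)); first exact: continuous_Tmap.
exact: continuous_Sc.
Qed.

Lemma Sc_le1 x : `|Sc S x| <= 1.
Proof. by apply: (S_le1 S hS); exact: clampP. Qed.

Lemma taud_dist d x : 0 <= d -> `|taud d x - Tmap x : R| <= d.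
Proof.
move=> d0; rewrite /taud addrAC subrr add0r normrM (ger0_norm d0).
by rewrite -[leRHS]mulr1 ler_wpM2l// Sc_le1.
Qed.

Lemma taud_in d x : 0 <= d -> d <= Tb - xi / 2 -> d <= 1 - xi / 2 - Tmax ->
  I01 x -> xi / 2 <= (taud d x : R) <= 1 - xi / 2.
Proof.
move=> d0 db dm; rewrite /I01/= in_itv/= => x01; have /andP[x0 _] := x01.
have h3 := Tb_le_T x x01; have h4 := T_le_Tmax x x0.
have := taud_dist d x d0; rewrite ler_norml; move: (taud d x : R) => t /andP[? ?].
by apply/andP; split; lra.
Qed.

(** E stands for the preimage of w under the perturbation. The second clause controls the level set,
    as noise windows are closed. *)
Definition tracks (t : T_R -> T_R) (w E : R) :=
  forall x : R, 0 <= x <= 1 -> ((t x : R) <= w) = (Tmap x <= E) /\ ((t x : R) = w -> Tmap x = E).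

(** The left side is the mass of the points sent by t into a closed window. By tracking, this is a
    difference of sublevels of T, up to a level set of mass 0. *)
Lemma Pop_tracks (t : T_R -> T_R) y E1 E2 : measurable_fun setT t ->
  tracks t (y - xi / 2) E1 -> tracks t (y + xi / 2) E2 ->
  Pop xi t f y = xi^-1 * (G' E2 - G' E1).
Proof.
move=> mt h3 h4; pose C : set T_R := t @^-1` `[y - xi / 2, y + xi / 2].
have mC : measurable C.
  by rewrite -[X in measurable X]setTI; apply: mt => //; exact: measurable_itv.
have mI := @measurable_I01 R.
have mE E : measurable (level E) := measurable_level E.
have mN : measurable (I01 `&` [set x | Tmap x = E1] : set T_R).
  apply: measurableI => //; rewrite (_ : [set _ | _] = Tmap @^-1` [set E1])//.
  rewrite -[X in measurable X]setTI; apply: (measurable_Tmap measurableT).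
  exact: measurable_set1.
have yy : y - xi / 2 <= y + xi / 2 by have := xi_gt0; lra.
have I01E (x : R) : I01 x -> 0 <= x <= 1 by rewrite /I01/= in_itv.
have E12 : level E1 `<=` level E2.
  move=> x [Ix /= xE]; split => //=; have x01 := I01E x Ix.
  by rewrite -(h4 x x01).1 (le_trans _ yy)// (h3 x x01).1.
have dE : mass mu (level E2 `\` level E1) = G' E2 - G' E1.
  apply/eqP; rewrite eq_sym subr_eq /G' /G -massU; [|by apply: measurableD|exact: mE|].
    apply/eqP; congr (mass mu _); apply/seteqP; split => x.
      by move=> xd; have [h|h] := pselect (level E1 x); [right|left].
    by move=> [[]//|/E12].
  by apply/seteqP; split => x // [[]].
have mD : measurable (level E2 `\` level E1) by apply: measurableD.
have massC : mass mu C = G' E2 - G' E1.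
  rewrite {1}/mass (mu_I01 mu muI C mC) -/(mass mu (C `&` I01)); apply/le_anti/andP; split.
    rewrite -dE -[leRHS]addr0.
    have N0 := T_level_null xi mu xi_gt0 xi_b xi_m' muI st V h1 h2 hI E1.
    rewrite -[X in _ + X]/(fine 0%E) -N0 -[fine _]/(mass mu _).
    apply: (@le_trans _ _ (mass mu ((level E2 `\` level E1) `|` (I01 `&` [set x | Tmap x = E1])))).
      apply: mass_le; [exact: measurableI|exact: measurableU|].
      move=> x [/= Cx Ix]; have x01 := I01E x Ix; move: Cx; rewrite /C/= in_itv/= => /andP[c3 c4].
      have [e|ne] := eqVneq (t x : R) (y - xi / 2); first by right; split => //=; exact: (h3 x x01).2.
      left; split; first by split => //=; rewrite -(h4 x x01).1.
      move=> [_ /=]; rewrite -(h3 x x01).1 => c5; move/eqP: ne; apply.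
      by apply/le_anti; rewrite c5 c3.
    rewrite /mass -fineD; [|exact: mu_fin|exact: mu_fin].
    apply: fine_le; [exact: mu_fin (measurableU _ _ mD mN)|by rewrite fin_numD !mu_fin|].
    exact: measureU2.
  rewrite -dE; apply: mass_le => //; first exact: measurableI.
  move=> x [[Ix /= x2] x1]; have x01 := I01E x Ix; split => //=; rewrite /C/= in_itv/=.
  rewrite (h4 x x01).1 x2 andbT leNgt; apply/negP => x3; apply: x1; split => //=.
  by rewrite -(h3 x x01).1 ltW.
rewrite -massC /mass (mu_f0 xi mu xi_gt0 xi_b xi_m' muI st)//.
have fi := f0_integ xi mu xi_gt0 xi_b xi_m' muI st.
transitivity (xi^-1 * \int[leb]_x (\1_C x * f x)).
  rewrite -RintZ; last first.
    apply: (integ_bounded_mul _ _ 1 (measurable_indic mC)) => //.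
    by move=> x; rewrite indicE; case: (_ \in _); rewrite ?normr0 ?normr1.
  apply: eq_Rintegral => x _; rewrite nbumpE/= -mulrA; congr (_ * (_ * _)).
  rewrite !indicE; congr (_%:R); congr nat_of_bool.
  by apply/idP/idP; rewrite !inE /C/= !in_itv/=; move: (t x : R) => z; lra.
congr (_ * _); rewrite /Rintegral; congr fine; rewrite [RHS]integral_mkcond.
by apply: eq_integral => x _; rewrite patchE indicE; case: (x \in C); rewrite ?mul1r ?mul0r.
Qed.

(** The mean value theorem gives G E - G w = k z (E - w) with E - w = - d S E; uniform continuity of
    k and the Lipschitz bound on S replace z and E by w. Near [Tmax], where G need not be
    differentiable, S vanishes and E = w. *)
Lemma flux_limit e : 0 < e -> exists2 dl, 0 < dl & forall d, 0 < d -> d < dl ->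
  forall w, exists2 E, tracks (taud d) w E & `|G' E - G' w - d * flux w| <= d * e.
Proof.
move=> e_gt0; have e20 : 0 < e / 2 by rewrite divr_gt0.
pose k w := g' (clamp 0 B w).
have ck : continuous k by exact: continuous_gclamp.
have [r r0 hr] := segment_uniform_continuous k 0 B (e / 2) ck e20.
have [c _ hc] := @EVT_max R (fun t => `|k t|) 0 B B0 (continuous_subspaceT (fun x => cvg_norm (ck x))).
pose M := `|k c| + 1; have M0 : 0 < M by rewrite ltr_wpDl.
have kM x : `|k x| <= M.
  have -> : k x = k (clamp 0 B x) by rewrite /k [in RHS]clamp_id.
  by apply: le_trans (hc _ _) _; rewrite ?lerDl// in_itv/= clP.
(* The bounds serve, in order, uniform continuity of k, keeping w below B, monotonicity of Id + d S,
   and the variation of S between w and E. *)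
pose dl := Num.min (Num.min r (e0 / 2)) (Num.min (1 / 2) (e / 2 / M)).
exists dl; first by rewrite !lt_min r0 !divr_gt0.
move=> d d0; rewrite !lt_min => /andP[/andP[dr de] /andP[d12 dM]] w.
have tIn (x : R) : 0 <= x <= 1 -> 0 <= Tmap x <= 1 by exact: Tmap_01.
have tE (x : R) : 0 <= x <= 1 -> taud d x = Tmap x + d * S (Tmap x) :> R.
  by move=> x01; rewrite /taud /Sc clamp_id ?tIn.
have d_ge0 := ltW d0; have d1 : d < 1 by lra.
have de0 : 0 <= d * e by rewrite mulr_ge0 ?ltW.
have rng (x : R) : 0 <= x <= 1 -> 0 <= x + d * S x <= 1.
  move=> x01; have I0 : 0 <= (0 : R) <= 1 by rewrite lexx ler01.
  have I1 : 0 <= (1 : R) <= 1 by rewrite lexx ler01.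
  have := S_lip S hS x 0 x01 I0; have := S_lip S hS x 1 x01 I1.
  rewrite (S0 S hS) (S1 S hS) !subr0.
  rewrite [`|x - 1|]ler0_norm ?[`|x|]ger0_norm; [|lra|lra].
  rewrite !ler_norml => /andP[k1 k2] /andP[k3 k4].
  have : d * - x <= d * S x by rewrite ler_wpM2l.
  have : d * S x <= d * - (x - 1) by rewrite ler_wpM2l.
  have : d * x <= 1 * x by rewrite ler_wpM2r; lra.
  have : d * (1 - x) <= 1 * (1 - x) by rewrite ler_wpM2r; lra.
  by lra.
have Tb0 : 0 <= Tb :> R by have := tb; lra.
have [w0|w0] := ltP w 0.
  exists w; last by rewrite subrr flux_lo ?mulr0 ?subr0 ?normr0//; apply: (le_trans (ltW w0)); exact: ltW.
  move=> x x01; rewrite tE//; have := rng _ (tIn x x01); have := tIn x x01.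
  move: (Tmap x : R) => z z01 zr; split; last by lra.
  by rewrite !leNgt; congr (~~ _); apply/idP/idP => _; lra.
have [w1|w1] := ltP 1 w.
  exists w; last by rewrite subrr flux_hi ?mulr0 ?subr0 ?normr0//; apply: (le_trans B1); exact: ltW.
  move=> x x01; rewrite tE//; have := rng _ (tIn x x01); have := tIn x x01.
  move: (Tmap x : R) => z z01 zr; split; last by lra.
  by apply/idP/idP => _; lra.
have w01 : 0 <= w <= 1 by rewrite w0 w1.
have [E [E01 Ew hE]] := Dpert_inverse S hS d w d_ge0 d1 w01.
exists E.
  move=> x x01; rewrite tE//; exact: hE _ (tIn x x01).
have /andP[E0 E1] := E01.
have wE : w - E = d * S E by rewrite -Ew addrAC subrr add0r.
have SE1 := S_le1 S hS E E01.
have dSE : `|d * S E| <= d by rewrite normrM (ger0_norm d_ge0) -[leRHS]mulr1 ler_wpM2l.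
have wEd : `|w - E| <= d by rewrite wE.
have Gh z : Tmax <= z -> G' z = 1 by move=> mz; exact: (G_hi xi mu xi_gt0 xi_b xi_m' muI st V h1 h2 hI z mz).
(* Above this level either S E = 0, hence E = w, or E and w both lie above [Tmax], where G is 1. *)
have [Ehi|Elo] := leP (Tmax - e0) E.
  have [Em|Em] := leP E (Tmax + e0).
    have SE0 : S E = 0 by apply: Se0 => //; rewrite ler_norml; lra.
    have <- : E = w by move: wE; rewrite SE0 mulr0; lra.
    rewrite subrr sub0r normrN [flux E](_ : _ = 0) ?mulr0 ?normr0//.
    have [BE|EB] := leP B E; first exact: flux_hi.
    by rewrite /flux clamp_id ?E0 ?(ltW EB)// SE0 mulr0 oppr0.
  have wm : Tmax <= w by move: wEd; rewrite ler_norml; have := e0_gt0; lra.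
  have Bw : B <= w by exact: le_trans (ltW Bm) wm.
  rewrite (Gh w wm) (Gh E) ?flux_hi ?mulr0 ?subrr ?subr0 ?normr0//.
  by have := e0_gt0; lra.
have wB : w <= B by move: wEd; rewrite /B ler_norml; lra.
have EB : E <= B by rewrite /B; have := e0_gt0; lra.
have mvt u v : 0 <= u -> u <= v -> v <= B -> exists2 z, u <= z <= v & G' v - G' u = k z * (v - u).
  move=> u0 uv vB.
  have dG (z : R) : z \in `]u, v[ -> is_derive z 1 G' (k z).
    rewrite in_itv/= => /andP[uz zv]; have z0 : 0 <= z by lra.
    have zB : z < B by exact: lt_le_trans zv vB.
    rewrite /k clamp_id ?z0 ?(ltW zB)//.
    by apply: is_derive_G => //; exact: lt_trans Bm.
  have cG : {within `[u, v], continuous G'}.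
    by apply: continuous_subspaceT; exact: (continuous_G xi mu xi_gt0 xi_b xi_m' muI st V h1 h2 hI).
  have [z zI ez] := MVT_segment uv dG cG.
  by exists z => //; move: zI; rewrite in_itv.
have [z zw Gz] : exists2 z, `|w - z| <= d & G' E - G' w = k z * (E - w).
  have [Ew'|/ltW wE'] := leP E w.
    have [z /andP[z1 z2] ez] := mvt E w E0 Ew' wB.
    exists z; last by rewrite -opprB ez; ring.
    by move: wEd; rewrite !ler_norml; lra.
  have [z /andP[z1 z2] ez] := mvt w E w0 wE' EB.
  by exists z => //; move: wEd; rewrite !ler_norml; lra.
have wI : 0 <= w <= B by rewrite w0 wB.
have kw : k w = g' w by rewrite /k clamp_id.
have fl : flux w = - (k w * S w) by rewrite kw /flux clamp_id.
have -> : G' E - G' w - d * flux w = d * ((k w - k z) * S E + k w * (S w - S E)).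
  rewrite fl Gz (_ : E - w = - (d * S E)); last by rewrite -wE opprB.
  by move: (k w) (k z) => a1 a2; ring.
rewrite normrM (ger0_norm d_ge0) ler_wpM2l//.
apply: (le_trans (ler_normD _ _)); rewrite !normrM.
have a1 : `|k w - k z| * `|S E| <= e / 2.
  rewrite -[leRHS]mulr1 ler_pM//; apply: hr => //; exact: (le_trans zw (ltW dr)).
have a2 : `|k w| * `|S w - S E| <= M * (e / 2 / M).
  rewrite ler_pM//; apply: (le_trans (S_lip S hS w E w01 E01)).
  exact: (le_trans wEd (ltW dM)).
have a3 : M * (e / 2 / M) = e / 2 by rewrite mulrC divfK// gt_eqF.
rewrite a3 in a2; lra.
Qed.

Lemma response_pointwise e : 0 < e -> exists2 dl, 0 < dl & forall d, 0 < d -> d < dl ->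
  forall y, `|(Pop xi (taud d) f y - Pop xi Tmap f y) / d -
    xi^-1 * (flux (y + xi / 2) - flux (y - xi / 2))| <= xi^-1 * (e + e).
Proof.
move=> e_gt0; have [dl dl0 hdl] := flux_limit e e_gt0; exists dl => // d d0 ddl y.
have [E1 t1 q1] := hdl d d0 ddl (y - xi / 2).
have [E2 t2 q2] := hdl d d0 ddl (y + xi / 2).
have tid w : tracks Tmap w w by move=> x _; split.
rewrite (Pop_tracks (taud d) y E1 E2 (measurable_taud d) t1 t2).
rewrite (Pop_tracks Tmap y _ _ measurable_Tmap (tid _) (tid _)).
set a1 := G' E1 - _ - _ in q1; set a2 := G' E2 - _ - _ in q2.
have -> : (xi^-1 * (G' E2 - G' E1) - xi^-1 * (G' (y + xi / 2) - G' (y - xi / 2))) / d -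
    xi^-1 * (flux (y + xi / 2) - flux (y - xi / 2)) = xi^-1 * (d^-1 * (a2 - a1)).
  by rewrite /a1 /a2; field; rewrite !gt_eqF.
rewrite normrM gtr0_norm ?invr_gt0// ler_wpM2l ?invr_ge0 ?(ltW xi_gt0)//.
rewrite normrM gtr0_norm ?invr_gt0// ler_pdivrMl//.
by apply: (le_trans (ler_normB _ _)); rewrite mulrDr addrC lerD.
Qed.

End response.

(** * Dependence of the operator on the map *)

Section perturbed_operator.
Context {R : realType}.
Notation leb := (@lebesgue_measure R).
Notation T_R := (measurableTypeR R).
Variables (xi : R) (xi_gt0 : 0 < xi).

(** Two windows of equal width differ only between their left ends and between their right ends. *)
Lemma indic_window_diff (a b h y : R) : 0 <= h ->
  `|\1_(`[a - h, a + h]) y - \1_(`[b - h, b + h]) y| <=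
  \1_(`[Num.min a b - h, Num.max a b - h]) y + \1_(`[Num.min a b + h, Num.max a b + h]) y :> R.
Proof.
move=> h0; wlog ab : a b / a <= b.
  move=> H; have /orP[/H//|/H{}H] := le_total a b.
  by rewrite distrC (minC a) (maxC a); exact: H.
rewrite min_l// max_r// !indicE.
have E (u v : R) : (y \in `[u, v]%classic) = (u <= y <= v) by apply/idP/idP; rewrite inE/= in_itv.
rewrite !E.
case: (boolP (a - h <= y <= a + h)) => p1; case: (boolP (b - h <= y <= b + h)) => p2;
case: (boolP (a - h <= y <= b - h)) => p3; case: (boolP (a + h <= y <= b + h)) => p4;
rewrite /= ?subrr ?subr0 ?sub0r ?normrN ?normr0 ?normr1 ?addr0 ?add0r ?lexx ?ler01//; try lra.
Qed.

(** The difference of the kernels is carried by two strips of width at most D, on which it is at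
    most xi^-1. *)
Lemma Pop_diff (t t' : T_R -> T_R) (D : R) (u : T_R -> R) :
  measurable_fun setT t -> measurable_fun setT t' ->
  (forall x, `|t x - t' x : R| <= D) -> integ u ->
  \int[leb]_y `|Pop xi t u y - Pop xi t' u y| <= 2 * xi^-1 * D * \int[leb]_x `|u x|.
Proof.
move=> mt mt' tD iu; pose k z := nbump xi t z - nbump xi t' z.
have xiV : 0 <= xi^-1 by rewrite invr_ge0 ltW.
have mk : measurable_fun setT k by apply: measurable_funB; exact: measurable_nbump.
have kM z : `|k z| <= xi^-1 + xi^-1.
  by apply: (le_trans (ler_normB _ _)); rewrite lerD// nbump_le.
have kC x : (\int[leb]_y (`|k (x, y)|)%:E <= (2 * xi^-1 * D)%:E)%E.
  pose p := Num.min (t x : R) (t' x); pose q := Num.max (t x : R) (t' x).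
  pose w y : R := xi^-1 * (\1_(`[p - xi / 2, q - xi / 2]) y + \1_(`[p + xi / 2, q + xi / 2]) y).
  have pq : p <= q by rewrite /p /q ge_min !le_max lexx.
  have qp : q - p <= D.
    have := tD x; rewrite /p /q; move: (t x : R) (t' x : R) => a1 a2.
    by case: (leP a1 a2) => h; rewrite ler_norml; lra.
  have iw : integ (fun y => w y).
    by apply: integZ; apply: integD; exact: integ_indic.
  apply: (@le_trans _ _ (\int[leb]_y (w y)%:E)%E).
    apply: ge0_le_integral => //.
    - by apply/measurable_EFinP; apply: measurableT_comp => //; exact: measurableT_comp mk _.
    - exact: measurable_int iw.
    move=> y _; rewrite lee_fin /k !nbumpE/= -mulrBr normrM (ger0_norm xiV) ler_wpM2l//.
    by apply: indic_window_diff; rewrite divr_ge0// ltW.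
  rewrite (_ : (\int[leb]_y (w y)%:E)%E = (\int[leb]_y w y)%:E); last first.
    by rewrite /Rintegral fineK//; exact: integrable_fin_num iw.
  rewrite lee_fin RintZ; last by apply: integD; exact: integ_indic.
  rewrite RintD ?Rint_indic; [|lra|lra|exact: integ_indic|exact: integ_indic].
  rewrite [2 * _]mulrC -mulrA ler_wpM2l//; lra.
have h := Kop_norm leb k (xi^-1 + xi^-1) _ u mk kM kC iu.
apply: le_trans h; apply/eq_ler/eq_Rintegral => y _; congr `|_|.
rewrite /Kop /Pop /Kop -RintB; [|exact: Pop_section|exact: Pop_section].
by apply: eq_Rintegral => x _; rewrite /k mulrBl.
Qed.

Lemma stationary_density (tau : T_R -> T_R) (mu : probability T_R R) :
  measurable_fun setT tau -> (forall x, I01 x -> xi / 2 <= (tau x : R) <= 1 - xi / 2) ->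
  mu I01 = 1%E -> (forall A : set T_R, measurable A -> Lnoise xi tau mu A = mu A) ->
  let v := Kop mu (nbump xi tau) (\1_I01) in
  [/\ is_density mu v, integ v, (forall x, ~ I01 x -> v x = 0),
      \int[leb]_x `|v x| = 1 &
      \int[leb]_x v x = 1 /\ \int[leb]_x `|v x - Pop xi tau v x| = 0].
Proof.
move=> mtau tin muI st v.
have tau01 x : I01 x -> 0 <= (tau x : R) <= 1.
  by move=> /tin; have := xi_gt0; move: (tau x : R) => t ? /andP[? ?]; apply/andP; split; lra.
have dv : is_density (Lnoise xi tau mu) v.
  apply: Lnoise_density => //.
  - exact: mu_window_integrable.
  - by move=> x Ix; rewrite indicE memNset.
  - by move=> B mB; exact: mu_windowE.
have dmu : is_density mu v.
  by case: dv => d1 d2; split => // A mA; rewrite -st// d2.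
have vo x : ~ I01 x -> v x = 0.
  by apply: Pop_out => // z Iz; rewrite indicE memNset.
have iv : integ v by case: dmu => /L1_integ; rewrite ext01_fixed.
have v0 x : 0 <= v x.
  by apply: Rintegral_ge0 => z _; rewrite mulr_ge0 ?indicE//; exact: nbump_ge0.
have vE (A : set T_R) : measurable A -> mu A = (\int[leb]_(x in A) (v x)%:E)%E.
  by case: dmu => _ h mA; rewrite h// meas_ext01 ext01_fixed.
have i1 : \int[leb]_x v x = 1 by rewrite /Rintegral -vE// probability_setT.
have d2 : is_density (Lnoise xi tau mu) (Pop xi tau v) by apply: Lnoise_density.
split => //; first by rewrite -i1; apply: eq_Rintegral => x _; rewrite ger0_norm.
split => //; have := is_density_unique _ _ _ dv d2; rewrite !ext01_fixed//.
by move=> x Ix; apply: Pop_out.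
Qed.

End perturbed_operator.

(** * The response formula *)

Section linear_response.
Context {R : realType}.
Notation leb := (@lebesgue_measure R).
Notation T_R := (measurableTypeR R).
Variables (xi : R) (S : R -> R) (dbar : R) (mu : R -> probability T_R R).
Hypothesis hxi : xi = 860 / 10 ^+ 5 \/ xi = 129 / 10 ^+ 6.
Hypothesis hS : admissible_direction S.
Hypothesis dbar_gt0 : 0 < dbar.
Hypothesis hD : forall delta, 0 <= delta < dbar -> bilipschitz_homeo01 (Dpert S delta).
Hypothesis hmu0 : stationary01 xi Tmap (mu 0).
Hypothesis hmu : forall delta, 0 < delta < dbar -> stationary01 xi (Tpert S delta) (mu delta).

Let xi_rng : 129 / 10 ^+ 6 <= xi <= 860 / 10 ^+ 5.
Proof. by case: hxi => ->; lra. Qed.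

Let xi_gt0 : 0 < xi. Proof. by have := xi_rng; lra. Qed.
Let xi_b : xi / 2 < Tb. Proof. by have := xi_rng; have := @Tb_bounds R; lra. Qed.
Let xi_m : (Tmax : R) < 1 - xi / 2. Proof. by have := xi_rng; have := @Tmax_bounds R; lra. Qed.

Let tin x : I01 x -> xi / 2 <= (Tmap x : R) <= 1 - xi / 2.
Proof. by apply: Tmap_noise => //; exact: ltW. Qed.

Let mT : measurable_fun setT (Tmap : T_R -> T_R). Proof. exact: measurable_Tmap. Qed.

Lemma contraction : exists N theta, theta < 1 /\
  forall u : T_R -> R, integ u -> (forall x, ~ I01 x -> u x = 0) -> \int[leb]_x u x = 0 ->
    \int[leb]_x `|iter N (Pop xi Tmap) u x| <= theta * \int[leb]_x `|u x|.
Proof.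
have [p pI Tp] := @fixed_point R.
have x4 : 0 < xi / 4 by rewrite divr_gt0.
have /cvgrPdist_lt /(_ _ x4) /nbhs_ballP[r /= r0 hr] := @continuous_Tmap R p.
pose eta := Num.min (r / 2) (xi / 4).
have eta0 : 0 < eta by rewrite lt_min x4 divr_gt0.
have eta4 : eta <= xi / 4 by rewrite ge_min lexx orbT.
have p01 : 0 <= p <= 1 by move: pI => /andP[? ?]; apply/andP; split; lra.
have teta (x : R) : `|x - p| <= eta -> `|Tmap x - p : R| <= xi / 4.
  rewrite le_min => /andP[xr _]; rewrite -[in X in _ - X]Tp distrC ltW//.
  by apply: hr; rewrite /ball/= distrC; lra.
apply: (Pop_contraction xi xi_gt0 Tmap mT (@continuous_Tmap R) p _ eta eta0 eta4 teta).
(* Reachability at the smaller amplitude implies it for both values of xi. *)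
move=> P Pp hP; apply: (noise_reaches P p pI Pp) => x y x01 y01 xy.
by apply: hP => //; apply: (le_trans xy); have := xi_rng; lra.
Qed.

Let Dpert01 d x : 0 <= d < dbar -> 0 <= x <= 1 -> 0 <= x + d * S x <= 1.
Proof.
move=> hd x01; have [[hf _ _] _] := hD d hd.
have := hf x; rewrite /I01/= in_itv/= => /(_ x01); rewrite in_itv/=.
exact.
Qed.

Let taudE d x : I01 x -> Tpert S d x = taud S d x.
Proof.
rewrite /I01/= in_itv/= => x01; rewrite /Tpert /Dpert /taud/= /Sc clamp_id//.
exact: Tmap_01.
Qed.

Let Lnoise_taud d (m : set R -> \bar R) (A : set R) :
  Lnoise xi (Tpert S d) m A = Lnoise xi (taud S d) m A.
Proof.
congr (reflconv _ _ _); apply/funext => C; congr (m _).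
by apply/seteqP; split => x [Ix /= Cx]; split => //=; move: Cx; rewrite taudE.
Qed.

Let st0 : mu 0 I01 = 1%E /\
  forall A : set T_R, measurable A -> Lnoise xi Tmap (mu 0) A = mu 0 A.
Proof. exact: hmu0. Qed.

Let std d : 0 < d < dbar -> mu d I01 = 1%E /\
  forall A : set T_R, measurable A -> Lnoise xi (taud S d) (mu d) A = mu d A.
Proof. by move=> /hmu[m1 m2]; split => // A mA; rewrite -Lnoise_taud m2. Qed.

(** For delta up to dbar the noise may be reflected, so absolute continuity is obtained from
    [stationary_has_density]; the explicit kernel enters only for small delta. *)
Lemma densities_exist d : 0 <= d < dbar -> has_density (mu d).
Proof.
move=> /andP[d0 dd]; have xi2 : xi <= 2 by have := xi_rng; lra.
move: d0; rewrite le_eqVlt => /orP[/eqP<-|d0].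
  have [m1 m2] := st0; apply: (stationary_has_density (mu 0) m1 xi Tmap) => // x.
  by rewrite /I01/= in_itv/=; exact: Tmap_01.
have hd : 0 < d < dbar by rewrite d0.
have [m1 m2] := std d hd.
apply: (stationary_has_density (mu d) m1 xi (taud S d)) => //; first exact: measurable_taud.
move=> x Ix; rewrite -taudE//; apply: Dpert01; first by rewrite ltW.
by move: Ix; rewrite /I01/= in_itv/=; exact: Tmap_01.
Qed.

Lemma linear_response :
  let f := fun delta => dens (mu delta) in
  let L := LnoiseL1 xi Tmap in
  let LTf0 := dens (transfer Tmap (mu 0)) in
  [/\ (forall delta, 0 <= delta < dbar -> has_density (mu delta)),
      has_density (transfer Tmap (mu 0)),
      (forall h, zero_average h -> exists r, is_neumann_sum L h r) &
      exists2 nu : {charge set (measurableTypeR R) -> \bar R},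
        distributional_derivative (fun x => - LTf0 x * S x) nu &
        let h := dens (reflconv (rho_unif xi) nu) in
        [/\ has_density (reflconv (rho_unif xi) nu), zero_average h &
            L1norm (fun x => (f delta x - f 0 x) / delta - resolvent1 L h x)
              @[delta --> 0^'+] --> 0%E ] ].
Proof.
move=> f L LTf0; have [N [theta [th1 ctr]]] := contraction.
have [V [h1 [h2 hI]]] := @inverse_branches_exist R.
have [m1 m2] := st0.
have [e0 e00 Se0] := S_near_max S hS.
(* The cap 1/10 keeps the upper end [Tmax - e1 / 2] of the window above its lower end xi / 2. *)
pose e1 := Num.min e0 (1 / 10).
have e10 : 0 < e1 by rewrite lt_min e00 divr_gt0.
have e11 : e1 <= 1 / 10 by rewrite ge_min lexx orbT.
have Se1 (x : R) : 0 <= x <= 1 -> `|x - Tmax| <= e1 -> S x = 0.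
  by move=> x01 xe; apply: Se0 => //; rewrite (le_trans xe)// ge_min lexx.
have [nu [n1 n2 n3 n4]] := nu_exists xi (mu 0) xi_gt0 xi_b xi_m m1 m2 V h1 h2 hI S hS e1 e10 e11 Se1.
split.
- exact: densities_exist.
- exists (ghat xi (mu 0) V h1 h2).
  exact: (transfer_density xi (mu 0) xi_gt0 xi_b (ltW xi_m) m1 m2 V h1 h2 hI).
- by move=> h h0; exact: (neumann_sum_exists xi xi_gt0 Tmap mT tin N theta th1 ctr h h0).
exists nu => // h.
have hn : has_density (reflconv (rho_unif xi) nu) by eexists; exact: n2.
have hd : is_density (reflconv (rho_unif xi) nu) h by exact: dens_spec.
pose hs y := xi^-1 * (flux xi (mu 0) V h1 h2 S e1 (y + xi / 2) - flux xi (mu 0) V h1 h2 S e1 (y - xi / 2)).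
have bnd01 := (@Tb_bounds R, @Tmax_bounds R).
have hs_out y : ~ I01 y -> hs y = 0.
  move=> Iy; rewrite /hs; have [y0|y0] := ltP (y : R) 0.
    by rewrite !(flux_lo xi (mu 0) xi_gt0 xi_b xi_m m1 m2 V h1 h2 hI S e1 e11) ?subrr ?mulr0//; have := xi_gt0; lra.
  have y1 : 1 < (y : R) by rewrite ltNge; apply/negP => y1; apply: Iy; rewrite /I01/= in_itv/= y0.
  by rewrite !(flux_hi xi (mu 0) V h1 h2 S e1 e10 e11 Se1) ?subrr ?mulr0//; have := xi_gt0; have := xi_m; have := e10; lra.
have hsE : ext01 hs = hs by exact: ext01_fixed.
have ihh : integ (ext01 h) by apply/L1_integ; case: hd.
have hhs : \int[leb]_x `|ext01 h x - hs x| = 0.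
  by have := is_density_unique _ _ _ hd n2; rewrite -/hs hsE.
have h0 : zero_average h.
  by apply/zero_averageE; split => //; rewrite (Rint_eq _ _ ihh n3 hhs).
split => //.
have [ir r0 rfix] := resolvent1_spec xi xi_gt0 Tmap mT tin N theta th1 ctr h h0.
set r := resolvent1 _ _ in ir r0 rfix *.
have [v0d iv0 v0o v0n [v01 v0f]] := stationary_density xi xi_gt0 Tmap (mu 0) mT tin m1 m2.
set v0 := Kop _ _ _ in v0d iv0 v0o v0n v01 v0f.
pose K := N%:R / (1 - theta).
have K0 : 0 <= K by rewrite divr_ge0// subr_ge0 ltW.
have rb := resolvent_bound xi xi_gt0 Tmap mT N theta th1 ctr.
(* [resolvent_bound] is applied to w = (v - v0) / d - r. Up to null terms, w - P w is (Pd v0 - P v0)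
   / d - h, small by [response_pointwise], plus (Pd - P)(v - v0) / d, of order d since both Pd - P
   and v - v0 are. *)
have key e : 0 < e -> exists2 dl, 0 < dl & forall d, 0 < d -> d < dl ->
    L1norm (fun x => (f d x - f 0 x) / d - r x) = 
      (\int[leb]_x `|(ext01 (f d) x - ext01 (f 0) x) / d - ext01 r x|)%:E /\
    \int[leb]_x `|(ext01 (f d) x - ext01 (f 0) x) / d - ext01 r x| <=
      K * (4 * xi^-1 ^+ 2 * K * d + xi^-1 * (e + e)).
  move=> e_gt0.
  have [dl dl0 hdl] := response_pointwise xi (mu 0) xi_gt0 xi_b xi_m m1 m2 V h1 h2 hI S hS e1 e10 e11 Se1 e e_gt0.
  exists (Num.min (Num.min dl dbar) (Num.min (Tb - xi / 2) (1 - xi / 2 - Tmax))).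
    by rewrite !lt_min dl0 dbar_gt0 !subr_gt0 xi_b/= xi_m.
  move=> d d0; rewrite !lt_min => /andP[/andP[ddl ddb] /andP[db dm]].
  have dR : 0 < d < dbar by rewrite d0.
  have [q1 q2] := std d dR.
  have mt := measurable_taud S hS d.
  have td x : I01 x -> xi / 2 <= (taud S d x : R) <= 1 - xi / 2.
    by apply: taud_in => //; exact: ltW.
  have [vd ivd vo vn [vi vf]] := stationary_density xi xi_gt0 (taud S d) (mu d) mt td q1 q2.
  set v := Kop _ _ _ in vd ivd vo vn vi vf.
  have fd : is_density (mu d) (f d) by apply: dens_spec; apply: densities_exist; rewrite ltW.
  have f0' : is_density (mu 0) (f 0) by apply: dens_spec; apply: densities_exist; rewrite lexx.
  have iFd : integ (ext01 (f d)) by apply/L1_integ; case: fd.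
  have iF0 : integ (ext01 (f 0)) by apply/L1_integ; case: f0'.
  have ed : \int[leb]_x `|ext01 (f d) x - v x| = 0.
    by have := is_density_unique _ _ _ fd vd; rewrite (ext01_fixed v).
  have ez : \int[leb]_x `|ext01 (f 0) x - v0 x| = 0.
    by have := is_density_unique _ _ _ f0' v0d; rewrite (ext01_fixed v0).
  have eE x : ext01 (fun x => (f d x - f 0 x) / d - r x) x =
      (ext01 (f d) x - ext01 (f 0) x) / d - ext01 r x.
    rewrite /ext01 !patchE; case: ifP => // _; by rewrite subrr mul0r subrr.
  have iquot (u1 u2 : T_R -> R) : integ u1 -> integ u2 -> integ (fun x => (u1 x - u2 x) / d).
    by move=> i1 i2; under eq_fun do rewrite mulrC; apply: integZ; exact: integB.
  have iE : integ (fun x => (ext01 (f d) x - ext01 (f 0) x) / d - ext01 r x).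
    by apply: integB => //; exact: iquot.
  split.
    rewrite L1normE; last by apply/L1_integ; rewrite (funext eE).
    by congr EFin; apply: eq_Rintegral => x _; rewrite eE.
  pose w x := (v x - v0 x) / d - ext01 r x.
  have iw : integ w by apply: integB => //; exact: iquot.
  have wo x : ~ I01 x -> w x = 0 by move=> Ix; rewrite /w vo// v0o// ext01_out// subrr mul0r subrr.
  have wi : \int[leb]_x w x = 0.
    rewrite RintB//; last exact: iquot.
    rewrite r0 subr0; under eq_Rintegral do rewrite mulrC.
    by rewrite RintZ ?RintB ?vi ?v01 ?subrr ?mulr0//; exact: integB.
  have -> : \int[leb]_x `|(ext01 (f d) x - ext01 (f 0) x) / d - ext01 r x| = \int[leb]_x `|w x|.
    apply: Rint_norm_eq => //; apply/eqP; rewrite eq_le Rint_norm_ge0 andbT.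
    apply: (@le_trans _ _ (d^-1 * (\int[leb]_x `|ext01 (f d) x - v x| +
        \int[leb]_x `|ext01 (f 0) x - v0 x|))); last by rewrite ed ez addr0 mulr0.
    rewrite -RintD; [|exact/integ_norm/integB|exact/integ_norm/integB].
    rewrite -RintZ; last by apply: integD; apply: integ_norm; exact: integB.
    apply: Rint_le.
    - exact: (integ_norm _ (integB _ _ iE iw)).
    - by apply: integZ; apply: integD; apply: integ_norm; exact: integB.
    move=> x; rewrite /w (_ : _ - _ = d^-1 * ((ext01 (f d) x - v x) - (ext01 (f 0) x - v0 x))); last by ring.
    rewrite normrM gtr0_norm ?invr_gt0// ler_wpM2l ?invr_ge0 ?(ltW d0)//; exact: ler_normB.
  apply: (le_trans (rb w iw wo wi)); rewrite -/K ler_wpM2l//.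
  pose P u := Pop xi Tmap u; pose Pd u := Pop xi (taud S d) u.
  have iP u : integ u -> integ (P u) by exact: Pop_integ.
  have iPd u : integ u -> integ (Pd u) by exact: Pop_integ.
  have ivv : integ (fun x => v x - v0 x) by exact: integB.
  have PB u1 u2 x : integ u1 -> integ u2 -> P (fun x => u1 x - u2 x) x = P u1 x - P u2 x by exact: PopB.
  have PdB u1 u2 x : integ u1 -> integ u2 -> Pd (fun x => u1 x - u2 x) x = Pd u1 x - Pd u2 x by exact: PopB.
  have dist x : `|taud S d x - Tmap x : R| <= d by apply: taud_dist => //; exact: ltW.
  (* By stationarity (Id - P)(v - v0) equals (Pd - P) v up to null terms, and [Pop_diff] bounds the
     latter by 2 d / xi. *)
  have b1 : \int[leb]_x `|v x - v0 x| <= K * (2 * xi^-1 * d).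
    apply: (le_trans (rb (fun x => v x - v0 x) ivv _ _)).
    - by move=> x Ix; rewrite vo// v0o// subrr.
    - by rewrite RintB// vi v01 subrr.
    rewrite -/K ler_wpM2l//.
    have pd := Pop_diff xi xi_gt0 (taud S d) Tmap d v mt mT dist ivd.
    rewrite vn mulr1 in pd; apply: (le_trans _ pd).
    have k1 := integ_norm _ (integB _ _ (iPd _ ivd) (iP _ ivd)).
    have k2 := integ_norm _ (integB _ _ ivd (iPd _ ivd)).
    have k3 := integ_norm _ (integB _ _ iv0 (iP _ iv0)).
    have k12 := integD _ _ k1 k2; have k123 := integD _ _ k12 k3.
    apply: (@le_trans _ _ (\int[leb]_x (`|Pd v x - P v x| + `|v x - Pd v x| + `|v0 x - P v0 x|))); last first.
      by rewrite (RintD _ _ k12 k3) (RintD _ _ k1 k2) vf v0f !addr0.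
    apply: Rint_le; [exact: (integ_norm _ (integB _ _ ivv (iP _ ivv)))|exact: k123|].
    move=> x; rewrite -/(P _ _) PB//.
    have -> : v x - v0 x - (P v x - P v0 x) = (Pd v x - P v x) + (v x - Pd v x) - (v0 x - P v0 x) by ring.
    apply: (le_trans (ler_normB _ _)); rewrite lerD2r; exact: ler_normD.
  have b2 : \int[leb]_x `|Pd (fun x => v x - v0 x) x - P (fun x => v x - v0 x) x| <=
      2 * xi^-1 * d * (K * (2 * xi^-1 * d)).
    apply: (le_trans (Pop_diff xi xi_gt0 (taud S d) Tmap d _ mt mT dist ivv)).
    by rewrite ler_wpM2l// !mulr_ge0 ?invr_ge0 ?ltW.
  pose ee x := (Pd v0 x - P v0 x) / d - hs x.
  have eo x : ~ I01 x -> ee x = 0.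
    move=> Ix; rewrite /ee hs_out// /P /Pd.
    have z1 : Pop xi (taud S d) v0 x = 0 by apply: Pop_out.
    have z2 : Pop xi Tmap v0 x = 0 by apply: Pop_out.
    by rewrite z1 z2 subrr mul0r subrr.
  have iee : integ ee by apply: integB => //; apply: iquot; [exact: iPd|exact: iP].
  have b3 : \int[leb]_x `|ee x| <= xi^-1 * (e + e).
    have -> : xi^-1 * (e + e) = \int[leb]_y (xi^-1 * (e + e) * \1_(`[0, 1]) y).
      by rewrite RintZ ?Rint_indic ?subr0 ?mulr1//; exact: integ_indic.
    apply: Rint_le; [exact: integ_norm|by apply: integZ; exact: integ_indic|move=> y].
    have [Iy|Iy] := pselect (I01 y); last by rewrite eo// normr0 indicE memNset ?mulr0.
    by rewrite indicE mem_set// mulr1; exact: (hdl d d0 ddl y).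
  (* A1 to A4 have integral 0: they record stationarity of v and v0, the resolvent equation, and the
     choice of the representative h. The estimate is carried by A5 and ee. *)
  pose A1 x := d^-1 * `|v x - Pd v x|. pose A2 x := d^-1 * `|v0 x - P v0 x|.
  pose A3 x := `|ext01 r x - P (ext01 r) x - ext01 h x|. pose A4 x := `|ext01 h x - hs x|.
  pose A5 x := d^-1 * `|Pd (fun x => v x - v0 x) x - P (fun x => v x - v0 x) x|.
  have i1 : integ A1 by apply: integZ; apply: integ_norm; apply: integB => //; exact: iPd.
  have i2 : integ A2 by apply: integZ; apply: integ_norm; apply: integB => //; exact: iP.
  have i3 : integ A3 by apply: integ_norm; apply: integB => //; apply: integB => //; exact: iP.
  have i4 : integ A4 by apply: integ_norm; exact: integB.
  have i5 : integ A5 by apply: integZ; apply: integ_norm; apply: integB; [exact: iPd|exact: iP].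
  have i6 : integ (fun x => `|ee x|) by exact: integ_norm.
  have c1 : \int[leb]_x A1 x = 0.
    by rewrite /A1 RintZ ?vf ?mulr0//; apply: integ_norm; apply: integB => //; exact: iPd.
  have c2 : \int[leb]_x A2 x = 0.
    by rewrite /A2 RintZ ?v0f ?mulr0//; apply: integ_norm; apply: integB => //; exact: iP.
  have c5 : \int[leb]_x A5 x <= 4 * xi^-1 ^+ 2 * K * d.
    rewrite /A5 RintZ; last by apply: integ_norm; apply: integB; [exact: iPd|exact: iP].
    rewrite mulrC ler_pdivrMr//; apply: (le_trans b2); apply/eq_ler; ring.
  have s2 := integD _ _ i1 i2; have s3 := integD _ _ s2 i3; have s4 := integD _ _ s3 i4.
  have s5 := integD _ _ s4 i5; have s6 := integD _ _ s5 i6.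
  have c3 : \int[leb]_x A3 x = 0 by exact: rfix.
  have c4 : \int[leb]_x A4 x = 0 by exact: hhs.
  have step : \int[leb]_x `|w x - P w x| <=
      \int[leb]_x (A1 x + A2 x + A3 x + A4 x + A5 x + `|ee x|).
    apply: Rint_le.
    - by apply: integ_norm; apply: integB => //; exact: iP.
    - exact: s6.
    move=> x.
    have Pw : P w x = d^-1 * (P v x - P v0 x) - P (ext01 r) x.
      rewrite /w PB//; last exact: iquot.
      congr (_ - _); rewrite -PB//.
      have -> : (fun x => (v x - v0 x) / d) = (fun x => d^-1 * (v x - v0 x)).
        by apply/funext => z; rewrite mulrC.
      by rewrite /P PopZ.
    have PdE := PdB v v0 x ivd iv0; have PE := PB v v0 x ivd iv0.
    have -> : w x - P w x = d^-1 * (v x - Pd v x) - d^-1 * (v0 x - P v0 x)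
        - (ext01 r x - P (ext01 r) x - ext01 h x) - (ext01 h x - hs x)
        + d^-1 * (Pd (fun x => v x - v0 x) x - P (fun x => v x - v0 x) x) + ee x.
      by rewrite Pw PdE PE /w /ee; field; rewrite gt_eqF.
    have dV : 0 < d^-1 by rewrite invr_gt0.
    have nm z : d^-1 * `|z| = `|d^-1 * z| by rewrite normrM (gtr0_norm dV).
    rewrite /A1 /A2 /A3 /A4 /A5 !nm.
    apply: (le_trans (ler_normD _ _)); rewrite lerD2r.
    apply: (le_trans (ler_normD _ _)); rewrite lerD2r.
    apply: (le_trans (ler_normB _ _)); rewrite lerD2r.
    apply: (le_trans (ler_normB _ _)); rewrite lerD2r.
    exact: ler_normB.
  apply: (le_trans step).
  rewrite (RintD _ _ s5 i6) (RintD _ _ s4 i5) (RintD _ _ s3 i4) (RintD _ _ s2 i3) (RintD _ _ i1 i2).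
  by rewrite c1 c2 c3 c4 !add0r; exact: lerD.
(* With d < e / C, the bound of [key] for e / C becomes (C - 1) e / C; the added 1 makes C
   positive. *)
pose C := K * (4 * xi^-1 ^+ 2 * K + 2 * xi^-1) + 1.
have C0 : 0 < C.
  have xV : 0 <= xi^-1 by rewrite invr_ge0 ltW.
  apply: ltr_wpDl => //; apply: mulr_ge0 => //; apply: addr_ge0; last exact: mulr_ge0.
  by apply: mulr_ge0 => //; apply: mulr_ge0 => //; exact: exprn_ge0.
have pos0 : \forall d \near (0 : R)^'+, 0 < d by exact: nbhs_right_gt.
apply/fine_cvgP; split.
  have [dl dl0 hdl] := key 1 ltr01.
  have small : \forall d \near (0 : R)^'+, d < dl by exact: nbhs_right_lt.
  near=> d.
  have d0 : 0 < d by near: d.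
  have ddl : d < dl by near: d.
  by have [-> _] := hdl d d0 ddl.
apply/cvgrPdist_le => e e_gt0; have eC : 0 < e / C by rewrite divr_gt0.
have [dl dl0 hdl] := key (e / C) eC.
have small : \forall d \near (0 : R)^'+, d < dl by exact: nbhs_right_lt.
have small' : \forall d \near (0 : R)^'+, d < e / C by exact: nbhs_right_lt.
near=> d.
have d0 : 0 < d by near: d.
have ddl : d < dl by near: d.
have dC : d < e / C by near: d.
have [E hb] := hdl d d0 ddl.
rewrite sub0r normrN /= E /= ger0_norm ?Rint_norm_ge0//; apply: (le_trans hb).
have A0 : 0 <= 4 * xi^-1 ^+ 2 * K by apply: mulr_ge0 => //; apply: mulr_ge0 => //; apply: exprn_ge0; rewrite invr_ge0 ltW.
apply: (@le_trans _ _ (K * (4 * xi^-1 ^+ 2 * K * (e / C) + xi^-1 * (e / C + e / C)))).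
  by rewrite ler_wpM2l// lerD2r ler_wpM2l// ltW.
have -> : K * (4 * xi^-1 ^+ 2 * K * (e / C) + xi^-1 * (e / C + e / C)) = e / C * (C - 1).
  by rewrite /C; ring.
have -> : e / C * (C - 1) = e - e / C by rewrite mulrBr mulr1 divfK// gt_eqF.
by rewrite gerBl ltW.
Unshelve. all: by end_near.
Qed.

End linear_response.

Theorem proposition50 (R : realType) (xi : R)
    (hxi : xi = 860 / 10 ^+ 5 \/ xi = 129 / 10 ^+ 6)
    (S : R -> R) (hS : admissible_direction S)
    (dbar : R) (dbar_gt0 : 0 < dbar)
    (hD : forall delta, 0 <= delta < dbar -> bilipschitz_homeo01 (Dpert S delta))
    (mu : R -> probability (measurableTypeR R) R)
    (hmu0 : stationary01 xi Tmap (mu 0))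
    (hmu : forall delta, 0 < delta < dbar ->
       stationary01 xi (Tpert S delta) (mu delta)) :
  let f := fun delta => dens (mu delta) in
  let L := LnoiseL1 xi Tmap in
  let LTf0 := dens (transfer Tmap (mu 0)) in
  [/\ (forall delta, 0 <= delta < dbar -> has_density (mu delta)),
      has_density (transfer Tmap (mu 0)),
      (forall h, zero_average h -> exists r, is_neumann_sum L h r) &
      exists2 nu : {charge set (measurableTypeR R) -> \bar R},
        distributional_derivative (fun x => - LTf0 x * S x) nu &
        let h := dens (reflconv (rho_unif xi) nu) in
        [/\ has_density (reflconv (rho_unif xi) nu), zero_average h &
            L1norm (fun x => (f delta x - f 0 x) / delta - resolvent1 L h x)
              @[delta --> 0^'+] --> 0%E ] ].
Proof.
move=> f L LTf0.
exact: (linear_response xi S dbar mu hxi hS dbar_gt0 hD hmu0 hmu).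
Qed.
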